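(* Let $\sigma$ be a nonnegative integer, $J\subset\mathbb R$ a bounded interval, and let $\{f_\tau\}_\tau$ be a sequence of functions supported in $J$ and such that $$F:=\Big(\sum_\tau|f_\tau|^2\Big)^{1/2}\in L\log^{\frac{\sigma+1}{2}}L(J).$$ (1) If $2^k\ge|J|^{-1}$, there exist functions $\{f_{\tau,k}\}_{\tau,k}$ with $\operatorname{supp}f_{\tau,k}\subset 4J$ such that $$|S_kf_\tau|\lesssim\phi_{2^{-k}}*f_{\tau,k},\qquad\left\|\Big(\sum_{\tau,\,2^k\ge|J|^{-1}}|f_{\tau,k}|^2\Big)^{1/2}\right\|_{L\log^{\frac{\sigma}{2}}L(J)}\lesssim\|F\|_{L\log^{\frac{\sigma+1}{2}}L(J)}.$$ (2) If in addition $\int f_\tau=0$ for all $\tau$, then, for $2^k<|J|^{-1}$, there exist functions $\{f_{\tau,k}\}_{\tau,k}$ satisfying $|S_kf_\tau|\lesssim\phi_{2^{-k}}*f_{\tau,k}$, and for every $\alpha>0$ $$\int_{\mathbb R}\Phi_{\frac{\sigma}{2}}\left(\alpha^{-1}\Big(\sum_\tau\sum_{2^k<|J|^{-1}}|f_{\tau,k}|^2\Big)^{1/2}\right)\lesssim\frac{1}{|J|}\int_J\Phi_{\frac{\sigma}{2}}\left(\frac{|F|}{\alpha}\right).$$ In this case, i.e. for $2^k<|J|^{-1}$, nothing is claimed about the supports of the functions $f_{\tau,k}$.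
   Context: For $s\ge0$, $\Phi_s(t)=t[\log(e+t)]^s$, $t\ge0$. For a bounded interval $K$, $L\log^sL(K)$ carries the normalized Luxemburg norm $\|g\|_{L\log^sL(K)}=\inf\{t>0:\frac1{|K|}\int_K\Phi_s(|g|/t)\le1\}$. $\phi(x)=(1+|x|^2)^{-3/4}$ and $\phi_t(x)=t^{-1}\phi(x/t)$ for $t>0$. $4J$ is the interval concentric with $J$ of length $4|J|$. The index $k$ ranges over $\mathbb Z$. $S_k$ is a smooth Littlewood–Paley projection at frequency scale $2^k$: the Fourier multiplier operator with symbol $\eta(2^{-k}\xi)$, where $\eta\in C_c^\infty(\mathbb R)$ is a fixed function with $0\le\eta\le1$, $\eta=1$ on $\{1\le|\xi|\le2\}$ and $\operatorname{supp}\eta\subset\{\frac12\le|\xi|\le\frac52\}$; thus the symbol equals $1$ on $L_k=[-2^{k+1},-2^k)\cup(2^k,2^{k+1}]$ and is supported in the two-fold concentric enlargement of the two intervals of $L_k$. The notation $A\lesssim B$ means $A\le CB$ with a constant $C$ depending only on $\sigma$ and on the fixed function $\eta$; in particular $C$ does not depend on $J$, $\{f_\tau\}$, $\tau$, $k$ or $\alpha$.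
   Formalization: The inequality in (2) is false for large |J|, since its two sides scale differently; it is proved with the factor 1/|J| also on the left, which implies the printed bound when |J|≤1 and gives it with an extra factor |J| on the right when |J|>1. *)

(* Defs.v *)
From HB Require Import structures.
From mathcomp Require Import all_boot all_order all_algebra.
From mathcomp Require Import all_classical all_reals all_analysis.
From mathcomp.real_closed Require Import complex.

Set Implicit Arguments.
Unset Strict Implicit.
Unset Printing Implicit Defensive.

Import Order.TTheory GRing.Theory Num.Theory.
Import numFieldNormedType.Exports.

Local Open Scope classical_set_scope.
Local Open Scope ring_scope.

(* The interval with endpoints a and b, for each of the four choices of open or
   closed endpoints. The left endpoint belongs to it iff l = true, the right
   one iff r = false. *)
Definition itvJ {R : realType} (l r : bool) (a b : R) : set R :=
  [set` Interval (BSide l a) (BSide r b)].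

(* Its concentric enlargement of length 4 (b - a). *)
Definition itv4J {R : realType} (l r : bool) (a b : R) : set R :=
  let c := (a + b) / 2 in
  itvJ l r (c - 2 * (b - a)) (c + 2 * (b - a)).

Definition supported_in {R : realType} {V : zmodType} (f : R -> V) (A : set R) :=
  forall x, ~ A x -> f x = 0.

Section orlicz.
Context {R : realType}.
Local Notation mu := (@lebesgue_measure R).

Definition Phi (s t : R) : R := t * (ln (expR 1 + t) `^ s).

(* Phi on [0, +oo], with Phi(+oo) = +oo: square functions may be infinite. *)
Definition ePhi (s : R) (t : \bar R) : \bar R := er_map (Phi s) t.

(* Normalized Luxemburg norm; it is +oo when no t is admissible, i.e. when g is
   not in L (log L)^s (K). *)
Definition luxemburg (s : R) (K : set R) (g : R -> \bar R) : \bar R :=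
  ereal_inf [set t%:E | t in [set t : R | 0 < t /\
    (((fine (mu K))^-1)%:E *
       \int[mu]_(x in K) ePhi s (`|g x| * (t^-1)%:E) <= 1)%E]].

Definition square_function {I : choiceType} (D : set I) (u : I -> R -> R)
    (x : R) : \bar R :=
  sqrte (\esum_(i in D) ((u i x) ^+ 2)%:E).

End orlicz.

Section complex_valued.
Context {R : realType}.
Local Notation mu := (@lebesgue_measure R).

Definition cmod (z : R[i]) : R := ComplexField.Normc.normc z.

Definition cmeasurable (f : R -> R[i]) : Prop :=
  measurable_fun [set: R] (fun x => complex.Re (f x)) /\
  measurable_fun [set: R] (fun x => complex.Im (f x)).

(* Meaningful for integrable f. *)
Definition cintegral (f : R -> R[i]) : R[i] :=
  Complex (\int[mu]_x complex.Re (f x))%R (\int[mu]_x complex.Im (f x))%R.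

Definition cexp (t : R) : R[i] := Complex (cos t) (sin t).

Definition fourier (f : R -> R[i]) (xi : R) : R[i] :=
  cintegral (fun x => f x * cexp (- (2 * pi * x * xi))).

(* For integrable f and compactly supported continuous m the integral below
   converges absolutely, hence this is the multiplier operator, pointwise. *)
Definition fourier_multiplier (m : R -> R) (f : R -> R[i]) (x : R) : R[i] :=
  cintegral (fun xi => (m xi)%:C%C * fourier f xi * cexp (2 * pi * x * xi)).

Definition LP_symbol (eta : R -> R) : Prop :=
  [/\ forall (n : nat) (x : R), derivable (derive1n n eta) x 1,
      forall x, 0 <= eta x <= 1,
      forall x, 1 <= `|x| <= 2 -> eta x = 1 &
      (* the target set is closed, so this bounds the closed support *)
      forall x, eta x != 0 -> 1 / 2 <= `|x| <= 5 / 2].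

Definition LP_proj (eta : R -> R) (k : int) : (R -> R[i]) -> R -> R[i] :=
  fourier_multiplier (fun xi => eta ((2 : R) ^ (- k) * xi)).

End complex_valued.

Section kernel.
Context {R : realType}.
Local Notation mu := (@lebesgue_measure R).

Definition phi (x : R) : R := (1 + x ^+ 2) `^ (- (3 / 4)).

Definition phi_scaled (t x : R) : R := t^-1 * phi (x / t).

(* |S_k f| <= C phi_{2^-k} * g everywhere, the convolution being absolutely
   convergent: outside that case Rintegral takes junk values. *)
Definition LP_dominated (eta : R -> R) (C : R) (k : int) (f : R -> R[i])
    (g : R -> R) : Prop :=
  forall x : R,
    mu.-integrable [set: R]
      (fun y => (phi_scaled ((2 : R) ^ (- k)) (x - y) * g y)%:E) /\
    cmod (LP_proj eta k f x) <=
      C * (\int[mu]_y (phi_scaled ((2 : R) ^ (- k)) (x - y) * g y))%R.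

End kernel.

(* Main.v *)
(** Let [A_h] be the average over a window of radius [h] and
    [D_h f = (A_(h/2) f (. + h/2) - A_(h/2) f (. - h/2)) / 2] the corresponding
    Haar-type difference.  The multiplier of [D_h], with [h = 2^-k / 4], does not
    vanish on the support of the symbol of [S_k], so [S_k f] is the convolution of
    [D_h f] with a kernel of decay [(1 + x^2)^-1] at scale [2^-k], and [S_k] may be
    replaced by [D_h].

    For high frequencies, cut [J] into the levels [E_j] where [F] is about
    [t0 2^j], with [t0] close to the Luxemburg norm of [F].  The part of [|D_h f|]
    coming from [E_j] is carried back to [E_j] by
    [1_(E_j) A_h (|D_h (f 1_(E_j))| / A_h 1_(E_j))], at bounded cost for [phi]
    since [phi_(2^-k)] is essentially constant at scale [h].  The square function of
    these pieces is estimated in L^2(E_j) by two Bellman inequalities, for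
    [u^2 / w] and for the entropy [- w ln w]; the entropy is responsible for a loss
    [1 + j], up to an exponentially small error [16^-j |J|].  Comparing
    [Phi_(sigma/2)] with a quadratic function on each level turns this
    into the loss of half a power of the logarithm.

    For low frequencies and mean zero [f], [D_h f] vanishes away from three
    intervals of length [|J|], so that a multiple [2^k |J|] of [|f|] dominates,
    and these factors are square summable in [k]. *)
Require Import Defs.
From HB Require Import structures.
From mathcomp Require Import all_boot all_order all_algebra.
From mathcomp Require Import all_classical all_reals all_analysis.
From mathcomp.real_closed Require Import complex.
From mathcomp Require Import measurable_realfun ring lra.

Set Implicit Arguments.
Unset Strict Implicit.
Unset Printing Implicit Defensive.

Import Order.TTheory GRing.Theory Num.Theory.
Import numFieldNormedType.Exports.

Local Open Scope classical_set_scope.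
Local Open Scope ring_scope.

(** * Window averages *)

Section translation.
Context {R : realType}.
Notation mu := (@lebesgue_measure R).

Lemma lebesgue_measure_shift (c : R) (A : set R) : measurable A ->
  pushforward mu ((fun x => x + c) : _ -> measurableTypeR R) A = mu A.
Proof.
move=> mA; have mc : measurable_fun [set: R] (fun x => x + c).
  exact: measurable_funD.
pose mcP := isMeasurableFun.Build _ _ (measurableTypeR R) (measurableTypeR R)
  (fun x => x + c) mc.
pose F : {mfun measurableTypeR R >-> measurableTypeR R} :=
  HB.pack (fun x : R => x + c) mcP.
apply/esym.
apply: (@lebesgue_measure_unique R (pushforward mu F : {measure set _ -> \bar R})) => //.
move=> _ [[a b]] _ <-.
change (mu `]a, b] = mu ((fun x : R => x + c) @^-1` `]a, b])).
have -> : (fun x => x + c) @^-1` `]a, b]%classic = `](a - c), (b - c)]%classic.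
  by apply/seteqP; split => x /=; rewrite !in_itv/= ltrBlDr lerBrDr.
rewrite !lebesgue_measure_itv/= !lte_fin ltrD2r.
by case: ifPn => // _; rewrite -!EFinB opprB addrA subrK.
Qed.

Lemma ge0_integral_shift (c : R) (H : R -> \bar R) :
  measurable_fun [set: R] H -> (forall x, 0 <= H x)%E ->
  (\int[mu]_x H (x + c)%R = \int[mu]_x H x)%E.
Proof.
move=> mH H0.
have mc : measurable_fun [set: R] (fun x => x + c).
  exact: measurable_funD.
have := @ge0_integral_pushforward _ _ (measurableTypeR R) (measurableTypeR R) R (fun x => x + c) mc mu setT H measurableT mH (fun x _ => H0 x).
rewrite preimage_setT => <-.
by apply: eq_measure_integral => A mA _; exact/lebesgue_measure_shift.
Qed.

End translation.

Section windows.
Context {R : realType}.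
Notation mu := (@lebesgue_measure R).
Implicit Types (f g : R -> R) (a b : R).

Definition window a b f y : R := \int[mu]_(x in `[y + a, y + b[) f x.

Definition window_indic a b (y x : R) : R := (y + a <= x < y + b)%R%:R.

Lemma window_indic_ge0 a b y x : 0 <= window_indic a b y x.
Proof. exact: ler0n. Qed.

Lemma normr_window_indic_le a b f y x :
  (`|(f x * window_indic a b y x)%:E| <= `|(f x)%:E|)%E.
Proof.
rewrite lee_fin normrM ler_piMr ?normr_ge0//.
by rewrite /window_indic; case: (_ <= _ < _); rewrite ?normr1 ?normr0.
Qed.

Lemma measurable_window_indic a b :
  measurable_fun [set: R * R] (fun p : R * R => window_indic a b p.1 p.2).
Proof.
have mD (c : R) : measurable_fun [set: R * R] (fun p : R * R => p.1 + c).
  exact: measurable_funD.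
have m1 : measurable_fun [set: R * R] (fun p : R * R => p.1 + a <= p.2 < p.1 + b).
  apply: (@measurable_and _ _ _ (fun p : R * R => p.1 + a <= p.2)
    (fun p : R * R => p.2 < p.1 + b)).
  - by apply: measurable_fun_ler.
  - by apply: measurable_fun_ltr.
apply: (eq_measurable_fun
  (fun p : R * R => if p.1 + a <= p.2 < p.1 + b then 1 else 0 : R)).
  by move=> p _; rewrite /window_indic; case: ifP.
by apply: measurable_fun_ifT.
Qed.

Lemma measurable_window_indicr a b y :
  measurable_fun [set: R] (window_indic a b y).
Proof.
exact: (measurableT_comp (measurable_window_indic a b) (pair1_measurable y)).
Qed.

Lemma measurable_window_indicl a b x :
  measurable_fun [set: R] (window_indic a b ^~ x).
Proof.
exact: (measurableT_comp (measurable_window_indic a b) (pair2_measurable x)).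
Qed.

Lemma window_indicE a b f y :
  (\int[mu]_(x in `[(y + a)%R, (y + b)%R[) (f x)%:E =
   \int[mu]_x (f x * window_indic a b y x)%R%:E)%E.
Proof.
rewrite integral_mkcond; apply: eq_integral => x _.
rewrite patchE mem_setE in_itv/= /window_indic.
by case: ifPn => _; rewrite ?mulr1 ?mulr0.
Qed.

Lemma dual_window_indicE a b g x :
  (\int[mu]_(y in `](x - b)%R, (x - a)%R]) (g y)%:E =
   \int[mu]_y (g y * window_indic a b y x)%R%:E)%E.
Proof.
rewrite integral_mkcond; apply: eq_integral => y _.
rewrite patchE mem_setE in_itv/= /window_indic ltrBlDr lerBrDr andbC.
by case: ifPn => _; rewrite ?mulr1 ?mulr0.
Qed.

Lemma tonelli_window a b f g :
  measurable_fun [set: R] f -> (forall x, 0 <= f x) ->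
  measurable_fun [set: R] g -> (forall x, 0 <= g x) ->
  (\int[mu]_y ((\int[mu]_(x in `[(y + a)%R, (y + b)%R[) (f x)%:E) * (g y)%:E) =
   \int[mu]_x ((f x)%:E * \int[mu]_(y in `](x - b)%R, (x - a)%R]) (g y)%:E))%E.
Proof.
move=> mf f0 mg g0.
pose H (p : R * R) := (f p.2 * g p.1 * window_indic a b p.1 p.2)%:E.
have mH : measurable_fun [set: R * R] H.
  apply/measurable_EFinP; apply: measurable_funM; last exact: measurable_window_indic.
  by apply: measurable_funM; exact: measurableT_comp.
have H0 p : (0 <= H p)%E by rewrite lee_fin !mulr_ge0 ?window_indic_ge0.
have := @fubini_tonelli _ _ _ _ R mu mu H mH H0 => /=.
rewrite /H/= => E.
transitivity (\int[mu]_x \int[mu]_x0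
   (f x0 * g x * window_indic a b x x0)%R%:E)%E.
  apply: eq_integral => y _.
  rewrite window_indicE.
  rewrite -(@ge0_integralZr _ _ _ mu setT measurableT
    (fun x => (f x * window_indic a b y x)%R%:E)).
  - by apply: eq_integral => x _; rewrite -EFinM mulrAC.
  - apply/measurable_EFinP; apply: measurable_funM; first exact: mf.
    exact: measurable_window_indicr.
  - by move=> x _; rewrite lee_fin mulr_ge0 ?window_indic_ge0.
  - by rewrite lee_fin.
apply: (etrans E); apply: eq_integral => x _.
rewrite dual_window_indicE.
rewrite -(@ge0_integralZl _ _ _ mu setT measurableT
    (fun y => (g y * window_indic a b y x)%R%:E)).
- by apply: eq_integral => y _; rewrite -EFinM mulrA.
- apply/measurable_EFinP; apply: measurable_funM; first exact: mg.
  exact: measurable_window_indicl.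
- by move=> y _; rewrite lee_fin mulr_ge0 ?window_indic_ge0.
- by rewrite lee_fin.
Qed.

Lemma integrable_window_kernel a b f g (M : R) : a <= b ->
  mu.-integrable [set: R] (EFin \o f) ->
  measurable_fun [set: R] g -> (forall y, `|g y| <= M) ->
  (mu \x mu)%E.-integrable [set: R * R]
    (fun p => (f p.2 * g p.1 * window_indic a b p.1 p.2)%R%:E).
Proof.
move=> ab fi mg gM.
have mf : measurable_fun [set: R] f by apply/measurable_EFinP; exact: measurable_int fi.
have M0 : 0 <= M by apply: le_trans (gM 0).
apply/integrable21ltyP.
  apply/measurable_EFinP; apply: measurable_funM; last exact: measurable_window_indic.
  by apply: measurable_funM; exact: measurableT_comp.
apply: (@le_lt_trans _ _ (\int[mu]_x (`|f x|%R%:E * (M * (b - a))%R%:E))%E).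
  apply: ge0_le_integral => //.
  - by move=> x _; apply: integral_ge0.
  - apply: (@measurable_fun_fubini_tonelli_G _ _ _ _ R mu (fun p : R * R =>
      (`|(f p.2 * g p.1 * window_indic a b p.1 p.2)%R%:E|)%E)) => //.
    apply: measurableT_comp => //; apply/measurable_EFinP; apply: measurable_funM; last exact: measurable_window_indic.
    by apply: measurable_funM; exact: measurableT_comp.
  - apply: emeasurable_funM => //; apply/measurable_EFinP.
    exact: measurableT_comp.
  move=> x _ /=.
  have mW : measurable_fun [set: R] (fun y => (window_indic a b y x)%:E).
    by apply/measurable_EFinP; exact: measurable_window_indicl.
  apply: (@le_trans _ _ (\int[mu]_y ((`|f x| * M)%R%:E * (window_indic a b y x)%:E))%E).
    apply: ge0_le_integral => //.
    + have mfg : measurable_fun [set: R] (fun y => f x * g y).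
        by apply: measurable_funM.
      apply/measurable_EFinP; apply: measurableT_comp => //.
      exact (measurable_funM mfg (measurable_window_indicl a b x)).
    + exact (measurable_funeM _ mW).
    + move=> y _ /=; rewrite -EFinM lee_fin !normrM.
      rewrite (ger0_norm (window_indic_ge0 _ _ _ _)).
      by rewrite ler_wpM2r ?window_indic_ge0// ler_wpM2l.
  rewrite ge0_integralZl//; last 2 first.
  - by move=> y _; rewrite lee_fin window_indic_ge0.
  - by rewrite lee_fin mulr_ge0.
  have -> : (\int[mu]_y (window_indic a b y x)%:E = (b - a)%:E)%E.
    transitivity (\int[mu]_(y in `](x - b)%R, (x - a)%R]) cst 1%:E y)%E.
      rewrite (dual_window_indicE a b (cst 1)).
      by apply: eq_integral => y _; rewrite mul1r.
    rewrite integral_cst//= mul1e.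
    rewrite lebesgue_measure_itv/= lte_fin ltrD2l ltrN2.
    case: ltP => [_|ba]; first by rewrite -EFinD; congr (_%:E); lra.
    by congr (_%:E); lra.
  by rewrite -!EFinM mulrA.
rewrite ge0_integralZr//.
- apply: lte_mul_pinfty => //; first exact: integral_ge0.
  + by rewrite ge0_fin_numE ?integral_ge0//; case/integrableP: fi.
  + exact: ltry.
- by apply/measurable_EFinP; exact: measurableT_comp.
- by rewrite lee_fin mulr_ge0// subr_ge0.
Qed.

Lemma EFin_window a b f y : mu.-integrable [set: R] (EFin \o f) ->
  (window a b f y)%:E = (\int[mu]_(x in `[(y + a)%R, (y + b)%R[) (f x)%:E)%E.
Proof.
move=> fi; rewrite /window /Rintegral fineK//.
apply: integrable_fin_num => //.
by apply: (integrableS _ _ _ fi).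
Qed.

Lemma measurable_window a b f : a <= b -> mu.-integrable [set: R] (EFin \o f) ->
  measurable_fun [set: R] (window a b f).
Proof.
move=> ab fi.
have ki := @integrable_window_kernel a b f (cst 1) 1 ab fi
  (@measurable_cst _ _ _ _ _ _) _.
have {}ki := ki ltac:(by move=> y; rewrite normr1).
have := measurable_fubini_F ki; rewrite /fubini_F => mF.
apply/measurable_EFinP; apply: (eq_measurable_fun _ _ mF) => y _ /=.
rewrite EFin_window// window_indicE.
by apply: eq_integral => x _; rewrite mulr1.
Qed.

Lemma fubini_window a b f g (M : R) : a <= b ->
  mu.-integrable [set: R] (EFin \o f) ->
  measurable_fun [set: R] g -> (forall y, `|g y| <= M) ->
  \int[mu]_y (window a b f y * g y) =
  \int[mu]_x (f x * \int[mu]_(y in `]x - b, x - a]) g y).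
Proof.
move=> ab fi mg gM.
have ki := integrable_window_kernel ab fi mg gM.
have mf : measurable_fun [set: R] f by apply/measurable_EFinP; exact: measurable_int fi.
rewrite /Rintegral; congr fine.
have F := Fubini ki.
transitivity (\int[mu]_x \int[mu]_x0
   (f x0 * g x * window_indic a b x x0)%R%:E)%E.
  apply: eq_integral => y _.
  rewrite EFinM (EFin_window a b y fi) window_indicE muleC.
  rewrite -(@integralZl _ _ _ mu setT measurableT
    (fun x => (f x * window_indic a b y x)%R%:E)).
    by apply: eq_integral => x _; rewrite -EFinM; congr (_%:E); ring.
  refine (@le_integrable _ _ _ mu _ measurableT _ _ _ _ fi).
  - apply/measurable_EFinP; apply: measurable_funM; first exact: mf.
    exact: measurable_window_indicr.
  - by move=> x _; exact: normr_window_indic_le.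
apply: (etrans F); apply: eq_integral => x _.
have gi : mu.-integrable `](x - b), (x - a)] (EFin \o g).
  apply: measurable_bounded_integrable.
  - exact: measurable_itv.
  - rewrite /= lebesgue_measure_itv/=; case: ifP => _; last exact: ltry.
    by rewrite -EFinB ltry.
  - exact: measurable_funTS.
  - exists M; split; first exact: num_real.
    by move=> m Mm y _; exact: le_trans (gM y) (ltW Mm).
rewrite EFinM fineK; last exact: integrable_fin_num.
rewrite dual_window_indicE.
rewrite -(@integralZl _ _ _ mu setT measurableT
    (fun y => (g y * window_indic a b y x)%R%:E)).
  by apply: eq_integral => y _; rewrite -EFinM; congr (_%:E); ring.
have gi' := (@integrable_mkcond _ _ _ mu _ (EFin \o g) (measurable_itv `](x - b), (x - a)])).1 gi.
refine (@eq_integrable _ _ _ mu _ measurableT _ _ _ gi').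
move=> y _ /=; rewrite patchE mem_setE in_itv/= /window_indic.
rewrite ltrBlDr lerBrDr andbC.
by case: ifPn => _; rewrite ?mulr1 ?mulr0.
Qed.

End windows.

Section cauchy_schwarz.
Context {R : realType}.
Notation mu := (@lebesgue_measure R).
Implicit Types (f u w : R -> R) (D : set (measurableTypeR R)).

Lemma sqr_le_discr (a b c : R) :
  (forall s, 0 <= a - 2 * s * b + s ^+ 2 * c) -> 0 <= c -> b ^+ 2 <= a * c.
Proof.
move=> H; rewrite le_eqVlt => /predU1P[c0|c0].
  rewrite -c0 mulr0; have [->|b0] := eqVneq b 0; first by rewrite expr0n.
  have := H ((a + 1) / (2 * b)); rewrite -c0 mulr0 addr0.
  have -> : 2 * ((a + 1) / (2 * b)) * b = a + 1 by field.
  by rewrite opprD addNKr => ?; lra.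
have := H (b / c).
have -> : a - 2 * (b / c) * b + (b / c) ^+ 2 * c = (a * c - b ^+ 2) / c.
  by field; exact: lt0r_neq0.
by rewrite pmulr_lge0 ?invr_gt0// subr_ge0.
Qed.

Lemma discr_ge0 (s a b c : R) : 0 <= a -> 0 <= c -> b ^+ 2 <= a * c ->
  0 <= a - 2 * s * b + s ^+ 2 * c.
Proof.
move=> a0; rewrite le_eqVlt => /predU1P[<-|c0] bac.
  move: bac; rewrite mulr0 => b0.
  have /eqP : b ^+ 2 == 0 by rewrite eq_le b0 sqr_ge0.
  by move/eqP; rewrite sqrf_eq0 => /eqP ->; rewrite !mulr0 subr0 addr0.
rewrite -(pmulr_lge0 _ c0).
have -> : (a - 2 * s * b + s ^+ 2 * c) * c = (a * c - b ^+ 2) + (b - s * c) ^+ 2.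
  by ring.
by rewrite addr_ge0 ?sqr_ge0// subr_ge0.
Qed.

Lemma Rintegral_CS D f u w : measurable D ->
  mu.-integrable D (EFin \o f) -> mu.-integrable D (EFin \o u) ->
  mu.-integrable D (EFin \o w) ->
  (forall x, D x -> 0 <= u x) -> (forall x, D x -> 0 <= w x) ->
  (forall x, D x -> f x ^+ 2 <= u x * w x) ->
  (\int[mu]_(x in D) f x) ^+ 2 <=
  (\int[mu]_(x in D) u x) * (\int[mu]_(x in D) w x).
Proof.
move=> mD fi ui wi u0 w0 fuw; apply: sqr_le_discr; last exact: Rintegral_ge0.
move=> s.
have i1 : mu.-integrable D (EFin \o (fun x => 2 * s * f x)).
  exact (integrableZl mD (2 * s) fi).
have i2 : mu.-integrable D (EFin \o (fun x => s ^+ 2 * w x)).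
  exact (integrableZl mD (s ^+ 2) wi).
have i3 : mu.-integrable D (EFin \o (fun x => u x - 2 * s * f x)).
  exact (integrableB mD ui i1).
have <- : \int[mu]_(x in D) (u x - 2 * s * f x + s ^+ 2 * w x) =
  (\int[mu]_(x in D) u x) - 2 * s * (\int[mu]_(x in D) f x) +
  s ^+ 2 * (\int[mu]_(x in D) w x).
  rewrite (RintegralD mD i3 i2) (RintegralB mD ui i1).
  by rewrite (RintegralZl _ mD fi) (RintegralZl _ mD wi).
by apply: Rintegral_ge0 => x Dx; apply: discr_ge0; [exact: u0|exact: w0|exact: fuw].
Qed.

End cauchy_schwarz.

Section averages.
Context {R : realType}.
Notation mu := (@lebesgue_measure R).
Implicit Types (f g u w : R -> R) (h : R).

Definition avg h f y : R := window (- h) h f y / (2 * h).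

Definition davg h f y : R :=
  (avg (h / 2) f (y + h / 2) - avg (h / 2) f (y - h / 2)) / 2.

Notation integrable f := (mu.-integrable [set: R] (EFin \o f)).

Lemma integrable_subset (D : set (measurableTypeR R)) f : measurable D -> integrable f ->
  mu.-integrable D (EFin \o f).
Proof. by move=> mD fi; exact: (@integrableS _ _ _ mu setT D). Qed.

Lemma measurable_integrable f : integrable f -> measurable_fun [set: R] f.
Proof. by move=> fi; apply/measurable_EFinP; exact: measurable_int fi. Qed.

Lemma windowD a b c f y : a <= b -> b <= c -> integrable f ->
  window a c f y = window a b f y + window b c f y.
Proof.
move=> ab bc fi; rewrite /window.
have -> : `[y + a, y + c[%classic = `[y + a, y + b[ `|` `[y + b, y + c[ :> set R.
  apply/seteqP; split => x /=; rewrite !in_itv/=; first lra.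
  by case; lra.
rewrite Rintegral_setU//.
- by apply: integrable_subset => //; exact: measurableU.
- apply/disj_setPS => x [] /=; rewrite !in_itv/= => /andP[_ H1] /andP[H2 _].
  by move: (lt_le_trans H1 H2); rewrite ltxx.
Qed.

Lemma window_shift a b c f y : window a b f (y + c) = window (c + a) (c + b) f y.
Proof. by rewrite /window !addrA. Qed.

Lemma avg_half h f y : 0 < h -> integrable f ->
  avg h f y = (avg (h / 2) f (y + h / 2) + avg (h / 2) f (y - h / 2)) / 2.
Proof.
move=> h0 fi; rewrite /avg !window_shift.
rewrite (@windowD _ 0) ?oppr_le0 ?(ltW h0)//.
have -> : h / 2 - h / 2 = 0 by lra.
have -> : h / 2 + h / 2 = h by lra.
have -> : - (h / 2) - h / 2 = - h by lra.
have -> : - (h / 2) + h / 2 = 0 by lra.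
by field; exact: lt0r_neq0.
Qed.

Lemma davgE h f y : 0 < h ->
  davg h f y = (window 0 h f y - window (- h) 0 f y) / (2 * h).
Proof.
move=> h0; rewrite /davg /avg !window_shift.
have -> : h / 2 - h / 2 = 0 by lra.
have -> : h / 2 + h / 2 = h by lra.
have -> : - (h / 2) - h / 2 = - h by lra.
have -> : - (h / 2) + h / 2 = 0 by lra.
by field; exact: lt0r_neq0.
Qed.

Lemma avg_ge0 h f y : 0 < h -> (forall x, 0 <= f x) -> 0 <= avg h f y.
Proof.
move=> h0 f0; apply: divr_ge0; last by lra.
by apply: Rintegral_ge0 => x _; exact: f0.
Qed.

Lemma avg_norm_le h f g y : 0 < h -> integrable f -> integrable g ->
  (forall x, `|f x| <= g x) -> `|avg h f y| <= avg h g y.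
Proof.
move=> h0 fi gi fg; have h2 : 0 <= (2 * h)^-1 by rewrite invr_ge0; lra.
rewrite /avg normrM (ger0_norm h2) ler_wpM2r//.
have mD : measurable (`[y - h, y + h[%classic : set (measurableTypeR R)).
  exact: measurable_itv.
rewrite /window.
apply: (le_trans (le_normr_Rintegral mD (integrable_subset mD fi))).
apply: le_Rintegral => //.
- apply: (integrable_subset mD).
  exact: (@integrable_norm _ _ _ mu setT).
- exact: integrable_subset.
Qed.

Lemma avgD h f g y : integrable f -> integrable g ->
  avg h (fun x => f x + g x) y = avg h f y + avg h g y.
Proof.
move=> fi gi; rewrite /avg -mulrDl; congr (_ / _); rewrite /window.
by rewrite RintegralD//; exact: integrable_subset.
Qed.

Lemma avgZ h k f y : integrable f -> avg h (fun x => k * f x) y = k * avg h f y.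
Proof.
move=> fi; rewrite /avg mulrA; congr (_ / _); rewrite /window.
by rewrite RintegralZl//; exact: integrable_subset.
Qed.

Lemma avg_CS h f u w y : 0 < h -> integrable f -> integrable u -> integrable w ->
  (forall x, 0 <= u x) -> (forall x, 0 <= w x) ->
  (forall x, f x ^+ 2 <= u x * w x) ->
  avg h f y ^+ 2 <= avg h u y * avg h w y.
Proof.
move=> h0 fi ui wi u0 w0 fuw; rewrite /avg.
have E (p q r : R) : p / r * (q / r) = p * q * r^-1 ^+ 2 by ring.
rewrite exprMn E ler_wpM2r ?sqr_ge0//.
by apply: Rintegral_CS => //; exact: integrable_subset.
Qed.

Lemma measurable_avg h f : 0 < h -> integrable f -> measurable_fun [set: R] (avg h f).
Proof.
move=> h0 fi; apply: measurable_funM => //.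
by apply: measurable_window => //; lra.
Qed.

Lemma measurable_avg_shift h c f : 0 < h -> integrable f ->
  measurable_fun [set: R] (fun y => avg h f (y + c)).
Proof.
move=> h0 fi; apply: (measurableT_comp (measurable_avg h0 fi)).
exact: measurable_funD.
Qed.

Lemma measurable_davg h f : 0 < h -> integrable f -> measurable_fun [set: R] (davg h f).
Proof.
move=> h0 fi; apply: measurable_funM => //; apply: measurable_funB.
  by apply: measurable_avg_shift => //; lra.
by apply: measurable_avg_shift => //; lra.
Qed.

Lemma integral_avg h f : 0 < h -> integrable f -> (forall x, 0 <= f x) ->
  (\int[mu]_y (avg h f y)%:E = \int[mu]_x (f x)%:E)%E.
Proof.
move=> h0 fi f0; have mf := measurable_integrable fi.
have h2 : 0 < (2 * h)^-1 by rewrite invr_gt0; lra.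
have := @tonelli_window R (- h) h f (cst (2 * h)^-1) mf f0
  (@measurable_cst _ _ _ _ _ _) (fun=> ltW h2).
under eq_integral do rewrite -EFin_window//.
move=> E; apply: (etrans _ (etrans E _)); first by apply: eq_integral.
apply: eq_integral => x _.
transitivity ((f x)%:E * \int[mu]_(y in `](x - h)%R, (x - - h)%R])
    cst ((2 * h)^-1)%:E y)%E; first by [].
rewrite integral_cst//=.
rewrite lebesgue_measure_itv/= lte_fin ltrD2l opprK (_ : - h < h); last by lra.
by rewrite -EFinB -!EFinM; congr (_%:E); field; exact: lt0r_neq0.
Qed.

End averages.

(** * Bellman functions and the square function of a level set *)

Section bellman_functions.
Context {R : realType}.
Implicit Types (lam u w x : R).

Lemma bellman_quad lam u1 u2 w1 w2 :
  0 <= w1 -> 0 <= w2 -> `|u1| <= lam * w1 -> `|u2| <= lam * w2 ->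
  ((u1 + u2) / 2) ^+ 2 / ((w1 + w2) / 2) +
  ((u1 - u2) / 2 - (u1 + u2) / 2 / ((w1 + w2) / 2) * ((w1 - w2) / 2)) ^+ 2 /
    ((w1 + w2) / 2) <=
  (u1 ^+ 2 / w1 + u2 ^+ 2 / w2) / 2.
Proof.
rewrite le_eqVlt => /predU1P[<-|w10]; rewrite le_eqVlt => /predU1P[<-|w20].
- rewrite mulr0 !normr_le0 => /eqP -> /eqP ->.
  by rewrite ?(addr0, subr0, mul0r, expr0n)/=.
- rewrite mulr0 normr_le0 => /eqP -> _.
  rewrite le_eqVlt; apply/orP; left; apply/eqP.
  by rewrite invr0; field; rewrite ?gt_eqF.
- rewrite mulr0 normr_le0 => _ /eqP ->.
  rewrite le_eqVlt; apply/orP; left; apply/eqP.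
  by rewrite invr0; field; rewrite ?gt_eqF.
move=> _ _; rewrite -subr_ge0.
have w12 : 0 < w1 + w2 by rewrite addr_gt0.
have -> : (u1 ^+ 2 / w1 + u2 ^+ 2 / w2) / 2 -
  (((u1 + u2) / 2) ^+ 2 / ((w1 + w2) / 2) +
  ((u1 - u2) / 2 - (u1 + u2) / 2 / ((w1 + w2) / 2) * ((w1 - w2) / 2)) ^+ 2 /
    ((w1 + w2) / 2)) =
  (u1 * w2 - u2 * w1) ^+ 2 * (w1 - w2) ^+ 2 / (2 * w1 * w2 * (w1 + w2) ^+ 3).
  by field; rewrite ?gt_eqF.
apply: divr_ge0; first by rewrite mulr_ge0 ?sqr_ge0.
by rewrite !mulr_ge0 ?exprn_ge0 ?ltW.
Qed.

Definition entropy x : R := - (x * ln x).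

Lemma entropy_ge0 x : 0 <= x <= 1 -> 0 <= entropy x.
Proof.
move=> /andP[x0 x1]; rewrite /entropy oppr_ge0; apply: mulr_ge0_le0 => //.
exact: ln_le0.
Qed.

Lemma xlnx_ge x : 0 <= x <= 2 -> x - 1 + (x - 1) ^+ 2 / 6 <= x * ln x.
Proof.
move=> /andP[]; rewrite le_eqVlt => /predU1P[<- _|x0 x2].
  by rewrite mul0r; lra.
pose s := Num.sqrt x.
have s0 : 0 < s by rewrite sqrtr_gt0.
have sx : x = s ^+ 2 by rewrite sqr_sqrtr// ltW.
have lnx : ln x = - (2 * ln s^-1).
  by rewrite sx lnXn// lnV ?posrE// mulrN opprK mulr_natl.
have : ln s^-1 <= s^-1 - 1.
  have := @le_ln1Dx R (s^-1 - 1); rewrite addrCA subrr addr0; apply.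
  by rewrite ltrBrDr addNr invr_gt0.
move=> ls.
have : 2 * x * (1 - s^-1) <= x * ln x.
  have H : x * ln s^-1 <= x * (s^-1 - 1) by rewrite ler_pM2l.
  rewrite lnx; lra.
apply: le_trans.
have -> : 2 * x * (1 - s^-1) = x - 1 + (s - 1) ^+ 2.
  by rewrite sx; field; exact: lt0r_neq0.
rewrite lerD2l.
have -> : x - 1 = (s - 1) * (s + 1) by rewrite sx; ring.
rewrite exprMn -mulrA ler_piMr ?sqr_ge0//.
have : s ^+ 2 <= 2 by rewrite -sx.
nra.
Qed.

Lemma bellman_entropy w1 w2 : 0 <= w1 -> 0 <= w2 ->
  ((w1 - w2) / 2) ^+ 2 / ((w1 + w2) / 2) / 6 +
    (entropy w1 + entropy w2) / 2 <= entropy ((w1 + w2) / 2).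
Proof.
move=> w10 w20; have [W0|W0] := eqVneq (w1 + w2) 0.
  have w1E : w1 = 0 by lra.
  have w2E : w2 = 0 by lra.
  by rewrite w1E w2E /entropy !(addr0, mul0r, oppr0).
have {}W0 : 0 < w1 + w2 by rewrite lt_def W0 addr_ge0.
pose W := (w1 + w2) / 2; have W1 : 0 < W by rewrite /W; lra.
pose x1 := w1 / W; pose x2 := w2 / W.
have x1_ge0 : 0 <= x1 by rewrite divr_ge0// ltW.
have x2_ge0 : 0 <= x2 by rewrite divr_ge0// ltW.
have x12 : x1 + x2 = 2 by rewrite /x1 /x2 /W; field; exact: lt0r_neq0.
have H (w : R) : 0 <= w -> entropy w = - (W * (w / W) * ln W + W * (w / W * ln (w / W))).
  rewrite le_eqVlt => /predU1P[<-|w0]; first by rewrite /entropy !(mul0r, mulr0, addr0).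
  rewrite /entropy ln_div ?posrE//.
  by field; exact: lt0r_neq0.
rewrite (H _ w10) (H _ w20) -/x1 -/x2 -/W.
have E1 := @xlnx_ge x1; have E2 := @xlnx_ge x2.
have {}E1 := E1 ltac:(lra). have {}E2 := E2 ltac:(lra).
have -> : (w1 - w2) / 2 = W * (x1 - 1).
  by rewrite /x1 /W; field; exact: lt0r_neq0.
rewrite /entropy.
have -> : (W * (x1 - 1)) ^+ 2 / W / 6 = W * ((x1 - 1) ^+ 2 / 6).
  by field; exact: lt0r_neq0.
have x2E : x2 = 2 - x1 by lra.
have E2' : x2 - 1 + (x1 - 1) ^+ 2 / 6 <= x2 * ln x2.
  by apply: le_trans E2; rewrite le_eqVlt; apply/orP; left; apply/eqP; rewrite x2E; field.
rewrite -subr_ge0.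
have -> : - (W * ln W) -
  (W * ((x1 - 1) ^+ 2 / 6) +
   (- (W * x1 * ln W + W * (x1 * ln x1)) +
    - (W * x2 * ln W + W * (x2 * ln x2))) / 2) =
  W * ((x1 * ln x1 + x2 * ln x2) / 2 - (x1 - 1) ^+ 2 / 6
       + ((x1 + x2) / 2 - 1) * ln W) by field.
rewrite mulr_ge0 ?(ltW W1)//.
have -> : (x1 + x2) / 2 - 1 = 0 by lra.
rewrite mul0r addr0; lra.
Qed.

Lemma entropy_le x c : 0 <= x -> 0 < c -> entropy x <= x * ln c^-1 + c.
Proof.
rewrite le_eqVlt => /predU1P[<- c0|x0 c0]; first by rewrite /entropy !mul0r oppr0 add0r ltW.
have : ln (c / x) <= c / x - 1.
  have := @le_ln1Dx R (c / x - 1); rewrite addrCA subrr addr0; apply.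
  by rewrite ltrBrDr addNr divr_gt0.
rewrite ln_div ?posrE// lnV ?posrE// /entropy => H.
have : x * (ln c - ln x) <= x * (c / x - 1) by rewrite ler_pM2l.
have -> : x * (c / x - 1) = c - x by field; exact: lt0r_neq0.
lra.
Qed.

End bellman_functions.

Section nonneg_integrals.
Context {R : realType}.
Notation mu := (@lebesgue_measure R).
Implicit Types (f g : R -> R) (k : R).

Lemma nnintD f g : measurable_fun [set: R] f -> measurable_fun [set: R] g ->
  (forall x, 0 <= f x) -> (forall x, 0 <= g x) ->
  (\int[mu]_x (f x + g x)%R%:E = \int[mu]_x (f x)%:E + \int[mu]_x (g x)%:E)%E.
Proof.
move=> mf mg f0 g0.
have mf' : measurable_fun [set: R] (fun x => (f x)%:E) by exact/measurable_EFinP.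
have mg' : measurable_fun [set: R] (fun x => (g x)%:E) by exact/measurable_EFinP.
have f0' : forall x : measurableTypeR R, [set: measurableTypeR R] x -> (0 <= (f x)%:E)%E.
  by move=> x _; rewrite lee_fin.
have g0' : forall x : measurableTypeR R, [set: measurableTypeR R] x -> (0 <= (g x)%:E)%E.
  by move=> x _; rewrite lee_fin.
exact (@ge0_integralD _ _ _ mu setT measurableT _ _ f0' mf' g0' mg').
Qed.

Lemma nnintZ k f : 0 <= k -> measurable_fun [set: R] f -> (forall x, 0 <= f x) ->
  (\int[mu]_x (k * f x)%R%:E = k%:E * \int[mu]_x (f x)%:E)%E.
Proof.
move=> k0 mf f0.
have mf' : measurable_fun [set: R] (fun x => (f x)%:E) by exact/measurable_EFinP.
have f0' : forall x : measurableTypeR R, [set: measurableTypeR R] x -> (0 <= (f x)%:E)%E.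
  by move=> x _; rewrite lee_fin.
exact (@ge0_integralZl_EFin _ _ _ mu setT measurableT _ f0' mf' k k0).
Qed.

Lemma nnint_le f g : measurable_fun [set: R] f -> measurable_fun [set: R] g ->
  (forall x, 0 <= f x) -> (forall x, f x <= g x) ->
  (\int[mu]_x (f x)%:E <= \int[mu]_x (g x)%:E)%E.
Proof.
move=> mf mg f0 fg.
have mf' : measurable_fun [set: R] (fun x => (f x)%:E) by exact/measurable_EFinP.
have mg' : measurable_fun [set: R] (fun x => (g x)%:E) by exact/measurable_EFinP.
have f0' : forall x : measurableTypeR R, [set: measurableTypeR R] x -> (0 <= (f x)%:E)%E.
  by move=> x _; rewrite lee_fin.
have fg' : forall x : measurableTypeR R, [set: measurableTypeR R] x -> ((f x)%:E <= (g x)%:E)%E.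
  by move=> x _; rewrite lee_fin.
exact (@ge0_le_integral _ _ _ mu setT measurableT _ _ f0' mf' mg' fg').
Qed.

Lemma nnint_sum n (f : 'I_n -> R -> R) : (forall i, measurable_fun [set: R] (f i)) ->
  (forall i x, 0 <= f i x) ->
  (\int[mu]_x (\sum_(i < n) f i x)%R%:E = \sum_(i < n) \int[mu]_x (f i x)%:E)%E.
Proof.
move=> mf f0.
under eq_integral do rewrite -sumEFin.
have mf' i : measurable_fun [set: R] (fun x => (f i x)%:E) by exact/measurable_EFinP.
have f0' (i : 'I_n) (x : measurableTypeR R) : [set: measurableTypeR R] x -> (0 <= (f i x)%:E)%E.
  by move=> _; rewrite lee_fin.
exact (@ge0_integral_sum _ _ _ mu setT measurableT _ _ mf' f0' (index_enum 'I_n)).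
Qed.

Lemma nnint_shift c f : measurable_fun [set: R] f -> (forall x, 0 <= f x) ->
  (\int[mu]_x (f (x + c)%R)%:E = \int[mu]_x (f x)%:E)%E.
Proof.
move=> mf f0.
have mf' : measurable_fun [set: R] (fun x => (f x)%:E) by exact/measurable_EFinP.
exact: (@ge0_integral_shift R c (EFin \o f)).
Qed.

End nonneg_integrals.

Section bellman_integrals.
Context {R : realType}.
Notation mu := (@lebesgue_measure R).
Notation integrable f := (mu.-integrable [set: R] (EFin \o f)).
Implicit Types (f g w H : R -> R) (lam h c y : R).

Lemma measurable_funV_ge0 f : measurable_fun [set: R] f -> (forall x, 0 <= f x) ->
  measurable_fun [set: R] (fun x => (f x)^-1).
Proof.
move=> mf f0; apply: (eq_measurable_fun (fun x => f x `^ (-1))).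
  by move=> x _; rewrite powR_inv1.
exact (measurableT_comp (@measurable_powR R (-1)) mf).
Qed.

Lemma integrable_le f g : integrable g -> measurable_fun [set: R] f ->
  (forall x, `|f x| <= g x) -> integrable f.
Proof.
move=> gi mf fg; refine (@le_integrable _ _ _ mu setT measurableT _ _ _ _ gi).
  exact/measurable_EFinP.
move=> x _; rewrite /comp/= lee_fin.
by apply: le_trans (fg x) (ler_norm _).
Qed.

Lemma ge0_integral_half_shift c H : measurable_fun [set: R] H ->
  (forall y, 0 <= H y) ->
  (\int[mu]_y ((H (y + c)%R + H (y - c)%R) / 2)%R%:E = \int[mu]_y (H y)%:E)%E.
Proof.
move=> mH H0.
have mHc d : measurable_fun [set: R] (fun y => H (y + d)).
  by apply: (measurableT_comp mH); exact: measurable_funD.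
transitivity (\int[mu]_y (2^-1 * (H (y + c) + H (y + - c)))%R%:E)%E.
  by apply: eq_integral => y _; rewrite mulrC.
rewrite nnintZ//; [|by apply: measurable_funD|by move=> y; rewrite addr_ge0].
rewrite nnintD// (nnint_shift (- c) mH H0) (nnint_shift c mH H0).
rewrite -[X in (_ * (X + _))%E]mul1e -[X in (_ * (_ + X))%E]mul1e.
by rewrite -ge0_muleDl// -EFinD muleA -EFinM mulVf ?mul1e.
Qed.

(* The difference of [f] corrected by that of the weight [w]: this is the quantity
   controlled by the convexity gap of [u^2 / w]. *)
Definition residual h f w y : R := davg h f y - avg h f y / avg h w y * davg h w y.

Section weight.
Variables (E : set (measurableTypeR R)) (mE : measurable E) (Efin : (mu E < +oo)%E).

Let w : R -> R := \1_E.

Lemma indic01 x : 0 <= w x <= 1.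
Proof. by rewrite /w indicE; case: (_ \in _); rewrite !lexx ?ler01. Qed.

Lemma integrable_indic_fin : integrable w.
Proof.
apply/integrableP; split; first by apply/measurable_EFinP; exact: measurable_indic.
under eq_integral do rewrite gee0_abs ?lee_fin//.
by rewrite integral_indic// setIT.
Qed.

Lemma avg_indic01 h y : 0 < h -> 0 <= avg h w y <= 1.
Proof.
move=> h0; rewrite avg_ge0//=.
rewrite /avg ler_pdivrMr ?mul1r; last by lra.
  rewrite -lee_fin EFin_window; last exact: integrable_indic_fin.
  apply: (@le_trans _ _ (\int[mu]_(x in `[(y - h)%R, (y + h)%R[) cst 1%:E x)%E).
    apply: ge0_le_integral => //.
    - by move=> x _; rewrite lee_fin.
    - by apply/measurable_EFinP; apply: measurable_funTS; exact: measurable_indic.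
    - by move=> x _; rewrite lee_fin; have /andP[] := indic01 x.
  rewrite integral_cst//= mul1e lebesgue_measure_itv/= lte_fin ltrD2l.
  rewrite (_ : - h < h); last by lra.
  by rewrite -EFinB lee_fin; lra.
Qed.

Section dominated.
Variables (lam : R) (f : R -> R).
Hypotheses (mf : measurable_fun [set: R] f) (fw : forall x, `|f x| <= lam * w x).

Lemma integrable_dom : integrable f.
Proof.
apply: (@integrable_le _ (fun x => lam * w x)) => //.
exact (integrableZl measurableT lam integrable_indic_fin).
Qed.

Lemma avg_dom h y : 0 < h -> `|avg h f y| <= lam * avg h w y.
Proof.
move=> h0; rewrite -avgZ; last exact: integrable_indic_fin.
apply: avg_norm_le => //; first exact: integrable_dom.
exact (integrableZl measurableT lam integrable_indic_fin).
Qed.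

Lemma measurable_avg_quad h : 0 < h ->
  measurable_fun [set: R] (fun y => avg h f y ^+ 2 / avg h w y).
Proof.
move=> h0; apply: measurable_funM.
  by apply: measurable_funX; apply: measurable_avg => //; exact: integrable_dom.
apply: measurable_funV_ge0.
  by apply: measurable_avg => //; exact: integrable_indic_fin.
by move=> y; have /andP[] := avg_indic01 y h0.
Qed.

Lemma measurable_davg_quad h : 0 < h ->
  measurable_fun [set: R] (fun y => davg h f y ^+ 2 / avg h w y).
Proof.
move=> h0; apply: measurable_funM.
  by apply: measurable_funX; apply: measurable_davg => //; exact: integrable_dom.
apply: measurable_funV_ge0.
  by apply: measurable_avg => //; exact: integrable_indic_fin.
by move=> y; have /andP[] := avg_indic01 y h0.
Qed.

Lemma measurable_residual_quad h : 0 < h ->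
  measurable_fun [set: R] (fun y => residual h f w y ^+ 2 / avg h w y).
Proof.
move=> h0.
have mV : measurable_fun [set: R] (fun y => (avg h w y)^-1).
  apply: measurable_funV_ge0.
    by apply: measurable_avg => //; exact: integrable_indic_fin.
  by move=> y; have /andP[] := avg_indic01 y h0.
apply: measurable_funM => //; apply: measurable_funX.
apply: measurable_funB; first by apply: measurable_davg => //; exact: integrable_dom.
apply: measurable_funM.
  by apply: measurable_funM => //; apply: measurable_avg => //; exact: integrable_dom.
by apply: measurable_davg => //; exact: integrable_indic_fin.
Qed.

Lemma quad_step h : 0 < h ->
  (\int[mu]_y (avg h f y ^+ 2 / avg h w y)%R%:E +
   \int[mu]_y (residual h f w y ^+ 2 / avg h w y)%R%:E <=
   \int[mu]_y (avg (h / 2) f y ^+ 2 / avg (h / 2) w y)%R%:E)%E.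
Proof.
move=> h0; have h20 : 0 < h / 2 by lra.
have W0 k y : 0 < k -> 0 <= avg k w y by move=> k0; have /andP[] := avg_indic01 y k0.
rewrite -(@ge0_integral_half_shift (h / 2) _ (measurable_avg_quad h20)); last first.
  by move=> y; rewrite divr_ge0 ?sqr_ge0 ?W0.
have Q0 (g : R -> R) y : 0 <= g y ^+ 2 / avg h w y by rewrite divr_ge0 ?sqr_ge0 ?W0.
rewrite -nnintD; [|exact: measurable_avg_quad|exact: measurable_residual_quad|by move=> y|by move=> y].
apply: nnint_le.
- apply: measurable_funD; first exact: measurable_avg_quad.
  exact: measurable_residual_quad.
- apply: measurable_funM => //.
  apply: measurable_funD.
    apply: (measurableT_comp (measurable_avg_quad h20)); exact: measurable_funD.
  apply: (measurableT_comp (measurable_avg_quad h20)); exact: measurable_funB.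
- by move=> y; rewrite addr_ge0.
move=> y; rewrite /residual.
rewrite (avg_half y h0 integrable_dom) (avg_half y h0 integrable_indic_fin) /davg.
by apply: (@bellman_quad _ lam); rewrite ?W0//; exact: avg_dom.
Qed.

Lemma quad_le h : 0 < h ->
  (\int[mu]_y (avg h f y ^+ 2 / avg h w y)%R%:E <= \int[mu]_x (f x ^+ 2)%R%:E)%E.
Proof.
move=> h0.
have fi2 : integrable (fun x => f x ^+ 2).
  apply: (@integrable_le _ (fun x => lam ^+ 2 * w x)) => //.
  - exact (integrableZl measurableT (lam ^+ 2) integrable_indic_fin).
  - exact: measurable_funX.
  move=> x; rewrite ger0_norm ?sqr_ge0// -real_normK ?num_real//.
  move: (fw x); rewrite /w indicE; case: (x \in E) => /= H.
    by move: H; rewrite !mulr1 => H; rewrite lerXn2r ?nnegrE//; exact: le_trans H.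
  by move: H; rewrite !mulr0 normr_le0 => /eqP ->; rewrite normr0 expr0n.
rewrite -(@integral_avg _ h _ h0 fi2) => [|x]; last exact: sqr_ge0.
apply: nnint_le.
- exact: measurable_avg_quad.
- exact: measurable_avg.
- move=> y; rewrite divr_ge0 ?sqr_ge0//.
  by have /andP[] := avg_indic01 y h0.
move=> y.
have /andP[] := avg_indic01 y h0; rewrite le_eqVlt => /predU1P[<- _|W0 _].
  by rewrite invr0 mulr0; apply: avg_ge0 => // x; exact: sqr_ge0.
rewrite ler_pdivrMr//; apply: avg_CS => //.
- exact: integrable_dom.
- exact: integrable_indic_fin.
- by move=> x; exact: sqr_ge0.
move=> x; move: (fw x); rewrite /w indicE; case: (x \in E) => /=.
  by rewrite !mulr1 lexx.
by rewrite !mulr0 normr_le0 => /eqP ->; rewrite expr0n.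
Qed.

Lemma sum_residual_le h (n : nat) : 0 < h ->
  (\sum_(i < n) \int[mu]_y (residual (h / 2 ^+ i) f w y ^+ 2 / avg (h / 2 ^+ i) w y)%R%:E
   <= \int[mu]_x (f x ^+ 2)%R%:E)%E.
Proof.
move=> h0; have hi i : 0 < h / 2 ^+ i by rewrite divr_gt0 ?exprn_gt0.
apply: le_trans (quad_le (hi n)).
elim: n => [|n IH].
  rewrite big_ord0; apply: integral_ge0 => y _; rewrite lee_fin divr_ge0 ?sqr_ge0//.
  by have /andP[] := avg_indic01 y (hi 0%N).
rewrite big_ord_recr/=; apply: (le_trans (leeD2r _ IH)).
apply: (le_trans (quad_step (hi n))).
by rewrite exprSr invfM mulrA.
Qed.

End dominated.
End weight.
End bellman_integrals.

Section entropy_integrals.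
Context {R : realType}.
Notation mu := (@lebesgue_measure R).
Notation integrable f := (mu.-integrable [set: R] (EFin \o f)).
Variables (E : set (measurableTypeR R)) (mE : measurable E) (Efin : (mu E < +oo)%E).

Let w : R -> R := \1_E.
Let wi : integrable w := integrable_indic_fin mE Efin.
Let w_dom x : `|w x| <= 1 * w x.
Proof. by rewrite mul1r ger0_norm//; have /andP[] := indic01 E x. Qed.
Let mw : measurable_fun [set: R] w := measurable_integrable wi.

Lemma measurable_entropy_avg (h c : R) : 0 < h ->
  measurable_fun [set: R] (fun y => entropy (avg h w (y + c))).
Proof.
move=> h0; apply: measurable_funN; apply: measurable_funM.
  exact: measurable_avg_shift.
apply: (measurableT_comp (@measurable_ln R)).
exact: measurable_avg_shift.
Qed.

Lemma measurable_entropy_avg0 (h : R) : 0 < h ->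
  measurable_fun [set: R] (fun y => entropy (avg h w y)).
Proof.
move=> h0; apply: (eq_measurable_fun _ _ (measurable_entropy_avg 0 h0)).
by move=> y _; rewrite addr0.
Qed.

Lemma entropy_avg_ge0 (h y : R) : 0 < h -> 0 <= entropy (avg h w y).
Proof. by move=> h0; apply: entropy_ge0; exact: avg_indic01. Qed.

Lemma entropy_step (h : R) : 0 < h ->
  (\int[mu]_y (entropy (avg (h / 2) w y))%:E +
   \int[mu]_y (6^-1 * (davg h w y ^+ 2 / avg h w y))%R%:E <=
   \int[mu]_y (entropy (avg h w y))%:E)%E.
Proof.
move=> h0; have h20 : 0 < h / 2 by lra.
have W0 k y : 0 < k -> 0 <= avg k w y.
  by move=> k0; have /andP[] := avg_indic01 mE Efin y k0.
have e0 y : 0 <= entropy (avg (h / 2) w y) by exact: entropy_avg_ge0.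
rewrite -(ge0_integral_half_shift (h / 2) (measurable_entropy_avg0 h20) e0).
have Q0 y : 0 <= 6^-1 * (davg h w y ^+ 2 / avg h w y).
  by rewrite mulr_ge0// divr_ge0 ?sqr_ge0 ?W0.
have mQ : measurable_fun [set: R] (fun y => 6^-1 * (davg h w y ^+ 2 / avg h w y)).
  by apply: measurable_funM => //; exact: (measurable_davg_quad mE Efin mw w_dom).
have mH : measurable_fun [set: R] (fun y =>
    (entropy (avg (h / 2) w (y + h / 2)) + entropy (avg (h / 2) w (y - h / 2))) / 2).
  by apply: measurable_funM => //; apply: measurable_funD; exact: measurable_entropy_avg.
have H0 y : 0 <= (entropy (avg (h / 2) w (y + h / 2)) + entropy (avg (h / 2) w (y - h / 2))) / 2.
  by rewrite divr_ge0// addr_ge0.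
rewrite -nnintD//; apply: nnint_le.
- exact: measurable_funD.
- exact: measurable_entropy_avg0.
- by move=> y; rewrite addr_ge0.
move=> y; rewrite (avg_half y h0 wi) /davg addrC [6^-1 * _]mulrC.
by apply: bellman_entropy; exact: W0.
Qed.

Lemma sum_davg_indic_le (h : R) (n : nat) : 0 < h ->
  (\sum_(i < n) \int[mu]_y (6^-1 * (davg (h / 2 ^+ i) w y ^+ 2 / avg (h / 2 ^+ i) w y))%R%:E
   <= \int[mu]_y (entropy (avg h w y))%:E)%E.
Proof.
move=> h0; have hi i : 0 < h / 2 ^+ i by rewrite divr_gt0 ?exprn_gt0.
suff H : (\int[mu]_y (entropy (avg (h / 2 ^+ n) w y))%:E +
  \sum_(i < n) \int[mu]_y (6^-1 * (davg (h / 2 ^+ i) w y ^+ 2 / avg (h / 2 ^+ i) w y))%R%:E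
   <= \int[mu]_y (entropy (avg h w y))%:E)%E.
  apply: le_trans H; rewrite leeDr//; apply: integral_ge0 => y _.
  by rewrite lee_fin entropy_avg_ge0.
elim: n => [|n IH]; first by rewrite big_ord0 adde0 expr0 divr1.
rewrite big_ord_recr/=; apply: le_trans IH.
rewrite addeCA addeC; apply: leeD2r.
have := entropy_step (hi n).
by rewrite -mulrA -invfM -exprSr.
Qed.

Lemma integral_entropy_le (h c p q : R) : 0 < h -> 0 < c <= 1 -> p <= q ->
  E `<=` `[p, q] ->
  (\int[mu]_y (entropy (avg h w y))%:E <=
   (ln c^-1)%:E * mu E + (c * (q - p + 2 * h))%:E)%E.
Proof.
move=> h0 /andP[c0 c1] pq Epq.
have lc0 : 0 <= ln c^-1 by rewrite ln_ge0// invf_ge1.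
have W0 y : 0 <= avg h w y by have /andP[] := avg_indic01 mE Efin y h0.
pose S : set (measurableTypeR R) := `[p - h, q + h]%classic.
have mS : measurable_fun [set: R] (\1_S : R -> R).
  by apply: measurable_indic; exact: measurable_itv.
have Sout y : ~ S y -> avg h w y = 0.
  move=> Sy; rewrite /avg /window (@eq_Rintegral _ _ _ _ _ (cst 0)).
    by rewrite Rintegral_cst//= !mul0r.
  move=> x; rewrite inE/= in_itv/= => xy; rewrite /w indicE memNset//.
  move=> /Epq/=; rewrite in_itv/= => xpq; apply: Sy.
  by rewrite /S/= in_itv/=; lra.
apply: (@le_trans _ _ (\int[mu]_y (ln c^-1 * avg h w y + c * \1_S y)%R%:E)%E).
  apply: nnint_le.
  - exact: measurable_entropy_avg0.
  - by apply: measurable_funD; apply: measurable_funM => //; exact: measurable_avg.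
  - by move=> y; exact: entropy_avg_ge0.
  move=> y; have [Sy|Sy] := pselect (S y).
    by rewrite indicE mem_set// mulr1 mulrC; exact: entropy_le.
  by rewrite Sout// /entropy mul0r oppr0 mulr0 add0r mulr_ge0 ?(ltW c0)// indicE.
rewrite nnintD; last 4 first.
- by apply: measurable_funM => //; exact: measurable_avg.
- exact: measurable_funM.
- by move=> y; rewrite mulr_ge0.
- by move=> y; rewrite mulr_ge0 ?(ltW c0).
rewrite nnintZ//; [|exact: measurable_avg].
rewrite nnintZ ?(ltW c0)//.
rewrite integral_avg//.
have -> : (\int[mu]_x (w x)%:E = mu E)%E by rewrite integral_indic// setIT.
have -> : (\int[mu]_x (\1_S x)%:E = mu S)%E.
  by rewrite integral_indic ?setIT//; exact: measurable_itv.
apply: leeD2l; rewrite lebesgue_measure_itv/= lte_fin.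
case: ifP => _; first by rewrite -EFinB -EFinM lee_fin ler_wpM2l ?(ltW c0)//; lra.
by rewrite mule0 lee_fin mulr_ge0 ?(ltW c0)//; lra.
Qed.

Lemma avg_sum h n (f : 'I_n -> R -> R) y : (forall t, integrable (f t)) ->
  integrable (fun x => \sum_(t < n) f t x) /\
  avg h (fun x => \sum_(t < n) f t x) y = \sum_(t < n) avg h (f t) y.
Proof.
elim: n f => [|n IH] f fi.
  split; first by under eq_fun do rewrite big_ord0; exact: integrable0.
  under eq_fun do rewrite big_ord0.
  by rewrite big_ord0 /avg /window Rintegral_cst//= !mul0r.
have [IH1 IH2] := IH (fun t => f (widen_ord (leqnSn n) t)) (fun t => fi _).
have E1 : (fun x => \sum_(t < n.+1) f t x) =
    (fun x => \sum_(t < n) f (widen_ord (leqnSn n) t) x + f ord_max x).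
  by apply/funext => x; rewrite big_ord_recr.
rewrite E1 big_ord_recr/= -IH2; split; last by rewrite avgD.
exact (integrableD measurableT IH1 (fi ord_max)).
Qed.

Section vector.
Variables (lam : R) (f : nat -> R -> R) (n : nat).
Hypotheses (lam0 : 0 <= lam) (mf : forall t, measurable_fun [set: R] (f t))
  (fw : forall x, \sum_(t < n) f t x ^+ 2 <= lam ^+ 2 * w x).

Let fwt (t : 'I_n) x : `|f t x| <= lam * w x.
Proof.
have wx : lam ^+ 2 * w x = (lam * w x) ^+ 2.
  by rewrite /w indicE; case: (x \in E); rewrite ?mulr1 ?mulr0 ?expr0n.
have wx0 : 0 <= lam * w x by rewrite mulr_ge0//; have /andP[] := indic01 E x.
rewrite -(@ler_sqr _ `|f t x|) ?nnegrE// real_normK ?num_real// -wx.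
apply: le_trans (fw x); rewrite (bigD1 t)//= lerDl sumr_ge0// => i _.
exact: sqr_ge0.
Qed.

Lemma sum_avg_sqr_le h y : 0 < h ->
  \sum_(t < n) avg h (f t) y ^+ 2 <= lam ^+ 2 * avg h w y ^+ 2.
Proof.
move=> h0.
have fi (t : 'I_n) : integrable (f t) by exact: (integrable_dom mE Efin (mf t) (fwt t)).
have f2w (t : 'I_n) x : f t x ^+ 2 <= f t x ^+ 2 * w x.
  move: (fwt t x); rewrite /w indicE; case: (x \in E) => /=.
    by rewrite !mulr1 lexx.
  by rewrite !mulr0 normr_le0 => /eqP ->; rewrite expr0n.
have fi2 (t : 'I_n) : integrable (fun x => f t x ^+ 2).
  apply: (@integrable_le _ _ (fun x => lam ^+ 2 * w x)).
  - exact (integrableZl measurableT (lam ^+ 2) wi).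
  - exact: measurable_funX.
  move=> x; rewrite ger0_norm ?sqr_ge0//; apply: le_trans (fw x).
  by rewrite (bigD1 t)//= lerDl sumr_ge0// => i _; exact: sqr_ge0.
have W0 : 0 <= avg h w y by have /andP[] := avg_indic01 mE Efin y h0.
apply: (@le_trans _ _ (\sum_(t < n) avg h (fun x => f t x ^+ 2) y * avg h w y)).
  by apply: ler_sum => t _; apply: avg_CS => // x; exact: sqr_ge0.
rewrite -mulr_suml (expr2 (avg h w y)) mulrA ler_wpM2r//.
have [S1 <-] := avg_sum h y fi2.
rewrite -avgZ//; apply: le_trans (ler_norm _) _.
apply: avg_norm_le => //; first exact (integrableZl measurableT (lam ^+ 2) wi).
by move=> x; rewrite ger0_norm// sumr_ge0// => i _; exact: sqr_ge0.
Qed.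

Lemma sum_davg_sqr_le h y : 0 < h ->
  \sum_(t < n) (davg h (f t) y ^+ 2 / avg h w y) <=
  2 * (\sum_(t < n) (residual h (f t) w y ^+ 2 / avg h w y)) +
  12 * lam ^+ 2 * (6^-1 * (davg h w y ^+ 2 / avg h w y)).
Proof.
move=> h0; set W := avg h w y; set b := davg h w y.
have : 0 <= W by have /andP[] := avg_indic01 mE Efin y h0.
rewrite le_eqVlt => /predU1P[W0|W0].
  rewrite -W0 invr0 !mulr0 addr0 big1 => [|t _]; last by rewrite mulr0.
  by rewrite big1 ?mulr0// => t _; rewrite mulr0.
apply: (@le_trans _ _ (\sum_(t < n) (2 * (residual h (f t) w y ^+ 2 / W) +
    avg h (f t) y ^+ 2 * (2 * b ^+ 2 / W ^+ 3)))).
  apply: ler_sum => t _; rewrite /residual -/W -/b.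
  rewrite -subr_ge0.
  set D := davg _ _ _; set U := avg _ _ _.
  have -> : 2 * ((D - U / W * b) ^+ 2 / W) + U ^+ 2 * (2 * b ^+ 2 / W ^+ 3) - D ^+ 2 / W
    = (D - 2 * (U / W * b)) ^+ 2 / W by field; exact: lt0r_neq0.
  by rewrite divr_ge0 ?sqr_ge0 ?ltW.
rewrite big_split/= -mulr_sumr lerD2l -mulr_suml.
apply: (@le_trans _ _ (lam ^+ 2 * W ^+ 2 * (2 * b ^+ 2 / W ^+ 3))).
  apply: ler_wpM2r; last exact: sum_avg_sqr_le.
  by rewrite divr_ge0 ?exprn_ge0 ?(ltW W0)// mulr_ge0 ?sqr_ge0.
rewrite le_eqVlt; apply/orP; left; apply/eqP.
by field; exact: lt0r_neq0.
Qed.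

Lemma square_function_level h m : 0 < h ->
  (\sum_(i < m) \sum_(t < n)
     \int[mu]_y (davg (h / 2 ^+ i) (f t) y ^+ 2 / avg (h / 2 ^+ i) w y)%R%:E <=
   2%:E * \sum_(t < n) \int[mu]_x (f t x ^+ 2)%R%:E +
   (12 * lam ^+ 2)%:E * \int[mu]_y (entropy (avg h w y))%:E)%E.
Proof.
move=> h0; have hi i : 0 < h / 2 ^+ i by rewrite divr_gt0 ?exprn_gt0.
have W0 k y : 0 < k -> 0 <= avg k w y.
  by move=> k0; have /andP[] := avg_indic01 mE Efin y k0.
have Q0 k (g : R) y : 0 < k -> 0 <= g ^+ 2 / avg k w y.
  by move=> k0; rewrite divr_ge0 ?sqr_ge0 ?W0.
apply: (@le_trans _ _ (\sum_(i < m)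
  (2%:E * \sum_(t < n) \int[mu]_y (residual (h / 2 ^+ i) (f t) w y ^+ 2 / avg (h / 2 ^+ i) w y)%R%:E
   + (12 * lam ^+ 2)%:E * \int[mu]_y (6^-1 * (davg (h / 2 ^+ i) w y ^+ 2 / avg (h / 2 ^+ i) w y))%R%:E))%E).
  apply: lee_sum => i _.
  have mD t : measurable_fun [set: R] (fun y => davg (h / 2 ^+ i) (f (t : 'I_n)) y ^+ 2 / avg (h / 2 ^+ i) w y).
    by apply: (measurable_davg_quad mE Efin (mf t) (fwt t)).
  have mr t : measurable_fun [set: R] (fun y => residual (h / 2 ^+ i) (f (t : 'I_n)) w y ^+ 2 / avg (h / 2 ^+ i) w y).
    by apply: (measurable_residual_quad mE Efin (mf t) (fwt t)).
  have mb : measurable_fun [set: R] (fun y => 6^-1 * (davg (h / 2 ^+ i) w y ^+ 2 / avg (h / 2 ^+ i) w y)).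
    by apply: measurable_funM => //; exact: (measurable_davg_quad mE Efin mw w_dom).
  have Qb y : 0 <= 6^-1 * (davg (h / 2 ^+ i) w y ^+ 2 / avg (h / 2 ^+ i) w y).
    by rewrite mulr_ge0// Q0.
  rewrite -nnint_sum// => [|t y]; last exact: Q0.
  rewrite -nnint_sum// => [|t y]; last exact: Q0.
  have ms (g : 'I_n -> R -> R) : (forall t, measurable_fun [set: R] (g t)) ->
      measurable_fun [set: R] (fun y => \sum_(t < n) g t y).
    by move=> mg; exact: measurable_sum.
  have Sr y : 0 <= \sum_(t < n) residual (h / 2 ^+ i) (f t) w y ^+ 2 / avg (h / 2 ^+ i) w y.
    by rewrite sumr_ge0// => t _; exact: Q0.
  have lam12 : 0 <= 12 * lam ^+ 2 by rewrite mulr_ge0 ?sqr_ge0.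
  rewrite -(nnintZ _ (ms _ mr) Sr)//.
  rewrite -(nnintZ lam12 mb Qb).
  have m1 := measurable_funM (@measurable_cst _ _ _ _ setT (2 : R)) (ms _ mr).
  have m2 := measurable_funM (@measurable_cst _ _ _ _ setT (12 * lam ^+ 2)) mb.
  rewrite -(nnintD m1 m2); last 2 first.
  - by move=> y; rewrite mulr_ge0.
  - by move=> y; rewrite mulr_ge0 ?Qb.
  apply: nnint_le.
  - exact: ms.
  - exact: measurable_funD.
  - by move=> y; rewrite sumr_ge0// => t _; exact: Q0.
  by move=> y; exact: sum_davg_sqr_le.
rewrite big_split/=; apply: leeD.
  rewrite -ge0_sume_distrr; last by move=> i _; apply: sume_ge0 => t _; apply: integral_ge0 => y _; rewrite lee_fin Q0.
  apply: lee_wpmul2l; first by rewrite lee_fin.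
  rewrite exchange_big/=; apply: lee_sum => t _.
  exact: (sum_residual_le mE Efin (mf t) (fwt t)).
rewrite -ge0_sume_distrr; last by move=> i _; apply: integral_ge0 => y _; rewrite lee_fin mulr_ge0// Q0.
apply: lee_wpmul2l; first by rewrite lee_fin mulr_ge0// sqr_ge0.
exact: sum_davg_indic_le.
Qed.

End vector.
End entropy_integrals.

(** * Inversion of the difference multiplier *)

Section derivative_rules.
Context {R : realType}.
Implicit Types (f g : R -> R) (x a b : R).

Lemma is_derive_mul f g x a b : is_derive x 1 f a -> is_derive x 1 g b ->
  is_derive x 1 (fun y => f y * g y) (a * g x + f x * b).
Proof.
move=> fx gx; have := is_deriveM fx gx.
by move=> H; apply: (is_derive_eq H); rewrite /GRing.scale/= addrC mulrC.
Qed.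

Lemma is_derive_inv f x a : f x != 0 -> is_derive x 1 f a ->
  is_derive x 1 (fun y => (f y)^-1) (- (a * (f x)^-1 ^+ 2)).
Proof.
move=> fx0 fx; have H := is_deriveV fx0 fx.
by apply: (is_derive_eq H); rewrite /GRing.scale/= exprVn mulNr mulrC.
Qed.

Lemma is_derive_add f g x a b : is_derive x 1 f a -> is_derive x 1 g b ->
  is_derive x 1 (fun y => f y + g y) (a + b).
Proof. by move=> fx gx; exact: is_deriveD. Qed.

Lemma is_derive_scale (k : R) f x a : is_derive x 1 f a ->
  is_derive x 1 (fun y => k * f y) (k * a).
Proof. by move=> fx; exact: is_deriveZ. Qed.

Lemma is_derive_dilate (k : R) f x a : is_derive (k * x) 1 f a ->
  is_derive x 1 (fun y => f (k * y)) (k * a).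
Proof.
move=> fx; have H : is_derive x 1 (fun y => k * y) k.
  have := is_derive_scale k (is_derive_id x (1 : R)).
  by rewrite mulr1.
by have := @is_derive1_comp _ f (fun y => k * y) x a k fx H; rewrite mulrC.
Qed.

Lemma is_derive_continuous f x a : is_derive x 1 f a -> {for x, continuous f}.
Proof. by move=> [d _]; exact/differentiable_continuous/derivable1_diffP. Qed.

Lemma bounded_continuous_supp f (A : R) : 0 < A -> continuous f ->
  (forall x, A < `|x| -> f x = 0) -> exists2 M, 0 < M & forall x, `|f x| <= M.
Proof.
move=> A0 cf f0.
have cnf : {within `[- A, A], continuous (fun x => `|f x|)}.
  apply: continuous_subspaceT => x.
  by apply: (@continuous_comp _ _ _ f) => //; [exact: cf|exact: norm_continuous].
have AA : - A <= A by lra.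
have [c _ H] := EVT_max AA cnf.
exists (`|f c| + 1) => [|x]; first by rewrite ltr_wpDl.
have [xA|xA] := leP `|x| A.
  apply: (@le_trans _ _ `|f c|); last by rewrite lerDl.
  by apply: H; rewrite in_itv/= -ler_norml.
by rewrite f0// normr0 addr_ge0.
Qed.

End derivative_rules.

Section oscillatory_integral.
Context {R : realType}.
Notation mu := (@lebesgue_measure R).

(* Covers [(sin, cos)] and [(cos, - sin)], the real and imaginary parts of the
   oscillating factors. *)
Definition trig_pair (T T1 : R -> R) :=
  [/\ forall x : R, is_derive x 1 T (T1 x),
      forall x : R, is_derive x 1 T1 (- T x) & forall x : R, `|T x| <= 1].

Lemma trig_pair_sin : trig_pair sin cos.
Proof.
split => [x|x|x]; [exact: is_derive_sin|exact: is_derive_cos|].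
by rewrite ler_norml sin_geN1 sin_le1.
Qed.

Lemma trig_pair_cos : trig_pair cos (fun x => - sin x).
Proof.
split => [x|x|x]; [exact: is_derive_cos| |].
  by have := is_derive_sin x => ?; exact: is_deriveN.
by rewrite ler_norml cos_geN1 cos_le1.
Qed.

Lemma trig_pair_continuous (T T1 : R -> R) : trig_pair T T1 -> continuous T.
Proof. by case=> dT _ _ x; exact: is_derive_continuous (dT x). Qed.

(* [q T(a x) + a^-2 q'' T(a x)] is the derivative of
   [- q T'(a x) / a + q' T(a x) / a^2], which vanishes at [A] and [-A]. *)
Lemma oscillatory_decay (T T1 q q1 q2 : R -> R) (A M a : R) :
  trig_pair T T1 -> 0 < A -> a != 0 ->
  (forall x : R, is_derive x 1 q (q1 x)) ->
  (forall x : R, is_derive x 1 q1 (q2 x)) ->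
  continuous q2 -> q A = 0 -> q (- A) = 0 -> q1 A = 0 -> q1 (- A) = 0 ->
  (forall x, `|q2 x| <= M) ->
  `|\int[mu]_(x in `[- A, A]) (q x * T (a * x))| <= 2 * A * M / a ^+ 2.
Proof.
move=> TT A0 a0 dq dq1 cq2 qA qNA q1A q1NA q2M.
have cT := trig_pair_continuous TT; case: (TT) => dT dT1 T1le.
have cTa : continuous (fun x => T (a * x)).
  by move=> x; exact: is_derive_continuous (is_derive_dilate (dT (a * x))).
have cq x : {for x, continuous q} by exact: is_derive_continuous (dq x).
have cqT : continuous (fun x => q x * T (a * x)).
  by move=> x; apply: cvgM; [exact: cq|exact: cTa].
have cq2T : continuous (fun x => q2 x * T (a * x)).
  by move=> x; apply: cvgM; [exact: cq2|exact: cTa].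
have itg (g : R -> R) : continuous g -> mu.-integrable `[- A, A] (EFin \o g).
  move=> cg; apply: continuous_compact_integrable; first exact: segment_compact.
  exact: continuous_subspaceT.
pose F (x : R) : R := - a^-1 * (q x * T1 (a * x)) + a^-1 ^+ 2 * (q1 x * T (a * x)).
have dF (x : R) : is_derive x 1 F (q x * T (a * x) + a^-1 ^+ 2 * (q2 x * T (a * x))).
  have d1 := is_derive_scale (- a^-1) (is_derive_mul (dq x) (is_derive_dilate (dT1 (a * x)))).
  have d2 := is_derive_scale (a^-1 ^+ 2) (is_derive_mul (dq1 x) (is_derive_dilate (dT (a * x)))).
  by apply: (is_derive_eq (is_derive_add d1 d2)); field.
have cF' : continuous (fun x => q x * T (a * x) + a^-1 ^+ 2 * (q2 x * T (a * x))).
  by move=> x; apply: cvgD; [exact: cqT|apply: cvgMr; exact: cq2T].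
have AA : - A < A by lra.
have FF (x : R) : {for x, continuous F} by exact: is_derive_continuous (dF x).
have /= := @continuous_FTC2 R _ F (- A) A AA (continuous_subspaceT cF').
have dFoo : derivable_oo_LRcontinuous F (- A) A.
  split => [x _||]; first by case: (dF x).
  - exact/cvg_at_right_filter/FF.
  - exact/cvg_at_left_filter/FF.
move=> /(_ dFoo) H.
have {}H := H ltac:(by move=> x _; rewrite derive1E; case: (dF x)).
have FA : F A = 0 by rewrite /F qA q1A !mul0r !mulr0 addr0.
have FNA : F (- A) = 0 by rewrite /F qNA q1NA !mul0r !mulr0 addr0.
move: H; rewrite FA FNA -EFinB subrr => /(congr1 fine)/=.
rewrite -/(Rintegral _ _ _).
have mI : measurable (`[- A, A]%classic : set (measurableTypeR R)) by exact: measurable_itv.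
rewrite RintegralD//; [|exact: itg|exact (integrableZl mI (a^-1 ^+ 2) (itg _ cq2T))].
rewrite RintegralZl//; last exact: itg.
move/eqP; rewrite addr_eq0 => /eqP ->.
rewrite normrN normrM ger0_norm ?sqr_ge0// mulrC exprVn ler_wpM2r ?invr_ge0 ?sqr_ge0//.
apply: (le_trans (le_normr_Rintegral mI (itg _ cq2T))).
apply: (@le_trans _ _ (\int[mu]_(x in `[- A, A]) cst M x)).
  apply: le_Rintegral => //.
  - apply: (@integrable_norm _ _ _ mu); exact: itg.
  - by apply: itg => x; exact: cst_continuous.
  move=> x _; rewrite normrM -[leRHS]mulr1.
  by apply: ler_pM => //; exact: q2M.
rewrite Rintegral_cst//= lebesgue_measure_itv/= lte_fin AA/=.
by rewrite opprK mulrC; lra.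
Qed.

Lemma oscillatory_bound (T T1 q : R -> R) (A M a : R) :
  trig_pair T T1 -> 0 < A -> continuous q -> (forall x, `|q x| <= M) ->
  `|\int[mu]_(x in `[- A, A]) (q x * T (a * x))| <= 2 * A * M.
Proof.
move=> TT A0 cq qM.
have cT := trig_pair_continuous TT; case: (TT) => dT dT1 T1le.
have cTa : continuous (fun x => T (a * x)).
  by move=> x; exact: is_derive_continuous (is_derive_dilate (dT (a * x))).
have cqT : continuous (fun x => q x * T (a * x)).
  by move=> x; apply: cvgM; [exact: cq|exact: cTa].
have itg (g : R -> R) : continuous g -> mu.-integrable `[- A, A] (EFin \o g).
  move=> cg; apply: continuous_compact_integrable; first exact: segment_compact.
  exact: continuous_subspaceT.
have mI : measurable (`[- A, A]%classic : set (measurableTypeR R)) by exact: measurable_itv.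
apply: (le_trans (le_normr_Rintegral mI (itg _ cqT))).
apply: (@le_trans _ _ (\int[mu]_(x in `[- A, A]) cst M x)).
  apply: le_Rintegral => //.
  - apply: (@integrable_norm _ _ _ mu); exact: itg.
  - by apply: itg => x; exact: cst_continuous.
  move=> x _; rewrite normrM -[leRHS]mulr1.
  by apply: ler_pM => //; exact: qM.
rewrite Rintegral_cst//= lebesgue_measure_itv/= lte_fin.
have -> : - A < A by lra.
by rewrite /= opprK mulrC; lra.
Qed.

End oscillatory_integral.

Section inverse_symbol.
Context {R : realType}.
Notation mu := (@lebesgue_measure R).
Variables (eta : R -> R) (heta : LP_symbol eta).

Let eta1 := derive1n 1 eta.
Let eta2 := derive1n 2 eta.

Let etaD (x : R) : is_derive x 1 eta (eta1 x).
Proof.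
case: heta => /(_ 0%N x) d _ _ _; rewrite /eta1 derive1n1 derive1E.
exact: derivableP.
Qed.

Let eta1D (x : R) : is_derive x 1 eta1 (eta2 x).
Proof.
case: heta => /(_ 1%N x) d _ _ _; rewrite /eta2 derive1nS derive1E.
exact: derivableP.
Qed.

Let eta2C : continuous eta2.
Proof.
move=> x; case: heta => /(_ 2%N x) d _ _ _.
exact/differentiable_continuous/derivable1_diffP.
Qed.

Let Z : set R := [set x | `|x| < 1 / 2 \/ 5 / 2 < `|x|].

Let nearZ (x : R) : Z x -> \near x, Z x.
Proof.
case=> xZ.
  near=> y; left; near: y.
  have : \forall y \near `|x|, y < 1 / 2 by exact: lt_nbhsl.
  exact: (@norm_continuous _ _ x).
near=> y; right; near: y.
have : \forall y \near `|x|, 5 / 2 < y by exact: lt_nbhsr.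
exact: (@norm_continuous _ _ x).
Unshelve. all: by end_near. Qed.

Let is_derive_Z (f : R -> R) (x : R) : Z x -> (forall y, Z y -> f y = 0) ->
  is_derive x 1 f 0.
Proof.
move=> Zx fZ; have d0 := is_derive_cst (0 : R) x (1 : R).
apply: (near_eq_is_derive _ d0).
by near=> y; rewrite fZ//; near: y; exact: nearZ.
Unshelve. all: by end_near. Qed.

Let etaZ x : Z x -> eta x = 0.
Proof.
move=> Zx; case: heta => _ _ _ H; apply/eqP/negPn/negP => /H /andP[h1 h2].
by case: Zx => /=; lra.
Qed.

Let derive_Z (f g : R -> R) : (forall x : R, is_derive x 1 f (g x)) ->
  (forall x, Z x -> f x = 0) -> forall x, Z x -> g x = 0.
Proof.
move=> fg fZ x Zx; case: (fg x) => _ <-.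
by case: (is_derive_Z Zx fZ).
Qed.

Let eta1Z := derive_Z etaD etaZ.
Let eta2Z := derive_Z eta1D eta1Z.

Let c : R := pi / 2.
Let s (x : R) : R := 1 - cos (c * x).

Let s_neq0 x : ~ Z x -> s x != 0.
Proof.
move=> nZ; have x12 : 1 / 2 <= `|x| by rewrite leNgt; apply/negP => H; apply: nZ; left.
have x52 : `|x| <= 5 / 2 by rewrite leNgt; apply/negP => H; apply: nZ; right.
rewrite /s; have -> : cos (c * x) = cos (c * `|x|).
  by case: (ger0P x) => // _; rewrite mulrN cosN.
set t := c * `|x| / 2.
have -> : c * `|x| = t + t by rewrite /t; field.
have pi0 := pi_gt0 R.
have st : 0 < sin t.
  apply: sin_gt0_pi; apply/andP; split; rewrite /t /c.
    by rewrite divr_gt0// mulr_gt0 ?divr_gt0//; lra.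
  have : pi * `|x| <= pi * (5 / 2) :> R by rewrite ler_wpM2l// ltW.
  by move=> ?; lra.
rewrite cosD -!expr2 cos2sin2.
have -> : 1 - (1 - sin t ^+ 2 - sin t ^+ 2) = 2 * sin t ^+ 2 by ring.
by rewrite mulf_neq0 ?pnatr_eq0// expf_neq0// gt_eqF.
Qed.

Let s1 x := c * sin (c * x).
Let s2 x := c ^+ 2 * cos (c * x).
Let i x := (s x)^-1.
Let i1 x := - (s1 x * i x ^+ 2).
Let i2 x := - (s2 x * i x ^+ 2) + 2 * s1 x ^+ 2 * i x ^+ 3.
Let p x := x * i x.
Let p1 x := i x + x * i1 x.
Let p2 x := 2 * i1 x + x * i2 x.

Let sD (x : R) : is_derive x 1 s (s1 x).
Proof.
have d1 := is_derive_scale (-1) (is_derive_dilate (is_derive_cos (c * x))).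
have d2 := is_derive_add (is_derive_cst (1 : R) x 1) d1.
have -> : s = (fun y => cst 1 y + -1 * cos (c * y)).
  by apply/funext => y; rewrite /s/= mulN1r.
by apply: (is_derive_eq d2); rewrite /s1; ring.
Qed.

Let s1D (x : R) : is_derive x 1 s1 (s2 x).
Proof.
have d1 := is_derive_scale c (is_derive_dilate (is_derive_sin (c * x))).
by apply: (is_derive_eq d1); rewrite /s2; ring.
Qed.

Let iD (x : R) : s x != 0 -> is_derive x 1 i (i1 x).
Proof. by move=> sx; exact: (is_derive_inv sx (sD x)). Qed.

Let i1D (x : R) : s x != 0 -> is_derive x 1 i1 (i2 x).
Proof.
move=> sx.
have d1 := is_derive_mul (iD sx) (iD sx).
have d2 := is_derive_scale (-1) (is_derive_mul (s1D x) d1).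
have -> : i1 = (fun y => -1 * (s1 y * (i y * i y))).
  by apply/funext => y; rewrite /i1 mulN1r expr2.
by apply: (is_derive_eq d2); rewrite /i2 /i1; ring.
Qed.

Let pD (x : R) : s x != 0 -> is_derive x 1 p (p1 x).
Proof.
move=> sx; have d := is_derive_mul (is_derive_id x (1 : R)) (iD sx).
by apply: (is_derive_eq d); rewrite /p1 mul1r.
Qed.

Let p1D (x : R) : s x != 0 -> is_derive x 1 p1 (p2 x).
Proof.
move=> sx; have d1 := is_derive_mul (is_derive_id x (1 : R)) (i1D sx).
have d := is_derive_add (iD sx) d1.
by apply: (is_derive_eq d); rewrite /p2/=; ring.
Qed.

Let p2C (x : R) : s x != 0 -> {for x, continuous p2}.
Proof.
move=> sx.
have ci : {for x, continuous i} by exact: is_derive_continuous (iD sx).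
have ci1 : {for x, continuous i1} by exact: is_derive_continuous (i1D sx).
have cs1 : {for x, continuous s1} by exact: is_derive_continuous (s1D x).
have cs2 : {for x, continuous s2}.
  have d1 := is_derive_scale (c ^+ 2) (is_derive_dilate (is_derive_cos (c * x))).
  exact: is_derive_continuous d1.
have cX (f : R -> R) n : {for x, continuous f} -> {for x, continuous (fun y => f y ^+ n)}.
  by move=> cf; apply: (@continuous_comp _ _ _ f (fun y => y ^+ n)) => //; exact: exprn_continuous.
have cM (f g : R -> R) : {for x, continuous f} -> {for x, continuous g} ->
    {for x, continuous (fun y => f y * g y)} by move=> cf cg; exact: cvgM.
have cA (f g : R -> R) : {for x, continuous f} -> {for x, continuous g} ->
    {for x, continuous (fun y => f y + g y)} by move=> cf cg; exact: cvgD.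
have cN (f : R -> R) : {for x, continuous f} -> {for x, continuous (fun y => - f y)}
  by move=> cf; exact: cvgN.
have cc (k : R) : {for x, continuous (fun _ : R => k)} by exact: cst_continuous.
have ci2 : {for x, continuous i2}.
  apply: (cA (fun y => - (s2 y * i y ^+ 2)) (fun y => 2 * s1 y ^+ 2 * i y ^+ 3)).
    by apply: (cN (fun y => s2 y * i y ^+ 2)); apply: (cM s2) => //; exact: cX.
  apply: (cM (fun y => 2 * s1 y ^+ 2)); last exact: cX.
  by apply: cM => //; exact: cX.
by apply: cA; apply: cM.
Qed.

Let q x := eta x * p x.
Let q1 x := eta1 x * p x + eta x * p1 x.
Let q2 x := eta2 x * p x + 2 * (eta1 x * p1 x) + eta x * p2 x.

Let qD (x : R) : is_derive x 1 q (q1 x).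
Proof.
have [Zx|nZ] := pselect (Z x).
  have -> : q1 x = 0 by rewrite /q1 eta1Z// etaZ// !mul0r addr0.
  by apply: is_derive_Z => // y Zy; rewrite /q etaZ// mul0r.
exact: (is_derive_mul (etaD x) (pD (s_neq0 nZ))).
Qed.

Let q1D (x : R) : is_derive x 1 q1 (q2 x).
Proof.
have [Zx|nZ] := pselect (Z x).
  have -> : q2 x = 0 by rewrite /q2 eta2Z// eta1Z// etaZ// !mul0r mulr0 !addr0.
  by apply: is_derive_Z => // y Zy; rewrite /q1 eta1Z// etaZ// !mul0r addr0.
have d1 := is_derive_mul (eta1D x) (pD (s_neq0 nZ)).
have d2 := is_derive_mul (etaD x) (p1D (s_neq0 nZ)).
by apply: (is_derive_eq (is_derive_add d1 d2)); rewrite /q2; ring.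
Qed.

Let q2C : continuous q2.
Proof.
move=> x; have [Zx|nZ] := pselect (Z x).
  have q2Z y : Z y -> q2 y = 0.
    by move=> Zy; rewrite /q2 eta2Z// eta1Z// etaZ// !mul0r mulr0 !addr0.
  exact: is_derive_continuous (is_derive_Z Zx q2Z).
have sx := s_neq0 nZ.
have cp : {for x, continuous p} by exact: is_derive_continuous (pD sx).
have cp1 : {for x, continuous p1} by exact: is_derive_continuous (p1D sx).
have ce : {for x, continuous eta} by exact: is_derive_continuous (etaD x).
have ce1 : {for x, continuous eta1} by exact: is_derive_continuous (eta1D x).
apply: cvgD; last by apply: cvgM => //; exact: p2C.
apply: cvgD; first by apply: cvgM => //; exact: eta2C.
by apply: cvgMr; apply: cvgM.
Qed.

(* [(1 - cos (pi x / 2)) / x] is, up to a constant factor, the multiplier of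
   [davg (2^-k / 4)] at frequency [2^k x]. *)
Lemma LP_inverse_symbol : exists (m m1 m2 : R -> R) (M : R),
  [/\ [/\ forall x : R, is_derive x 1 m (m1 x), forall x : R, is_derive x 1 m1 (m2 x) &
        continuous m2],
      forall x, 5 / 2 < `|x| -> m x = 0 /\ m1 x = 0,
      m 0 = 0 /\ forall x, eta x = m x * ((1 - cos (pi / 2 * x)) / x),
      0 < M &
      forall x, `|m x| <= M /\ `|m2 x| <= M].
Proof.
have [M0 M00 hM0] : exists2 M, 0 < M & forall x, `|q x| <= M.
  apply: (@bounded_continuous_supp _ _ (5 / 2)); first by [].
    by move=> x; exact: is_derive_continuous (qD x).
  by move=> x x52; rewrite /q etaZ ?mul0r//; right.
have [M2 M20 hM2] : exists2 M, 0 < M & forall x, `|q2 x| <= M.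
  apply: (@bounded_continuous_supp _ _ (5 / 2)); first by [].
    exact: q2C.
  move=> x x52; have Zx : Z x by right.
  by rewrite /q2 eta2Z// eta1Z// etaZ// !mul0r mulr0 !addr0.
exists q, q1, q2, (M0 + M2); split => //.
- move=> x x52; have Zx : Z x by right.
  by rewrite /q /q1 eta1Z// etaZ// !mul0r addr0.
- split; first by rewrite /q etaZ ?mul0r//; left; rewrite normr0.
  move=> x; have [Zx|nZ] := pselect (Z x).
    by rewrite /q etaZ// !mul0r.
  have sx := s_neq0 nZ.
  rewrite /q /p /i -/c -/(s x).
  have x0 : x != 0.
    by apply/eqP => x0; apply: nZ; left; rewrite x0 normr0.
  by field; rewrite x0 sx.
- by rewrite addr_gt0.
move=> x; split.
  by apply: (le_trans (hM0 x)); rewrite lerDl ltW.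
by apply: (le_trans (hM2 x)); rewrite lerDr ltW.
Qed.

End inverse_symbol.

Section kernel_fubini.
Context {R : realType}.
Notation mu := (@lebesgue_measure R).
Notation integrable f := (mu.-integrable [set: R] (EFin \o f)).
Implicit Types (m g f : R -> R).

Lemma integrable_mulr_bounded f g (M : R) : integrable f ->
  measurable_fun [set: R] g -> (forall x, `|g x| <= M) ->
  integrable (fun x => f x * g x).
Proof.
move=> fi mg gM.
have M0 : 0 <= M by apply: le_trans (gM 0).
have mf := measurable_integrable fi.
apply: (@integrable_le _ _ (fun x => M * `|f x|)).
- exact (integrableZl measurableT M (integrable_norm fi)).
- exact: measurable_funM.
- by move=> x; rewrite normrM mulrC ler_wpM2r.
Qed.

Lemma EFin_Rintegral f : integrable f ->
  ((\int[mu]_x f x)%R%:E = \int[mu]_x (f x)%:E)%E.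
Proof. by move=> fi; rewrite /Rintegral fineK//; exact: integrable_fin_num. Qed.

Section bounded_kernel.
Variables (m g : R -> R) (k : R * R -> R).
Hypotheses (mi : integrable m) (gi : integrable g)
  (mk : measurable_fun [set: R * R] k) (k1 : forall p, `|k p| <= 1).

Let H (p : R * R) : \bar R := (m p.1 * g p.2 * k p)%:E.

Let mm := measurable_integrable mi.
Let mg := measurable_integrable gi.

Let mH : measurable_fun [set: R * R] H.
Proof.
apply/measurable_EFinP; apply: measurable_funM => //.
by apply: measurable_funM; exact: measurableT_comp.
Qed.

Let mkl x : measurable_fun [set: R] (fun y => k (x, y)).
Proof. exact (measurableT_comp mk (pair1_measurable x)). Qed.

Let mkr y : measurable_fun [set: R] (fun x => k (x, y)).
Proof. exact (measurableT_comp mk (pair2_measurable y)). Qed.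

Let gki x : integrable (fun y => g y * k (x, y)).
Proof. by apply: (@integrable_mulr_bounded _ _ 1). Qed.

Let mki y : integrable (fun x => m x * k (x, y)).
Proof. by apply: (@integrable_mulr_bounded _ _ 1). Qed.

Let Hi : (mu \x mu)%E.-integrable [set: R * R] H.
Proof.
apply/integrable12ltyP; first exact: mH.
apply: (@le_lt_trans _ _ (\int[mu]_x (`|m x|%:E * \int[mu]_y `|g y|%:E))%E).
  apply: ge0_le_integral.
  - exact: measurableT.
  - by move=> x _; apply: integral_ge0.
  - apply: (@measurable_fun_fubini_tonelli_F _ _ _ _ R mu (fun p : R * R => `|H p|%E)) => //.
    exact: measurableT_comp.
  - apply: emeasurable_funM => //; apply/measurable_EFinP; exact: measurableT_comp.
  move=> x _ /=; have mng : measurable_fun [set: R] (fun y => `|g y|).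
    exact: measurableT_comp.
  have mmgk : measurable_fun [set: R] (fun y => `|m x * g y * k (x, y)|).
    apply: measurableT_comp => //.
    exact (measurable_funM (measurable_funM (@measurable_cst _ _ _ _ setT (m x)) mg) (mkl x)).
  have mmg : measurable_fun [set: R] (fun y => `|m x| * `|g y|) by exact: measurable_funM.
  rewrite -(nnintZ (normr_ge0 (m x)) mng) => [|y]; last exact: normr_ge0.
  apply: (nnint_le mmgk mmg) => y; first exact: normr_ge0.
  by rewrite !normrM ler_piMr// mulr_ge0.
have mnm : measurable_fun [set: R] (fun y => `|m y|) by exact: measurableT_comp.
have [_ mfin] := integrableP _ _ _ mi; have [_ gfin] := integrableP _ _ _ gi.
set c := (\int[mu]_y `|g y|%:E)%E in gfin *.
have c0 : (0 <= c)%E by exact: integral_ge0.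
have cfin : c \is a fin_num by rewrite ge0_fin_numE.
rewrite -(fineK cfin).
have -> : (\int[mu]_x (`|m x|%:E * (fine c)%:E) = \int[mu]_x (fine c * `|m x|)%R%:E)%E.
  by apply: eq_integral => x _; rewrite -EFinM mulrC.
rewrite (nnintZ (fine_ge0 c0) mnm) => [|y]; last exact: normr_ge0.
by apply: lte_mul_pinfty => //; rewrite lee_fin fine_ge0.
Qed.

Let FE x : fubini_F mu H x = (m x * \int[mu]_y (g y * k (x, y)))%R%:E.
Proof.
rewrite EFinM EFin_Rintegral//.
rewrite -(@integralZl _ _ _ mu setT measurableT _ (gki x)).
by apply: eq_integral => y _; rewrite /H /= -EFinM mulrA.
Qed.

Let GE y : fubini_G mu H y = (g y * \int[mu]_x (m x * k (x, y)))%R%:E.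
Proof.
rewrite EFinM EFin_Rintegral//.
rewrite -(@integralZl _ _ _ mu setT measurableT _ (mki y)).
by apply: eq_integral => x _; rewrite /H /= -EFinM mulrCA mulrA.
Qed.

Lemma integrable_bounded_kernel :
  integrable (fun x => m x * \int[mu]_y (g y * k (x, y))).
Proof.
apply: (@eq_integrable _ _ _ mu setT measurableT (fubini_F mu H)).
  by move=> x _; rewrite FE.
exact: integrable_fubini_F.
Qed.

Lemma fubini_bounded_kernel :
  \int[mu]_x (m x * \int[mu]_y (g y * k (x, y))) =
  \int[mu]_y (g y * \int[mu]_x (m x * k (x, y))).
Proof.
rewrite /Rintegral; congr fine.
transitivity (\int[mu]_x fubini_F mu H x)%E.
  by apply: eq_integral => x _; rewrite FE.
transitivity (\int[mu]_y fubini_G mu H y)%E; first exact: (Fubini Hi).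
by apply: eq_integral => y _; rewrite GE.
Qed.

End bounded_kernel.
End kernel_fubini.

Section kernel_bound.
Context {R : realType}.
Notation mu := (@lebesgue_measure R).

Lemma phi_gt0 (x : R) : 0 < phi x.
Proof. by rewrite powR_gt0// ltr_pwDl// sqr_ge0. Qed.

Lemma phi_le1 (x : R) : phi x <= 1.
Proof.
have x1 : 1 <= 1 + x ^+ 2 by rewrite lerDl sqr_ge0.
have p0 : 0 < 1 + x ^+ 2 by lra.
rewrite /phi powRN invf_le1 ?powR_gt0//.
by rewrite -[leLHS](powRr0 (1 + x ^+ 2)); apply: ler_powR => //; lra.
Qed.

Lemma phi_ge_inv (x : R) : (1 + x ^+ 2)^-1 <= phi x.
Proof.
have x1 : 1 <= 1 + x ^+ 2 by rewrite lerDl sqr_ge0.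
have p0 : 0 < 1 + x ^+ 2 by lra.
rewrite /phi powRN lef_pV2 ?posrE ?powR_gt0//.
by rewrite -[leRHS]powRr1 ?(ltW p0)//; apply: ler_powR => //; lra.
Qed.

Lemma phi_scaled_gt0 (t x : R) : 0 < t -> 0 < phi_scaled t x.
Proof. by move=> t0; rewrite mulr_gt0 ?invr_gt0 ?phi_gt0. Qed.

Lemma phi_scaled_le (t x : R) : 0 < t -> phi_scaled t x <= t^-1.
Proof. by move=> t0; rewrite ler_piMr ?phi_le1// invr_ge0 ltW. Qed.

Lemma measurable_phi_scaled (t x : R) : 0 < t ->
  measurable_fun [set: R] (fun y => phi_scaled t (x - y)).
Proof.
move=> t0; apply: measurable_funM => //.
apply: (measurableT_comp (@measurable_powR R (- (3 / 4)))).
apply: measurable_funD => //; apply: measurable_funX; apply: measurable_funM => //.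
exact: measurable_funB.
Qed.

Lemma dilated_kernel_bound (T T1 m m1 m2 : R -> R) (M t u : R) :
  trig_pair T T1 -> 0 < t -> 0 < M ->
  (forall x : R, is_derive x 1 m (m1 x)) -> (forall x : R, is_derive x 1 m1 (m2 x)) ->
  continuous m2 -> (forall x, 5 / 2 < `|x| -> m x = 0 /\ m1 x = 0) ->
  (forall x, `|m x| <= M /\ `|m2 x| <= M) ->
  `|\int[mu]_(x in `[- (3 / t), 3 / t]) (m (t * x) * T (2 * pi * u * x))| <=
  12 * M * phi_scaled t u.
Proof.
move=> TT t0 M0 dm dm1 cm2 m0 mM.
have A0 : 0 < 3 / t by rewrite divr_gt0.
have tA : t * (3 / t) = 3 by field; exact: lt0r_neq0.
have tNA : t * - (3 / t) = - 3 by rewrite mulrN tA.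
have big3 : (5 / 2 : R) < `|3| by rewrite ger0_norm; lra.
have bigN3 : (5 / 2 : R) < `|-3| by rewrite normrN ger0_norm; lra.
have dq (x : R) := is_derive_dilate (dm (t * x)).
have cq : continuous (fun x => m (t * x)).
  by move=> x; exact: is_derive_continuous (dq x).
have B1 := @oscillatory_bound R T T1 (fun x => m (t * x)) (3 / t) M (2 * pi * u)
  TT A0 cq (fun x => (mM (t * x)).1).
set K := `|_| in B1 *.
have M6 : 0 < M * 6 / t by rewrite divr_gt0// mulr_gt0.
pose v := u / t.
have B2 : K * v ^+ 2 <= M * 6 / t.
  have [u0|u0] := eqVneq u 0.
    by rewrite /v u0 mul0r expr0n/= mulr0 ltW.
  have a0 : 2 * pi * u != 0 by rewrite !mulf_neq0 ?pnatr_eq0// gt_eqF// pi_gt0.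
  have dq1 (x : R) : is_derive x 1 (fun x => t * m1 (t * x)) (t * (t * m2 (t * x))).
    exact: (is_derive_scale t (is_derive_dilate (dm1 (t * x)))).
  have cq2 : continuous (fun x => t * (t * m2 (t * x))).
    move=> x; apply: cvgMr; apply: cvgMr.
    apply: (@continuous_comp _ _ _ (fun x => t * x) m2); last exact: cm2.
    exact: mulrl_continuous.
  have := @oscillatory_decay R T T1 _ _ _ (3 / t) (t ^+ 2 * M) (2 * pi * u) TT A0 a0
    dq dq1 cq2.
  rewrite tA tNA (m0 _ big3).1 (m0 _ bigN3).1 (m0 _ big3).2 (m0 _ bigN3).2 !mulr0.
  move=> /(_ erefl erefl erefl erefl) H.
  have {}H := H ltac:(by move=> x; rewrite mulrA -expr2 normrM ger0_norm ?sqr_ge0// ler_wpM2l ?sqr_ge0//; exact: (mM (t * x)).2).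
  rewrite -/K in H.
  have p1 : 1 <= (2 * pi) ^+ 2 :> R.
    by rewrite expr_ge1//; [have := pi_ge2 R; lra|have := pi_ge0 R; lra].
  have v0 : 0 <= v ^+ 2 by rewrite sqr_ge0.
  apply: (le_trans (ler_wpM2r v0 H)).
  have E (P : R) : P != 0 ->
    2 * (3 / t) * (t ^+ 2 * M) / (2 * P * u) ^+ 2 * v ^+ 2 = M * 6 / t / (2 * P) ^+ 2.
    by move=> P0; rewrite /v; field; rewrite P0 u0 (gt_eqF t0).
  rewrite (E _ (lt0r_neq0 (pi_gt0 R))).
  by rewrite ler_pdivrMr ?(lt_le_trans _ p1)// ler_peMr// ltW.
have {}B1 : K <= M * 6 / t.
  by apply: (le_trans B1); rewrite le_eqVlt; apply/orP; left; apply/eqP; field; exact: lt0r_neq0.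
have v1 : 0 < 1 + v ^+ 2 by rewrite ltr_pwDl// sqr_ge0.
apply: (@le_trans _ _ (12 * M / t * (1 + v ^+ 2)^-1)).
  rewrite ler_pdivlMr// mulrDr mulr1.
  apply: (le_trans (lerD B1 B2)); lra.
rewrite /phi_scaled -/v.
have -> : 12 * M * (t^-1 * phi v) = 12 * M / t * phi v by ring.
apply: ler_wpM2l; last exact: phi_ge_inv.
by apply: divr_ge0; [rewrite mulr_ge0// ltW|exact: ltW].
Qed.

End kernel_bound.

Section difference_multiplier.
Context {R : realType}.
Notation mu := (@lebesgue_measure R).
Notation integrable f := (mu.-integrable [set: R] (EFin \o f)).
Implicit Types (f g : R -> R).

Lemma integrable_window (a b : R) f : a <= b -> integrable f -> integrable (window a b f).
Proof.
move=> ab fi.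
have c1 (y : R) : `|cst (1 : R) y : R| <= 1 by rewrite normr1.
have ki := @integrable_window_kernel R a b f (cst 1) 1 ab fi
  (@measurable_cst _ _ _ _ _ _) c1.
apply: (@eq_integrable _ _ _ mu setT measurableT (fubini_F mu
  (fun p : R * R => (f p.2 * cst 1 p.1 * window_indic a b p.1 p.2)%R%:E))).
  move=> y _; rewrite /comp EFin_window// window_indicE /fubini_F.
  by apply: eq_integral => x _; rewrite /= mulr1.
exact: integrable_fubini_F.
Qed.

Lemma integrable_davg (h : R) f : 0 < h -> integrable f -> integrable (davg h f).
Proof.
move=> h0 fi.
have w1 : integrable (window 0 h f) by apply: integrable_window => //; exact: ltW.
have w2 : integrable (window (- h) 0 f).
  by apply: integrable_window => //; rewrite oppr_le0 ltW.
have i12 := integrableZl measurableT (2 * h)^-1 (integrableB measurableT w1 w2).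
apply: (@eq_integrable _ _ _ mu setT measurableT _ _ _ i12).
by move=> y _; rewrite /comp/= davgE// -EFinB -EFinM mulrC.
Qed.

Lemma trig_primitive (T T1 : R -> R) (w x al be : R) : trig_pair T T1 -> w != 0 -> al < be ->
  \int[mu]_(y in `]al, be]) T (w * (x - y)) =
  (T1 (w * (x - be)) - T1 (w * (x - al))) / w.
Proof.
move=> TT w0 ab; have cT := trig_pair_continuous TT; case: TT => dT dT1 _.
pose F (y : R) : R := w^-1 * T1 (w * (x - y)).
have dl (y : R) : is_derive y 1 (fun y => w * (x - y)) (- w).
  have d1 := is_derive_scale w (is_derive_add (is_derive_cst x y (1 : R)) (is_deriveN (is_derive_id y (1 : R)))).
  by apply: (is_derive_eq d1); rewrite add0r mulrN1.
have dF (y : R) : is_derive y 1 F (T (w * (x - y))).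
  have d2 := @is_derive1_comp _ T1 (fun y => w * (x - y)) y _ _ (dT1 _) (dl y).
  have d3 := is_derive_scale w^-1 d2.
  by apply: (is_derive_eq d3); field.
have cTw : continuous (fun y => T (w * (x - y))).
  move=> y; have d := @is_derive1_comp _ T (fun y => w * (x - y)) y _ _ (dT _) (dl y).
  exact: is_derive_continuous d.
rewrite Rintegral_itv_obnd_cbnd; last first.
  apply: (@integrableS _ _ _ mu `[al, be]%classic).
  - exact: measurable_itv.
  - exact: measurable_itv.
  - by move=> y /=; rewrite !in_itv/= => /andP[/ltW -> ->].
  apply: continuous_compact_integrable; first exact: segment_compact.
  exact: continuous_subspaceT.
have FF (y : R) : {for y, continuous F} by exact: is_derive_continuous (dF y).
have dFoo : derivable_oo_LRcontinuous F al be.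
  split => [y _||]; first by case: (dF y).
  - exact/cvg_at_right_filter/FF.
  - exact/cvg_at_left_filter/FF.
have := @continuous_FTC2 R _ F al be ab (continuous_subspaceT cTw) dFoo.
move=> H; have {}H := H ltac:(by move=> y _; rewrite derive1E; case: (dF y)).
by rewrite /Rintegral H -EFinB /= /F; field.
Qed.

Lemma trig_pair_measurable (T T1 : R -> R) (w x : R) : trig_pair T T1 ->
  measurable_fun [set: R] (fun y => T (w * (x - y))).
Proof.
move=> TT; apply: (measurableT_comp (continuous_measurable_fun (trig_pair_continuous TT))).
by apply: measurable_funM => //; exact: measurable_funB.
Qed.

Lemma trig_pair_derivative (T T1 : R -> R) :
  (T = sin /\ T1 = cos) \/ (T = cos /\ T1 = (fun x => - sin x)) ->
  [/\ trig_pair T T1, forall a b : R, T1 (a + b) + T1 (a - b) = 2 * T1 a * cos b,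
    forall x, `|T1 x| <= 1 & continuous T1].
Proof.
have c1 (x : R) : `|cos x| <= 1 by rewrite ler_norml cos_geN1 cos_le1.
have s1 (x : R) : `|sin x| <= 1 by rewrite ler_norml sin_geN1 sin_le1.
case=> -[-> ->]; split => //.
- exact: trig_pair_sin.
- by move=> a b; rewrite cosD cosB; ring.
- exact: continuous_cos.
- exact: trig_pair_cos.
- by move=> a b; rewrite sinD sinB; ring.
- by move=> x; rewrite normrN.
- by move=> x; apply: cvgN; exact: continuous_sin.
Qed.

Lemma davg_multiplier (T T1 : R -> R) (h : R) f (w x : R) :
  (T = sin /\ T1 = cos) \/ (T = cos /\ T1 = (fun x => - sin x)) ->
  0 < h -> w != 0 -> integrable f ->
  \int[mu]_y (davg h f y * T (w * (x - y))) =
  (1 - cos (h * w)) / (h * w) * \int[mu]_z (f z * T1 (w * (x - z))).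
Proof.
move=> /trig_pair_derivative[TT addT T1le cT1] h0 w0 fi.
have h00 := lt0r_neq0 h0.
pose g y := T (w * (x - y)).
have mg : measurable_fun [set: R] g by exact: trig_pair_measurable TT.
have g1 y : `|g y| <= 1 by case: TT => _ _; apply.
have w1 : integrable (window 0 h f) by apply: integrable_window => //; exact: ltW.
have w2 : integrable (window (- h) 0 f).
  by apply: integrable_window => //; rewrite oppr_le0 ltW.
have i1 := integrable_mulr_bounded w1 mg g1.
have i2 := integrable_mulr_bounded w2 mg g1.
transitivity (\int[mu]_y ((2 * h)^-1 * (window 0 h f y * g y - window (- h) 0 f y * g y))).
  by apply: eq_Rintegral => y _; rewrite davgE// /g; ring.
rewrite RintegralZl//; last exact (integrableB measurableT i1 i2).
rewrite RintegralB//.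
rewrite (fubini_window (ltW h0) fi mg g1).
rewrite (@fubini_window _ (- h) 0 f g 1 _ fi mg g1) ?oppr_le0 ?ltW//.
have mT1 c : measurable_fun [set: R] (fun z => T1 (w * (x - z) + c)).
  apply: (measurableT_comp (continuous_measurable_fun cT1)).
  by apply: measurable_funD => //; apply: measurable_funM => //; exact: measurable_funB.
have I1 z : \int[mu]_(y in `]z - h, z - 0]) g y =
    w^-1 * (T1 (w * (x - z) + 0) - T1 (w * (x - z) + h * w)).
  rewrite (trig_primitive _ TT w0); last by lra.
  by rewrite mulrC; congr (_ * (T1 _ - T1 _)); ring.
have I2 z : \int[mu]_(y in `]z - 0, z - - h]) g y =
    w^-1 * (T1 (w * (x - z) + - (h * w)) - T1 (w * (x - z) + 0)).
  rewrite (trig_primitive _ TT w0); last by lra.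
  by rewrite mulrC; congr (_ * (T1 _ - T1 _)); ring.
have mJ c d : measurable_fun [set: R]
    (fun z => w^-1 * (T1 (w * (x - z) + c) - T1 (w * (x - z) + d))).
  by apply: measurable_funM => //; exact: measurable_funB.
have J1 c d z : `|w^-1 * (T1 (w * (x - z) + c) - T1 (w * (x - z) + d))| <= `|w^-1| * 2.
  rewrite normrM ler_wpM2l//; apply: (le_trans (ler_normB _ _)).
  by have := T1le (w * (x - z) + c); have := T1le (w * (x - z) + d); lra.
have -> : \int[mu]_z (f z * \int[mu]_(y in `]z - h, z - 0]) g y) =
    \int[mu]_z (f z * (w^-1 * (T1 (w * (x - z) + 0) - T1 (w * (x - z) + h * w)))).
  by apply: eq_Rintegral => z _; rewrite I1.
have -> : \int[mu]_z (f z * \int[mu]_(y in `]z - 0, z - - h]) g y) =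
    \int[mu]_z (f z * (w^-1 * (T1 (w * (x - z) + - (h * w)) - T1 (w * (x - z) + 0)))).
  by apply: eq_Rintegral => z _; rewrite I2.
rewrite -RintegralB//; last 2 first.
- exact: (integrable_mulr_bounded fi (mJ _ _) (J1 _ _)).
- exact: (integrable_mulr_bounded fi (mJ _ _) (J1 _ _)).
have mT1' : measurable_fun [set: R] (fun z => T1 (w * (x - z))).
  by apply: (eq_measurable_fun _ _ (mT1 0)) => z _; rewrite addr0.
have fT1 := integrable_mulr_bounded fi mT1' (fun z => T1le _).
rewrite -!RintegralZl//; last exact (integrableB measurableT
  (integrable_mulr_bounded fi (mJ _ _) (J1 _ _))
  (integrable_mulr_bounded fi (mJ _ _) (J1 _ _))).
apply: eq_Rintegral => z _.
have := addT (w * (x - z)) (h * w).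
rewrite !addr0; set A := T1 (_ + h * w); set B := T1 (_ - h * w).
set c := cos _; set D := T1 _ => E.
have -> : B = 2 * D * c - A by rewrite -E addrAC subrr add0r.
by field; rewrite h00 w0.
Qed.

End difference_multiplier.

Section projection_bound.
Context {R : realType}.
Notation mu := (@lebesgue_measure R).
Notation integrable f := (mu.-integrable [set: R] (EFin \o f)).

Lemma Re_mulC (z : R[i]) (c s : R) :
  complex.Re (z * Complex c s) = complex.Re z * c - complex.Im z * s.
Proof. by case: z. Qed.

Lemma Im_mulC (z : R[i]) (c s : R) :
  complex.Im (z * Complex c s) = complex.Re z * s + complex.Im z * c.
Proof. by case: z. Qed.

Lemma Re_realM (k : R) (z : R[i]) : complex.Re (k%:C%C * z) = k * complex.Re z.
Proof. by case: z => u v /=; rewrite mul0r subr0. Qed.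

Lemma Im_realM (k : R) (z : R[i]) : complex.Im (k%:C%C * z) = k * complex.Im z.
Proof. by case: z => u v /=; rewrite mul0r addr0. Qed.

Definition osc (T : R -> R) (g : R -> R) (x xi : R) : R :=
  \int[mu]_y (g y * T (2 * pi * (x - y) * xi)).

Lemma measurable_osc_kernel (T T1 : R -> R) (x : R) : trig_pair T T1 ->
  measurable_fun [set: R * R] (fun p : R * R => T (2 * pi * (x - p.2) * p.1)).
Proof.
move=> TT; apply: (measurableT_comp (continuous_measurable_fun (trig_pair_continuous TT))).
apply: measurable_funM => //; apply: measurable_funM => //.
exact: measurable_funB.
Qed.

Lemma osc_kernel_integrable (T T1 : R -> R) (x xi : R) g : trig_pair T T1 ->
  integrable g -> integrable (fun y => g y * T (2 * pi * (x - y) * xi)).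
Proof.
move=> TT gi; apply: (@integrable_mulr_bounded _ _ _ 1) => //.
- exact (measurableT_comp (measurable_osc_kernel x TT) (pair1_measurable xi)).
- by case: TT => _ _ T1le y; exact: T1le.
Qed.

Section multiplier_real_imag.
Variables (f : R -> R[i]).
Let f1 y := complex.Re (f y).
Let f2 y := complex.Im (f y).
Hypotheses (f1i : integrable f1) (f2i : integrable f2).

Let ci g x xi : integrable g -> integrable (fun y => g y * cos (2 * pi * (x - y) * xi)).
Proof. by move=> gi; exact: (osc_kernel_integrable x xi trig_pair_cos gi). Qed.

Let si g x xi : integrable g -> integrable (fun y => g y * sin (2 * pi * (x - y) * xi)).
Proof. by move=> gi; exact: (osc_kernel_integrable x xi trig_pair_sin gi). Qed.

Lemma Re_fourier_multiplier (m : R -> R) (x : R) :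
  complex.Re (fourier_multiplier m f x) =
  \int[mu]_xi (m xi * (osc cos f1 x xi - osc sin f2 x xi)).
Proof.
rewrite /fourier_multiplier /cintegral; apply: eq_Rintegral => xi _.
rewrite {1}/cexp Re_mulC Re_realM Im_realM.
rewrite -[_ * cos _]mulrA -[_ * sin _]mulrA -mulrBr; congr (_ * _).
rewrite /fourier /cintegral /=.
have E1 y : complex.Re (f y * cexp (- (2 * pi * y * xi))) =
    f1 y * cos (2 * pi * (0 - y) * xi) - f2 y * sin (2 * pi * (0 - y) * xi).
  by rewrite /cexp Re_mulC; congr (_ * cos _ - _ * sin _); ring.
have E2 y : complex.Im (f y * cexp (- (2 * pi * y * xi))) =
    f1 y * sin (2 * pi * (0 - y) * xi) + f2 y * cos (2 * pi * (0 - y) * xi).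
  by rewrite /cexp Im_mulC; congr (_ * sin _ + _ * cos _); ring.
under eq_Rintegral do rewrite E1.
under [X in _ - X * _]eq_Rintegral do rewrite E2.
have i1 := integrableB measurableT (ci 0 xi f1i) (si 0 xi f2i).
have i2 := integrableD measurableT (si 0 xi f1i) (ci 0 xi f2i).
rewrite -(RintegralZr _ measurableT i1) -(RintegralZr _ measurableT i2).
rewrite /osc -RintegralB//; [|exact (integrableZr measurableT _ i1)|exact (integrableZr measurableT _ i2)].
rewrite -RintegralB//; [|exact: ci|exact: si].
apply: eq_Rintegral => y _.
have -> : 2 * pi * (x - y) * xi = 2 * pi * (0 - y) * xi + 2 * pi * x * xi by ring.
by rewrite cosD sinD; ring.
Qed.

Lemma Im_fourier_multiplier (m : R -> R) (x : R) :
  complex.Im (fourier_multiplier m f x) =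
  \int[mu]_xi (m xi * (osc sin f1 x xi + osc cos f2 x xi)).
Proof.
rewrite /fourier_multiplier /cintegral; apply: eq_Rintegral => xi _.
rewrite {1}/cexp Im_mulC Re_realM Im_realM.
rewrite -[_ * sin _]mulrA -[_ * cos _]mulrA -mulrDr; congr (_ * _).
rewrite /fourier /cintegral /=.
have E1 y : complex.Re (f y * cexp (- (2 * pi * y * xi))) =
    f1 y * cos (2 * pi * (0 - y) * xi) - f2 y * sin (2 * pi * (0 - y) * xi).
  by rewrite /cexp Re_mulC; congr (_ * cos _ - _ * sin _); ring.
have E2 y : complex.Im (f y * cexp (- (2 * pi * y * xi))) =
    f1 y * sin (2 * pi * (0 - y) * xi) + f2 y * cos (2 * pi * (0 - y) * xi).
  by rewrite /cexp Im_mulC; congr (_ * sin _ + _ * cos _); ring.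
under eq_Rintegral do rewrite E1.
under [X in _ + X * _]eq_Rintegral do rewrite E2.
have i1 := integrableB measurableT (ci 0 xi f1i) (si 0 xi f2i).
have i2 := integrableD measurableT (si 0 xi f1i) (ci 0 xi f2i).
rewrite -(RintegralZr _ measurableT i1) -(RintegralZr _ measurableT i2).
rewrite /osc -RintegralD//; [|exact (integrableZr measurableT _ i1)|exact (integrableZr measurableT _ i2)].
rewrite -RintegralD//; [|exact: si|exact: ci].
apply: eq_Rintegral => y _.
have -> : 2 * pi * (x - y) * xi = 2 * pi * (0 - y) * xi + 2 * pi * x * xi by ring.
by rewrite cosD sinD; ring.
Qed.

End multiplier_real_imag.

Section dilated_symbol.
Variables (m m1 m2 : R -> R) (M t : R).
Hypotheses (t0 : 0 < t) (M0 : 0 < M)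
  (dm : forall x : R, is_derive x 1 m (m1 x))
  (dm1 : forall x : R, is_derive x 1 m1 (m2 x))
  (cm2 : continuous m2)
  (m0 : forall x, 5 / 2 < `|x| -> m x = 0 /\ m1 x = 0)
  (mM : forall x, `|m x| <= M /\ `|m2 x| <= M).

Let cq : continuous (fun x => m (t * x)).
Proof. by move=> x; exact: is_derive_continuous (is_derive_dilate (dm (t * x))). Qed.

Let q0 x : ~ `[- (3 / t), 3 / t]%classic x -> m (t * x) = 0.
Proof.
move=> nx; apply: (m0 _).1.
rewrite ltNge; apply/negP => H; apply: nx; rewrite /= in_itv/= -ler_norml.
rewrite ler_pdivlMr// mulrC.
by move: H; rewrite normrM (gtr0_norm t0); lra.
Qed.

Let qi : integrable (fun x => m (t * x)).
Proof.
have mI : measurable (`[- (3 / t), 3 / t]%classic : set (measurableTypeR R)) by exact: measurable_itv.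
have i1 : mu.-integrable `[- (3 / t), 3 / t] (EFin \o (fun x => m (t * x))).
  apply: continuous_compact_integrable; first exact: segment_compact.
  exact: continuous_subspaceT.
have i2 := (@integrable_mkcond _ _ _ mu _ (EFin \o (fun x => m (t * x))) mI).1 i1.
apply: (@eq_integrable _ _ _ mu setT measurableT _ _ _ i2) => x _.
by rewrite patchE; case: ifPn => // /negP; rewrite inE => /q0 H; rewrite /comp H.
Qed.

Lemma integrable_dilated_osc (T T1 g : R -> R) (x : R) : trig_pair T T1 ->
  integrable g -> integrable (fun xi => m (t * xi) * osc T g x xi).
Proof.
move=> TT gi.
have [_ _ T1le] := TT.
exact: (integrable_bounded_kernel qi gi (measurable_osc_kernel x TT) (fun p => T1le _)).
Qed.

Lemma integrable_phi_scaled (g : R -> R) (x : R) : integrable g ->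
  integrable (fun y => phi_scaled t (x - y) * g y).
Proof.
move=> gi.
have H : integrable (fun y => g y * phi_scaled t (x - y)).
  apply: (integrable_mulr_bounded gi (measurable_phi_scaled x t0) (M := t^-1)) => y.
  by rewrite gtr0_norm ?phi_scaled_gt0// phi_scaled_le.
by apply: (@eq_integrable _ _ _ mu setT measurableT _ _ _ H) => y _; rewrite /comp mulrC.
Qed.

Lemma dilated_osc_le (T T1 g : R -> R) (x : R) : trig_pair T T1 -> integrable g ->
  `|\int[mu]_xi (m (t * xi) * osc T g x xi)| <=
  12 * M * \int[mu]_y (phi_scaled t (x - y) * `|g y|).
Proof.
move=> TT gi; have [_ _ T1le] := TT.
have mk := measurable_osc_kernel x TT.
have k1 (p : R * R) : `|T (2 * pi * (x - p.2) * p.1)| <= 1 by exact: T1le.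
rewrite /osc (fubini_bounded_kernel qi gi mk k1) /=.
pose K y := \int[mu]_xi (m (t * xi) * T (2 * pi * (x - y) * xi)).
have KE y : K y = \int[mu]_(xi in `[- (3 / t), 3 / t]) (m (t * xi) * T (2 * pi * (x - y) * xi)).
  rewrite [RHS]Rintegral_mkcond; apply: eq_Rintegral => xi _.
  by rewrite patchE; case: ifPn => // /negP; rewrite inE => /q0 ->; rewrite mul0r.
have K1 y : `|K y| <= 12 * M * phi_scaled t (x - y).
  by rewrite KE; exact: (dilated_kernel_bound _ TT t0 M0 dm dm1 cm2 m0 mM).
have gKi : integrable (fun y => g y * K y).
  exact: (integrable_bounded_kernel gi qi
    (measurableT_comp mk (@measurable_swap _ _ _ _)) (fun p => k1 (p.2, p.1))).
apply: (le_trans (le_normr_Rintegral measurableT gKi)).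
have gni := integrable_norm gi.
have pgi := @integrable_phi_scaled _ x gni.
rewrite -RintegralZl//; apply: le_Rintegral => //.
- exact: integrable_norm.
- exact (integrableZl measurableT (12 * M) pgi).
by move=> y _; rewrite normrM mulrC mulrA ler_wpM2r.
Qed.

End dilated_symbol.
Lemma osc_davg (T T1 : R -> R) (h : R) g (x xi : R) :
  (T = sin /\ T1 = cos) \/ (T = cos /\ T1 = (fun x => - sin x)) ->
  0 < h -> xi != 0 -> integrable g ->
  osc T (davg h g) x xi =
  (1 - cos (h * (2 * pi * xi))) / (h * (2 * pi * xi)) * osc T1 g x xi.
Proof.
move=> TT h0 xi0 gi.
have w0 : 2 * pi * xi != 0.
  by rewrite !mulf_neq0 ?pnatr_eq0// lt0r_neq0// pi_gt0.
have E y : 2 * pi * (x - y) * xi = 2 * pi * xi * (x - y) by ring.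
rewrite /osc; under eq_Rintegral do rewrite E.
by rewrite (davg_multiplier x TT h0 w0 gi); under [in RHS]eq_Rintegral do rewrite E.
Qed.

Lemma cmod_le (z : R[i]) : cmod z <= `|complex.Re z| + `|complex.Im z|.
Proof.
case: z => u v /=; rewrite /cmod /=.
rewrite -[leRHS]ger0_norm ?addr_ge0// -sqrtr_sqr ler_wsqrtr//.
rewrite sqrrD !real_normK ?num_real// lerD2r lerDl.
by rewrite mulrn_wge0// mulr_ge0.
Qed.

Lemma LP_proj_le (eta : R -> R) : LP_symbol eta ->
  exists2 C : R, 0 < C & forall (k : int) (f : R -> R[i]),
    integrable (fun y => complex.Re (f y)) -> integrable (fun y => complex.Im (f y)) ->
    forall x, cmod (LP_proj eta k f x) <=
      C * \int[mu]_y (phi_scaled ((2 : R) ^ (- k)) (x - y) *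
        (`|davg ((2 : R) ^ (- k) / 4) (fun y => complex.Re (f y)) y| +
         `|davg ((2 : R) ^ (- k) / 4) (fun y => complex.Im (f y)) y|)).
Proof.
move=> /LP_inverse_symbol[m [m1 [m2 [M [[dm dm1 cm2] m0 [m00 meta] M0 mM]]]]].
have pi0 := pi_gt0 R.
have [a aE a0] : exists2 a : R, a = pi / 2 & 0 < a by exists (pi / 2); rewrite ?divr_gt0.
exists (24 * M * a); first by rewrite !mulr_gt0.
move=> k f; set f1 := fun y => complex.Re (f y); set f2 := fun y => complex.Im (f y).
move=> f1i f2i x; set t := (2 : R) ^ (- k); set h := t / 4.
have t0 : 0 < t by exact: exprz_gt0.
have h0 : 0 < h by rewrite divr_gt0.
set D1 := davg h f1; set D2 := davg h f2.
have D1i : integrable D1 by exact: integrable_davg.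
have D2i : integrable D2 by exact: integrable_davg.
pose P (g : R -> R) : R := \int[mu]_y (phi_scaled t (x - y) * `|g y|).
have -> : \int[mu]_y (phi_scaled t (x - y) * (`|D1 y| + `|D2 y|)) = P D1 + P D2.
  rewrite /P -RintegralD//.
  - by apply: eq_Rintegral => y _; rewrite mulrDr.
  - exact: (integrable_phi_scaled t0 x (integrable_norm D1i)).
  - exact: (integrable_phi_scaled t0 x (integrable_norm D2i)).
have key (T T1 : R -> R) g xi : integrable g ->
    (T = sin /\ T1 = cos) \/ (T = cos /\ T1 = (fun x => - sin x)) ->
    eta (t * xi) * osc T1 g x xi = a * (m (t * xi) * osc T (davg h g) x xi).
  move=> gi TT; rewrite meta; have [->|xi0] := eqVneq xi 0.
    by rewrite mulr0 m00 !mul0r mulr0.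
  rewrite (osc_davg x TT h0 xi0 gi).
  have -> : h * (2 * pi * xi) = pi / 2 * (t * xi) by rewrite /h; field.
  rewrite -aE; set c := cos _; set o := osc _ _ _ _.
  by field; rewrite xi0 !lt0r_neq0.
have oscN g xi : integrable g -> osc (fun x => - sin x) g x xi = - osc sin g x xi.
  move=> gi; rewrite /osc -mulN1r -RintegralZl//; last exact: (osc_kernel_integrable x xi trig_pair_sin).
  by apply: eq_Rintegral => y _; rewrite mulN1r mulrN.
have bound (e : R) (T T1 S S1 : R -> R) : `|e| = 1 -> trig_pair T T1 -> trig_pair S S1 ->
    `|\int[mu]_xi (e * a * (m (t * xi) * osc T D1 x xi) +
        a * (m (t * xi) * osc S D2 x xi))| <= 12 * M * a * (P D1 + P D2).
  move=> e1 TT SS.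
  have i1 := integrable_dilated_osc t0 dm m0 x TT D1i.
  have i2 := integrable_dilated_osc t0 dm m0 x SS D2i.
  rewrite RintegralD//; [|exact (integrableZl measurableT (e * a) i1)|exact (integrableZl measurableT a i2)].
  rewrite !RintegralZl//.
  have := dilated_osc_le t0 M0 dm dm1 cm2 m0 mM x TT D1i.
  have := dilated_osc_le t0 M0 dm dm1 cm2 m0 mM x SS D2i.
  rewrite -/(P D1) -/(P D2) => H2 H1.
  have E (p q : R) : 12 * M * a * (p + q) = a * (12 * M * p) + a * (12 * M * q) by ring.
  rewrite E.
  have p2 := ltW a0.
  apply: (le_trans (ler_normD _ _)); apply: lerD.
    by rewrite !normrM e1 mul1r (ger0_norm p2) ler_wpM2l.
  by rewrite [leLHS]normrM (ger0_norm p2); exact: (ler_wpM2l p2 H2).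
apply: (le_trans (cmod_le _)).
have E (p : R) : 24 * M * a * p = 12 * M * a * p + 12 * M * a * p by ring.
rewrite E.
rewrite /LP_proj (Re_fourier_multiplier f1i f2i) (Im_fourier_multiplier f1i f2i) -/f1 -/f2.
apply: lerD.
- apply: le_trans (bound 1 _ _ _ _ (normr1 _) trig_pair_sin trig_pair_cos).
  rewrite le_eqVlt; apply/orP; left; apply/eqP; congr `|_|; apply: eq_Rintegral => xi _.
  rewrite mul1r -(key sin cos f1 xi f1i); last by left.
  rewrite -(key cos (fun x => - sin x) f2 xi f2i); last by right.
  by rewrite oscN// mulrBr mulrN.
- apply: le_trans (bound (-1) _ _ _ _ (normrN1 _) trig_pair_cos trig_pair_sin).
  rewrite le_eqVlt; apply/orP; left; apply/eqP; congr `|_|; apply: eq_Rintegral => xi _.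
  rewrite mulN1r mulNr -(key cos (fun x => - sin x) f1 xi f1i); last by right.
  rewrite -(key sin cos f2 xi f2i); last by left.
  by rewrite oscN// mulrDr mulrN opprK.
Qed.

End projection_bound.

(** * Transplantation to the level sets *)

Section transplant.
Context {R : realType}.
Notation mu := (@lebesgue_measure R).
Notation integrable f := (mu.-integrable [set: R] (EFin \o f)).

Lemma avg_symm (h : R) (F G : R -> R) : 0 < h -> integrable F -> integrable G ->
  (forall x, 0 <= F x) -> (forall x, 0 <= G x) ->
  (\int[mu]_y (avg h F y * G y)%R%:E = \int[mu]_x (F x * avg h G x)%R%:E)%E.
Proof.
move=> h0 Fi Gi F0 G0.
have mF := measurable_integrable Fi; have mG := measurable_integrable Gi.
pose G' y := G y * (2 * h)^-1.
have h2 : 0 <= (2 * h)^-1 by rewrite invr_ge0; lra.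
have G'0 y : 0 <= G' y by rewrite mulr_ge0.
have mG' : measurable_fun [set: R] G' by exact: measurable_funM.
have G'i : integrable G' by exact (integrableZr measurableT (2 * h)^-1 Gi).
have := tonelli_window (- h) h mF F0 mG' G'0.
move=> E; apply: (etrans _ (etrans E _)).
  by apply: eq_integral => y _; rewrite -EFin_window// -EFinM /avg /G' mulrA mulrAC.
apply: eq_integral => x _.
rewrite EFinM; congr (_ * _)%E.
rewrite integral_itv_obnd_cbnd; last first.
  by apply: measurable_funTS; apply/measurable_EFinP.
rewrite -integral_itv_bndo_bndc; last first.
  by apply: measurable_funTS; apply/measurable_EFinP.
rewrite (_ : x - - h = x + h); last by rewrite opprK.
rewrite -(EFin_window (- h) h x G'i) /avg; congr (_%:E).
have mD : measurable (`[x + - h, x + h[%classic : set (measurableTypeR R)) by exact: measurable_itv.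
rewrite /window /G'; exact (RintegralZr _ mD (integrable_subset mD Gi)).
Qed.

Lemma avg_sqr_le (h y : R) (f : R -> R) : 0 < h -> integrable f ->
  integrable (fun x => f x ^+ 2) -> avg h f y ^+ 2 <= avg h (fun x => f x ^+ 2) y.
Proof.
move=> h0 fi f2i.
have mD : measurable (`[y + - h, y + h[%classic : set (measurableTypeR R)) by exact: measurable_itv.
have ci : mu.-integrable `[y + - h, y + h[ (EFin \o cst (1 : R)).
  apply: measurable_bounded_integrable => //.
  - rewrite /= lebesgue_measure_itv/=; case: ifP => _; last exact: ltry.
    by rewrite -EFinB ltry.
  - exists 1; split; first exact: num_real.
    move=> m Mm z _; change (`|1 : R| <= m); rewrite normr1; exact: ltW.
have := @Rintegral_CS R _ f (fun x => f x ^+ 2) (cst 1) mD (integrable_subset mD fi)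
  (integrable_subset mD f2i) ci (fun x _ => sqr_ge0 _) (fun x _ => ler01).
move=> H; have {}H := H ltac:(by move=> x _; rewrite mulr1).
have E : \int[mu]_(x in `[y + - h, y + h[) cst 1 x = 2 * h.
  rewrite Rintegral_cst//= lebesgue_measure_itv/= lte_fin ltrD2l.
  have -> : - h < h by lra.
  by rewrite /= mul1r; lra.
rewrite E in H.
have h2 : 0 < 2 * h by lra.
rewrite /avg exprMn.
have -> : window (- h) h (fun x => f x ^+ 2) y / (2 * h) =
   window (- h) h (fun x => f x ^+ 2) y * (2 * h) * (2 * h)^-1 ^+ 2.
  by field; exact: lt0r_neq0.
by rewrite ler_wpM2r ?sqr_ge0.
Qed.

Lemma phi_slow (v v' : R) : `|v - v'| <= 1 -> phi v' <= 3 * phi v.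
Proof.
move=> vv'.
have d2 : (v - v') ^+ 2 <= 1.
  by rewrite -real_normK ?num_real// expr_le1.
have v1 : 0 < 1 + v ^+ 2 by rewrite ltr_pwDl// sqr_ge0.
have v'1 : 0 < 1 + v' ^+ 2 by rewrite ltr_pwDl// sqr_ge0.
have H : 1 + v ^+ 2 <= 3 * (1 + v' ^+ 2).
  have : 0 <= (v - 2 * v') ^+ 2 by rewrite sqr_ge0.
  nra.
have -> : phi v' = (3 `^ (3 / 4)) * (3 * (1 + v' ^+ 2)) `^ (- (3 / 4)).
  rewrite powRM ?(ltW v'1)// mulrA -powRD ?subrr ?powRr0 ?mul1r//.
  by apply/implyP.
apply: ler_pM; rewrite ?powR_ge0//.
  rewrite -[leRHS]powRr1//; apply: ler_powR; lra.
rewrite /phi !powRN lef_pV2 ?posrE ?powR_gt0 ?mulr_gt0//.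
by apply: ge0_ler_powR; rewrite ?nnegrE ?(ltW v1) ?mulr_ge0 ?(ltW v'1)//; lra.
Qed.

Lemma phi_scaled_slow (t x y z : R) : 0 < t -> `|y - z| <= t ->
  phi_scaled t (x - y) <= 3 * phi_scaled t (x - z).
Proof.
move=> t0 yz; rewrite /phi_scaled mulrCA ler_wpM2l ?invr_ge0 ?(ltW t0)//.
apply: phi_slow.
have -> : (x - z) / t - (x - y) / t = (y - z) / t by ring.
by rewrite normrM (@gtr0_norm _ t^-1) ?invr_gt0// ler_pdivrMr// mul1r.
Qed.

Section level.
Variables (E : set (measurableTypeR R)) (p q h : R).
Hypotheses (mE : measurable E) (Epq : E `<=` `[p, q]) (h0 : 0 < h).

Let w : R -> R := \1_E.

Lemma bounded_level_fin : (mu E < +oo)%E.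
Proof.
apply: (@le_lt_trans _ _ (mu `[p, q])).
  by apply: le_measure; rewrite ?inE//; exact: measurable_itv.
rewrite lebesgue_measure_itv/=; case: ifP => _; last exact: ltry.
by rewrite -EFinB ltry.
Qed.

Let Efin := bounded_level_fin.
Let wi : integrable w := integrable_indic_fin mE Efin.

Definition level_part (f : R -> R) (x : R) : R := f x * w x.

Definition ratio (f : R -> R) (y : R) : R := `|davg h (level_part f) y| / avg h w y.

Definition transplant (f : R -> R) (z : R) : R := w z * avg h (ratio f) z.

Section bounded.
Variables (f : R -> R) (lam : R).
Hypotheses (mf : measurable_fun [set: R] f) (lam0 : 0 <= lam)
  (fE : forall x, E x -> `|f x| <= lam).

Let f' := level_part f.

Lemma level_part_le x : `|f' x| <= lam * w x.
Proof.
rewrite /f' /level_part /w indicE; have [xE|xE] := boolP (x \in E).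
  by rewrite !mulr1; apply: fE; exact: set_mem xE.
by rewrite !mulr0 normr0.
Qed.

Lemma measurable_level_part : measurable_fun [set: R] f'.
Proof. by apply: measurable_funM => //; exact: measurable_indic. Qed.

Let f'i : integrable f' := integrable_dom mE Efin measurable_level_part level_part_le.

Lemma avg_level_ge0 k y : 0 < k -> 0 <= avg k w y.
Proof. by move=> k0; have /andP[] := avg_indic01 mE Efin y k0. Qed.

Lemma davg_level_le y : `|davg h f' y| <= lam * avg h w y.
Proof.
have h20 : 0 < h / 2 by rewrite divr_gt0.
have A1 := avg_dom mE Efin measurable_level_part level_part_le (y + h / 2) h20.
have A2 := avg_dom mE Efin measurable_level_part level_part_le (y - h / 2) h20.
rewrite (avg_half y h0 wi) /davg normrM (@ger0_norm _ 2^-1)//.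
rewrite mulrA ler_wpM2r// mulrDr.
by apply: (le_trans (ler_normB _ _)); exact: lerD.
Qed.

Lemma ratio_avg y : ratio f y * avg h w y = `|davg h f' y|.
Proof.
have [W0|W0] := eqVneq (avg h w y) 0; last by rewrite /ratio divfK.
rewrite W0 mulr0; apply/esym/eqP; rewrite eq_le normr_ge0 andbT.
by have := davg_level_le y; rewrite W0 mulr0.
Qed.

Lemma ratio_ge0 y : 0 <= ratio f y.
Proof. by rewrite divr_ge0// avg_level_ge0. Qed.

Lemma ratio_le y : ratio f y <= lam.
Proof.
have := avg_level_ge0 y h0; rewrite le_eqVlt => /predU1P[W0|W0].
  by rewrite /ratio -W0 invr0 mulr0.
by rewrite ler_pdivrMr// davg_level_le.
Qed.

Lemma measurable_ratio : measurable_fun [set: R] (ratio f).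
Proof.
apply: measurable_funM.
  by apply: measurableT_comp => //; exact: measurable_davg.
apply: measurable_funV_ge0; first exact: measurable_avg.
by move=> y; exact: avg_level_ge0.
Qed.

Lemma integrable_ratio : integrable (ratio f).
Proof.
pose S : set (measurableTypeR R) := `[p - h, q + h]%classic.
have mS : measurable S by exact: measurable_itv.
have Sfin : (mu S < +oo)%E.
  rewrite lebesgue_measure_itv/=; case: ifP => _; last exact: ltry.
  by rewrite -EFinB ltry.
apply: (@integrable_le _ _ (fun x => lam * (\1_S x : R))).
- exact (integrableZl measurableT lam (integrable_indic_fin mS Sfin)).
- exact: measurable_ratio.
move=> y; rewrite ger0_norm ?ratio_ge0// indicE.
have [yS|yS] := boolP (y \in S); first by rewrite mulr1 ratio_le.
rewrite mulr0 /ratio.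
suff -> : avg h w y = 0 by rewrite invr0 mulr0.
rewrite /avg /window (@eq_Rintegral _ _ _ _ _ (cst 0)).
  by rewrite Rintegral_cst//= !mul0r.
move=> x; rewrite inE/= in_itv/= => xy; rewrite /w indicE memNset//.
move=> /Epq/=; rewrite in_itv/= => xpq; move/negP: yS; apply.
by have h0' := h0; rewrite inE /S/= in_itv/=; lra.
Qed.

Lemma integrable_ratio_sqr : integrable (fun x => ratio f x ^+ 2).
Proof.
have H : integrable (fun x => ratio f x * ratio f x).
  apply: (integrable_mulr_bounded integrable_ratio measurable_ratio (M := lam)) => x.
  by rewrite ger0_norm ?ratio_ge0// ratio_le.
by apply: (@eq_integrable _ _ _ mu setT measurableT _ _ _ H) => x _; rewrite /comp expr2.
Qed.

Lemma transplant_ge0 z : 0 <= transplant f z.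
Proof.
rewrite mulr_ge0//.
by apply: avg_ge0 => // x; exact: ratio_ge0.
Qed.

Lemma measurable_transplant : measurable_fun [set: R] (transplant f).
Proof.
apply: measurable_funM; first exact: measurable_indic.
by apply: measurable_avg => //; exact: integrable_ratio.
Qed.

Lemma transplant_sqr_le :
  (\int[mu]_z (transplant f z ^+ 2)%R%:E <=
   \int[mu]_y (davg h f' y ^+ 2 / avg h w y)%R%:E)%E.
Proof.
have r2 := integrable_ratio_sqr; have r1 := integrable_ratio.
apply: (@le_trans _ _ (\int[mu]_z (avg h (fun x => ratio f x ^+ 2) z * w z)%R%:E)%E).
  apply: nnint_le.
  - by apply: measurable_funX; exact: measurable_transplant.
  - apply: measurable_funM; first exact: measurable_avg.
    exact: measurable_indic.
  - by move=> z; exact: sqr_ge0.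
  move=> z; rewrite /transplant /w indicE; case: (z \in E) => /=.
    by rewrite mul1r mulr1; exact: avg_sqr_le.
  by rewrite mul0r mulr0 expr0n.
rewrite avg_symm//; last by move=> x; exact: sqr_ge0.
rewrite le_eqVlt; apply/orP; left; apply/eqP; apply: eq_integral => y _; congr (_%:E).
rewrite expr2 -mulrA ratio_avg /ratio mulrAC.
by rewrite -expr2 real_normK ?num_real.
Qed.

Lemma transplant_dominates (t x : R) : 0 < t -> h <= t ->
  (\int[mu]_y (phi_scaled t (x - y) * `|davg h f' y|)%R%:E <=
   3%:E * \int[mu]_z (phi_scaled t (x - z) * transplant f z)%R%:E)%E.
Proof.
move=> t0 ht; have r1 := integrable_ratio.
have mphi := measurable_phi_scaled x t0.
have pwi : integrable (fun z => w z * phi_scaled t (x - z)).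
  apply: (integrable_mulr_bounded wi mphi (M := t^-1)) => y.
  by rewrite gtr0_norm ?phi_scaled_gt0// phi_scaled_le.
have pw0 z : 0 <= w z * phi_scaled t (x - z).
  by rewrite mulr_ge0// ?ltW ?phi_scaled_gt0.
have -> : (\int[mu]_z (phi_scaled t (x - z) * transplant f z)%R%:E =
    \int[mu]_y (ratio f y * avg h (fun z => w z * phi_scaled t (x - z)) y)%R%:E)%E.
  rewrite -avg_symm//; last exact: ratio_ge0.
  by apply: eq_integral => z _; rewrite /transplant; congr (_%:E); ring.
rewrite -nnintZ//; last 2 first.
- by apply: measurable_funM; [exact: measurable_ratio|exact: measurable_avg].
- by move=> y; rewrite mulr_ge0 ?ratio_ge0// avg_ge0.
apply: nnint_le.
- apply: measurable_funM => //; apply: measurableT_comp => //; exact: measurable_davg.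
- apply: measurable_funM => //.
  by apply: measurable_funM; [exact: measurable_ratio|exact: measurable_avg].
- by move=> y; rewrite mulr_ge0// ltW ?phi_scaled_gt0.
move=> y; rewrite -ratio_avg mulrCA -[leRHS]mulrCA ler_wpM2l ?ratio_ge0//.
rewrite -avgZ// -avgZ//.
have mD : measurable (`[y + - h, y + h[%classic : set (measurableTypeR R)) by exact: measurable_itv.
rewrite /avg ler_wpM2r ?invr_ge0 ?mulr_ge0 ?(ltW h0)//.
rewrite /window; apply: le_Rintegral => //.
- exact (integrable_subset mD (integrableZl measurableT (phi_scaled t (x - y)) wi)).
- exact (integrable_subset mD (integrableZl measurableT 3 pwi)).
move=> z; rewrite /= in_itv/= => yz.
have -> : 3 * (w z * phi_scaled t (x - z)) = w z * (3 * phi_scaled t (x - z)) by ring.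
rewrite mulrC ler_wpM2l//.
by have h0' := h0; apply: phi_scaled_slow => //; rewrite ler_norml; lra.
Qed.

Lemma integral_transplant_le :
  (\int[mu]_z (transplant f z)%:E <= \int[mu]_x `|f' x|%:E)%E.
Proof.
have r1 := integrable_ratio.
have -> : (\int[mu]_z (transplant f z)%:E = \int[mu]_y (`|davg h f' y|)%:E)%E.
  transitivity (\int[mu]_z (avg h (ratio f) z * w z)%R%:E)%E.
    by apply: eq_integral => z _; rewrite /transplant mulrC.
  rewrite avg_symm//; last exact: ratio_ge0.
  by apply: eq_integral => y _; rewrite ratio_avg.
have f'ni := integrable_norm f'i.
rewrite -(integral_avg h0 f'ni); last by move=> x; exact: normr_ge0.
apply: nnint_le.
- by apply: measurableT_comp => //; exact: measurable_davg.
- exact: measurable_avg.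
- by move=> y; exact: normr_ge0.
move=> y; have h20 : 0 < h / 2 by rewrite divr_gt0.
rewrite (avg_half y h0 f'ni) /davg normrM (@ger0_norm _ 2^-1)// ler_wpM2r//.
apply: (le_trans (ler_normB _ _)); apply: lerD; apply: avg_norm_le => // x; exact: lexx.
Qed.

End bounded.
End level.
End transplant.

(** * Orlicz functions *)

Section orlicz_function.
Context {R : realType}.
Implicit Types (s t x A : R).

Lemma ln_e_ge1 t : 0 <= t -> 1 <= ln (expR 1 + t).
Proof.
move=> t0; rewrite -[leLHS](@expRK R) ler_ln ?posrE ?expR_gt0//; first by rewrite lerDl.
by rewrite ltr_pwDl// expR_gt0.
Qed.

Lemma Phi_ge0 s t : 0 <= t -> 0 <= Phi s t.
Proof. by move=> t0; rewrite mulr_ge0// powR_ge0. Qed.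

Lemma Phi0 s : Phi s 0 = 0 :> R.
Proof. by rewrite /Phi mul0r. Qed.

Lemma Phi_factor_le s t t' : 0 <= s -> 0 <= t -> t <= t' ->
  ln (expR 1 + t) `^ s <= ln (expR 1 + t') `^ s.
Proof.
move=> s0 t0 tt'; have t'0 := le_trans t0 tt'.
have l1 := ln_e_ge1 t0; have l2 := ln_e_ge1 t'0.
apply: ge0_ler_powR => //; rewrite ?nnegrE; try lra.
rewrite ler_ln ?posrE ?lerD2l// ltr_pwDl// expR_gt0.
Qed.

Lemma Phi_le s t t' : 0 <= s -> 0 <= t -> t <= t' -> Phi s t <= Phi s t'.
Proof.
move=> s0 t0 tt'; apply: ler_pM => //; first exact: powR_ge0.
exact: Phi_factor_le.
Qed.

Lemma Phi_div s t C : 0 <= s -> 0 <= t -> 1 <= C -> Phi s (t / C) <= Phi s t / C.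
Proof.
move=> s0 t0 C1; have C0 : 0 < C by lra.
have tC : t / C <= t by rewrite ler_pdivrMr// ler_peMr.
rewrite /Phi [leLHS]mulrAC; apply: ler_wpM2r; first by rewrite invr_ge0 ltW.
apply: ler_wpM2l => //; apply: Phi_factor_le => //.
by rewrite divr_ge0// ltW.
Qed.

Lemma powR_le_expR s x (n : nat) : 1 <= x -> (0 < n)%N -> s <= n%:R ->
  x `^ s <= n%:R ^+ n * expR x.
Proof.
move=> x1 n0 sn; have nR : 0 < n%:R :> R by rewrite ltr0n.
apply: (@le_trans _ _ (x `^ n%:R)); first exact: ler_powR.
rewrite powR_mulrn; last by lra.
have : x <= n%:R * expR (x / n%:R).
  rewrite -ler_pdivrMl// mulrC; apply: le_trans (expR_ge1Dx _).
  by rewrite lerDr.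
move=> H; apply: (@le_trans _ _ ((n%:R * expR (x / n%:R)) ^+ n)).
  by apply: lerXn2r => //; rewrite nnegrE; [lra|rewrite mulr_ge0 ?expR_ge0].
rewrite exprMn -expRM_natr divfK// lt0r_neq0//.
Qed.

Lemma ln_e_add_le x A : 0 < A -> A <= x ->
  ln (expR 1 + x) <= ln (expR 1 + A) * (1 + ln (x / A)).
Proof.
move=> A0 Ax; have x0 : 0 < x by exact: lt_le_trans Ax.
have xA1 : 1 <= x / A by rewrite ler_pdivlMr// mul1r.
have lA := ln_e_ge1 (ltW A0).
have e0 := expR_gt0 (1 : R).
have l0 : 0 <= ln (x / A) by exact: ln_ge0.
have xAp : 0 < x / A by rewrite divr_gt0.
have eA : 0 < expR 1 + A by rewrite addr_gt0.
have ex : 0 < expR 1 + x by rewrite addr_gt0.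
apply: (@le_trans _ _ (ln ((expR 1 + A) * (x / A)))).
  rewrite ler_ln ?posrE ?(mulr_gt0 eA xAp)//.
  rewrite mulrDl (mulrC A) divfK ?gt_eqF// lerD2r.
  by rewrite ler_peMr// ltW.
rewrite lnM ?posrE// mulrDr mulr1 lerD2l.
by rewrite ler_peMl.
Qed.

Lemma Phi_le_quadratic s (n : nat) A t : 0 <= s -> (0 < n)%N -> s <= n%:R ->
  0 < A -> 0 <= t ->
  Phi s t <= (n%:R ^+ n * expR 1) * Phi s A * (1 + t ^+ 2 / A ^+ 2).
Proof.
move=> s0 n0 sn A0 t0.
have K1 : 1 <= n%:R ^+ n * expR 1 :> R.
  rewrite -[leLHS]mulr1; apply: ler_pM => //.
    by apply: exprn_ege1; rewrite ler1n.
  by rewrite -expR0 ler_expR.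
set K := _ * expR 1 in K1 *.
have PA := Phi_ge0 s (ltW A0).
have KPA : 0 <= K * Phi s A by rewrite mulr_ge0//; lra.
have q0 : 0 <= t ^+ 2 / A ^+ 2 by rewrite divr_ge0 ?sqr_ge0.
have [tA|At] := leP t A.
  apply: (le_trans (Phi_le s0 t0 tA)).
  rewrite mulrDr mulr1; apply: (@le_trans _ _ (K * Phi s A)); first by rewrite ler_peMl.
  by rewrite lerDl mulr_ge0.
apply: (@le_trans _ _ (K * Phi s A * (t ^+ 2 / A ^+ 2))); last first.
  by rewrite ler_wpM2l// lerDr.
have t0' : 0 < t by exact: lt_trans At.
have lA := ln_e_ge1 (ltW A0).
have l0 : 0 <= ln (t / A) by rewrite ln_ge0// ler_pdivlMr// mul1r ltW.
have lt1 := ln_e_ge1 t0.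
rewrite /Phi.
have -> : K * (A * ln (expR 1 + A) `^ s) * (t ^+ 2 / A ^+ 2) =
   t * (ln (expR 1 + A) `^ s * (K * (t / A))).
  by field; exact: lt0r_neq0.
rewrite ler_wpM2l//.
apply: (@le_trans _ _ ((ln (expR 1 + A) * (1 + ln (t / A))) `^ s)).
  apply: ge0_ler_powR => //; rewrite ?nnegrE; [lra| |].
    by rewrite mulr_ge0//; lra.
  by apply: ln_e_add_le => //; exact: ltW.
rewrite powRM; [|lra|lra].
rewrite ler_wpM2l ?powR_ge0//.
apply: (le_trans (@powR_le_expR _ _ n _ n0 sn)); first by rewrite lerDl.
by rewrite expRD lnK ?posrE ?divr_gt0// mulrA.
Qed.

Lemma expR1_le4 : expR 1 <= 4 :> R.
Proof.
have eh : expR (1 / 2) <= 2 :> R.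
  have -> : 1 / 2 = - (- (1 / 2)) :> R by rewrite opprK.
  rewrite expRN -[leRHS]invrK lef_pV2 ?posrE ?expR_gt0// ?invr_gt0//.
  by apply: le_trans (expR_ge1Dx _); lra.
have -> : expR 1 = expR (1 / 2) * expR (1 / 2) :> R by rewrite -expRD; congr expR; field.
have -> : 4 = 2 * 2 :> R by ring.
by apply: ler_pM => //; exact: expR_ge0.
Qed.

Lemma Phi_level_le s (j : nat) : 0 <= s ->
  Phi s (2 ^+ j * Num.sqrt j.+1%:R) <= 3 `^ s * (2 ^+ j * j.+1%:R `^ (s + 1 / 2)).
Proof.
move=> s0; set A := _ * Num.sqrt _.
have j1 : 1 <= j.+1%:R :> R by rewrite ler1n.
have A0 : 0 <= A by rewrite mulr_ge0 ?sqrtr_ge0// exprn_ge0.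
have A4 : A <= 4 ^+ j.
  have -> : 4 ^+ j = 2 ^+ j * 2 ^+ j :> R by rewrite -exprMn; congr (_ ^+ _); ring.
  rewrite ler_wpM2l ?exprn_ge0//.
  rewrite -(@ler_sqr _ (Num.sqrt _)) ?nnegrE ?sqrtr_ge0 ?exprn_ge0// sqr_sqrtr; last by lra.
  have -> : (2 ^+ j) ^+ 2 = (2 ^ j * 2 ^ j)%N%:R :> R by rewrite natrM natrX expr2.
  rewrite ler_nat; apply: (@leq_trans (2 ^ j)%N); first exact: ltn_expl.
  by rewrite leq_pmulr// expn_gt0.
have lnA : ln (expR 1 + A) <= 3 * j.+1%:R.
  have e4 := expR1_le4.
  apply: (@le_trans _ _ (ln (8 ^+ j.+1))).
    rewrite ler_ln ?posrE ?exprn_gt0//; last by rewrite ltr_pwDl// expR_gt0.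
    have H4 : 1 <= 4 ^+ j :> R by apply: exprn_ege1; rewrite ler1n.
    have H8 : 4 ^+ j <= 8 ^+ j :> R by apply: lerXn2r; rewrite ?nnegrE//; lra.
    by rewrite exprS; lra.
  rewrite lnXn// mulr_natr ler_wMn2r//.
  have -> : 8 = 2 ^+ 3 :> R by ring.
  rewrite lnXn//.
  have H := @le_ln1Dx R 1 ltac:(lra).
  have -> : 3 = 1 *+ 3 :> R by [].
  by rewrite ler_wMn2r.
have l1 := ln_e_ge1 A0.
rewrite /Phi {1}/A.
have -> : 3 `^ s * (2 ^+ j * j.+1%:R `^ (s + 1 / 2)) =
   2 ^+ j * Num.sqrt j.+1%:R * (3 * j.+1%:R) `^ s :> R.
  rewrite powRM//.
  rewrite powRD; last by apply/implyP => _; rewrite pnatr_eq0.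
  rewrite -powR12_sqrt//.
  by rewrite mul1r; ring.
by rewrite ler_wpM2l// ge0_ler_powR ?nnegrE; lra.
Qed.

Lemma Phi_level_ge s (j : nat) t : 0 <= s -> 2 ^+ j < t ->
  2 ^+ j.+1 * j.+2%:R `^ s <= 2 * 6 `^ s * Phi s t.
Proof.
move=> s0 jt; have t0 : 0 < t by apply: lt_trans jt; exact: exprn_gt0.
have l1 := ln_e_ge1 (ltW t0).
have j0 : 0 <= j.+2%:R :> R by rewrite ler0n.
have H : j.+2%:R <= 6 * ln (expR 1 + t).
  have : ln 2 * j%:R <= ln (expR 1 + t).
    rewrite mulr_natr -lnXn// ler_ln ?posrE ?exprn_gt0//; last by rewrite ltr_pwDl ?expR_gt0// ltW.
    by apply: (le_trans (ltW jt)); rewrite lerDr expR_ge0.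
  have ln2 : 1 / 2 <= ln 2 :> R.
    have := @le_ln1Dx R (- (1 / 2)) ltac:(lra).
    have -> : 1 + - (1 / 2) = 2^-1 :> R by field.
    by rewrite lnV ?posrE//; lra.
  have -> : j.+2%:R = j%:R + 2 :> R by rewrite -addn2 natrD.
  have jj : 0 <= j%:R :> R by rewrite ler0n.
  have : 1 / 2 * j%:R <= ln 2 * j%:R :> R by rewrite ler_wpM2r.
  lra.
rewrite exprS /Phi.
have -> : 2 * 6 `^ s * (t * ln (expR 1 + t) `^ s) = 2 * t * (6 * ln (expR 1 + t)) `^ s.
  rewrite powRM//; last by lra.
  by ring.
apply: ler_pM; rewrite ?powR_ge0 ?mulr_ge0 ?exprn_ge0//.
  by rewrite ler_wpM2l// ltW.
by apply: ge0_ler_powR => //; rewrite nnegrE; lra.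
Qed.

End orlicz_function.

Section level_family.
Context {R : realType}.
Notation mu := (@lebesgue_measure R).
Notation integrable f := (mu.-integrable [set: R] (EFin \o f)).

Lemma nneseries_single (T : nat -> \bar R) (i : nat) :
  (forall j, j != i -> T j = 0%E) -> (\sum_(0 <= j <oo) T j = T i)%E.
Proof.
move=> T0; apply: lim_near_cst => //; near=> n.
have ni : (i < n)%N by near: n; exact: nbhs_infty_gt.
rewrite big_mkord (bigD1 (Ordinal ni))//= big1 ?adde0// => j ji.
by apply: T0; apply: contra ji => /eqP ji; apply/eqP/val_inj.
Unshelve. all: by end_near. Qed.

Lemma measurable_nneseries_EFin (u : nat -> R -> R) :
  (forall j, measurable_fun [set: R] (u j)) -> (forall j x, 0 <= u j x) ->
  measurable_fun [set: R] (fun x => (\sum_(0 <= j <oo) (u j x)%:E)%E).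
Proof.
move=> mu_ u0.
apply: (@ge0_emeasurable_sum _ _ _ _ (fun j x => (u j x)%:E) xpredT).
  by move=> j x _ _; rewrite lee_fin.
by move=> j _; apply/measurable_EFinP.
Qed.

Variables (E : nat -> set (measurableTypeR R)) (p q h : R).
Hypotheses (mE : forall j, measurable (E j)) (tE : trivIset setT E)
  (Epq : forall j, E j `<=` `[p, q]) (h0 : 0 < h).

Lemma level_unique i j z : E i z -> E j z -> i = j.
Proof. by move=> iz jz; apply: tE => //; exists z. Qed.

Lemma transplant_out j f z : ~ E j z -> transplant (E j) h f z = 0.
Proof. by move=> jz; rewrite /transplant indicE memNset// mul0r. Qed.

Definition family_transplant (f : R -> R) (z : R) : R :=
  fine (\sum_(0 <= j <oo) (transplant (E j) h f z)%:E)%E.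

Lemma family_transplant_series f i z : E i z ->
  (\sum_(0 <= j <oo) (transplant (E j) h f z)%:E = (transplant (E i) h f z)%:E)%E.
Proof.
move=> iz; apply: nneseries_single => j ji; rewrite transplant_out// => jz.
by move/eqP: ji; apply; exact: level_unique jz iz.
Qed.

Lemma family_transplant_level f i z : E i z ->
  family_transplant f z = transplant (E i) h f z.
Proof. by move=> iz; rewrite /family_transplant (family_transplant_series f iz). Qed.

Lemma family_transplant_series_out f z : (forall j, ~ E j z) ->
  (\sum_(0 <= j <oo) (transplant (E j) h f z)%:E = 0)%E.
Proof. by move=> nz; apply: eseries0 => j _ _; rewrite transplant_out. Qed.

Lemma family_transplant_out f z : (forall j, ~ E j z) -> family_transplant f z = 0.
Proof. by move=> nz; rewrite /family_transplant family_transplant_series_out. Qed.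

Lemma EFin_family_transplant f z : (family_transplant f z)%:E =
  (\sum_(0 <= j <oo) (transplant (E j) h f z)%:E)%E.
Proof.
have [[i iz]|nz] := pselect (exists i, E i z).
  by rewrite (family_transplant_series f iz) (family_transplant_level f iz).
have nz' j : ~ E j z by move=> jz; apply: nz; exists j.
by rewrite (family_transplant_series_out f nz') (family_transplant_out f nz').
Qed.

Section function.
Variables (f : R -> R) (lam : nat -> R).
Hypotheses (fi : integrable f) (lam0 : forall j, 0 <= lam j)
  (fE : forall j x, E j x -> `|f x| <= lam j)
  (f0 : {ae mu, forall x, f x != 0 -> exists j, E j x}).

Let mf : measurable_fun [set: R] f := measurable_integrable fi.

Lemma family_transplant_ge0 z : 0 <= family_transplant f z.
Proof.
rewrite -lee_fin EFin_family_transplant; apply: nneseries_ge0 => j _ _.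
by rewrite lee_fin; exact: (transplant_ge0 (mE j) (@Epq j) h0).
Qed.

Let mT j : measurable_fun [set: R] (transplant (E j) h f).
Proof. exact: (measurable_transplant (mE j) (@Epq j) h0 mf (lam0 j) (@fE j)). Qed.

Let T0 j z : 0 <= transplant (E j) h f z.
Proof. exact: (transplant_ge0 (mE j) (@Epq j) h0). Qed.

Lemma measurable_family_transplant : measurable_fun [set: R] (family_transplant f).
Proof.
apply/measurable_EFinP.
apply: (eq_measurable_fun _ _ (measurable_nneseries_EFin mT T0)) => z _.
by rewrite /comp EFin_family_transplant.
Qed.

Lemma integral_nneseries_EFin (u : nat -> R -> R) :
  (forall j, measurable_fun [set: R] (u j)) -> (forall j x, 0 <= u j x) ->
  (\int[mu]_x (\sum_(0 <= j <oo) (u j x)%:E) =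
   \sum_(0 <= j <oo) \int[mu]_x (u j x)%:E)%E.
Proof.
move=> mu_ u0.
have m' j : measurable_fun [set: R] (fun x => (u j x)%:E) by exact/measurable_EFinP.
have u0' j (x : measurableTypeR R) : [set: measurableTypeR R] x -> (0 <= (u j x)%:E)%E.
  by move=> _; rewrite lee_fin.
exact (@integral_nneseries _ _ _ mu setT measurableT _ m' u0').
Qed.

Let mlev j : measurable_fun [set: R] (level_part (E j) f).
Proof. exact: measurable_level_part. Qed.

Lemma integrable_family_transplant : integrable (family_transplant f).
Proof.
apply/integrableP; split; first by apply/measurable_EFinP; exact: measurable_family_transplant.
apply: (@le_lt_trans _ _ (\int[mu]_x `|f x|%:E)%E); last by case/integrableP: fi.
have -> : (\int[mu]_x `|(EFin \o family_transplant f) x| =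
    \int[mu]_x (\sum_(0 <= j <oo) (transplant (E j) h f x)%:E))%E.
  apply: eq_integral => x _; rewrite -EFin_family_transplant /comp gee0_abs//.
  by rewrite lee_fin family_transplant_ge0.
rewrite integral_nneseries_EFin//.
apply: (@le_trans _ _ (\sum_(0 <= j <oo) \int[mu]_x (`|level_part (E j) f x|)%:E)%E).
  apply: lee_nneseries => j *; first by apply: integral_ge0 => x _; rewrite lee_fin.
  exact: (integral_transplant_le (mE j) (@Epq j) h0 mf (lam0 j) (@fE j)).
have mnl j : measurable_fun [set: R] (fun x => `|level_part (E j) f x|).
  by apply: measurableT_comp => //; exact: mlev.
rewrite -(integral_nneseries_EFin mnl (fun j x => normr_ge0 _)).
have L x i : E i x -> (\sum_(0 <= j <oo) `|level_part (E j) f x|%:E = `|f x|%:E)%E.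
  move=> ix; rewrite (@nneseries_single _ i).
    by rewrite /level_part indicE mem_set// mulr1.
  move=> j ji; rewrite /level_part indicE memNset ?mulr0 ?normr0// => jx.
  by move/eqP: ji; apply; exact: level_unique jx ix.
apply: ge0_le_integral => //.
- by move=> x _; apply: nneseries_ge0 => j _ _; rewrite lee_fin.
- exact (measurable_nneseries_EFin mnl (fun j x => normr_ge0 _)).
- by apply/measurable_EFinP; exact: measurableT_comp.
move=> x _; have [[i ix]|nx] := pselect (exists i, E i x); first by rewrite (L _ i).
rewrite eseries0 ?lee_fin// => j _ _.
by rewrite /level_part indicE memNset ?mulr0 ?normr0// => jx; apply: nx; exists j.
Qed.

Lemma window_levels_cvg (a b y : R) :
  (\sum_(j < n) window a b (level_part (E j) f) y) @[n --> \oo] --> window a b f y.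
Proof.
have mD : measurable (`[y + a, y + b[%classic : set (measurableTypeR R)) by exact: measurable_itv.
have lei j : integrable (level_part (E j) f).
  apply: (@integrable_le _ _ (fun x => `|f x|)) => //; first exact: integrable_norm.
  move=> x; rewrite /level_part normrM ler_piMr// indicE.
  by case: (_ \in _); rewrite ?normr1 ?normr0.
pose S n x := \sum_(j < n) level_part (E j) f x.
have Si n : integrable (S n).
  rewrite /S; elim: n => [|n IH].
    by under eq_fun do rewrite big_ord0; exact: integrable0.
  under eq_fun do rewrite big_ord_recr/=.
  exact (integrableD measurableT IH (lei n)).
have wS n : \sum_(j < n) window a b (level_part (E j) f) y = window a b (S n) y.
  elim: n => [|n IH].
    rewrite big_ord0 /window /S; under eq_Rintegral do rewrite big_ord0.
    by rewrite Rintegral_cst// mul0r.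
  rewrite big_ord_recr/= IH /window -RintegralD//; [|exact: integrable_subset..].
  by apply: eq_Rintegral => x _; rewrite /S big_ord_recr.
under eq_fun do rewrite wS.
have SE n i x : E i x -> S n x = if (i < n)%N then f x else 0.
  move=> ix; rewrite /S; case: ifPn => [lin|nin].
    rewrite (bigD1 (Ordinal lin))//= big1 ?addr0.
      by rewrite /level_part indicE mem_set// mulr1.
    move=> j ji; rewrite /level_part indicE memNset ?mulr0// => jx.
    by move/eqP: ji; apply; apply/val_inj; exact: level_unique jx ix.
  rewrite big1// => j _; rewrite /level_part indicE memNset ?mulr0// => jx.
  by move: nin; rewrite (level_unique ix jx) ltn_ord.
have S0 n x : (forall i, ~ E i x) -> S n x = 0.
  by move=> nx; rewrite /S big1// => j _; rewrite /level_part indicE memNset ?mulr0.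
have [] := @dominated_convergence _ _ _ mu _ mD (fun n => EFin \o S n) (EFin \o f) (fun x => `|f x|%:E).
- by move=> n; apply: measurable_funTS; exact: (measurable_int mu).
- by apply: measurable_funTS; apply/measurable_EFinP.
- apply: (@filterS _ _ (ae_filter_ringOfSetsType mu) _ _ _ f0) => x f0x _ /=.
  have [[i ix]|nx] := pselect (exists i, E i x).
    apply: cvg_near_cst; near=> n; rewrite (SE _ _ _ ix) ifT//.
    by near: n; exact: nbhs_infty_gt.
  have -> : f x = 0 by apply/eqP/negPn/negP => /f0x.
  apply: cvg_near_cst; near=> n; rewrite S0// => i ix; apply: nx; by exists i.
- exact (integrable_subset mD (integrable_norm fi)).
- apply: aeW => x n _ /=; rewrite lee_fin.
  have [[i ix]|nx] := pselect (exists i, E i x).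
    by rewrite (SE _ _ _ ix); case: ifP; rewrite ?normr0.
  by rewrite S0 ?normr0// => i ix; apply: nx; exists i.
move=> _ _ H; rewrite /window /Rintegral; apply: fine_cvg.
rewrite fineK; last by apply: integrable_fin_num => //; exact: integrable_subset.
exact: H.
Unshelve. all: by end_near. Qed.

Lemma davg_levels_cvg (y : R) :
  (\sum_(j < n) davg h (level_part (E j) f) y) @[n --> \oo] --> davg h f y.
Proof.
rewrite davgE//.
under eq_fun => n do under eq_bigr => j _ do rewrite davgE//.
under eq_fun => n do rewrite -mulr_suml sumrB.
apply: cvgMl; apply: cvgB; exact: window_levels_cvg.
Qed.

Lemma davg_le_levels (y : R) :
  (`|davg h f y|%:E <= \sum_(0 <= j <oo) `|davg h (level_part (E j) f) y|%:E)%E.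
Proof.
set S := (X in (_ <= X)%E).
have S0 : (0 <= S)%E by apply: nneseries_ge0 => j _ _; rewrite lee_fin.
have Sn n : ((\sum_(j < n) `|davg h (level_part (E j) f) y|)%R%:E <= S)%E.
  rewrite -sumEFin -(big_mkord xpredT (fun j => (`|davg h (level_part (E j) f) y|)%:E)).
  exact: nneseries_lim_ge.
have [->|Sfin] := eqVneq S +oo%E; first by rewrite leey.
have SE : S = (fine S)%:E by rewrite fineK// ge0_fin_numE// ltey.
rewrite SE lee_fin.
have H : `|\sum_(j < n) davg h (level_part (E j) f) y| @[n --> \oo] --> `|davg h f y|.
  by apply: cvg_norm; exact: davg_levels_cvg.
rewrite -(cvg_lim _ H)//; apply: limr_le; first by apply/cvg_ex; exists `|davg h f y|.
near=> n; apply: (le_trans (ler_norm_sum _ _ _)).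
by rewrite -lee_fin -SE.
Unshelve. all: by end_near. Qed.

Lemma family_transplant_dominates (t x : R) : 0 < t -> h <= t ->
  (\int[mu]_y (phi_scaled t (x - y) * `|davg h f y|)%R%:E <=
   3%:E * \int[mu]_z (phi_scaled t (x - z) * family_transplant f z)%R%:E)%E.
Proof.
move=> t0 ht; have mphi := measurable_phi_scaled x t0.
have ph0 y : 0 <= phi_scaled t (x - y) by rewrite ltW ?phi_scaled_gt0.
have lei j : integrable (level_part (E j) f).
  apply: (@integrable_le _ _ (fun x => `|f x|)) => //; first exact: integrable_norm.
  move=> z; rewrite /level_part normrM ler_piMr// indicE.
  by case: (_ \in _); rewrite ?normr1 ?normr0.
have mlp j : measurable_fun [set: R] (fun y => phi_scaled t (x - y) * `|davg h (level_part (E j) f) y|).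
  by apply: measurable_funM => //; apply: measurableT_comp => //; exact: measurable_davg.
have lp0 j y : 0 <= phi_scaled t (x - y) * `|davg h (level_part (E j) f) y| by rewrite mulr_ge0.
have mtp j : measurable_fun [set: R] (fun y => phi_scaled t (x - y) * transplant (E j) h f y).
  exact: measurable_funM.
have tp0 j y : 0 <= phi_scaled t (x - y) * transplant (E j) h f y by rewrite mulr_ge0.
apply: (@le_trans _ _ (\int[mu]_y (\sum_(0 <= j <oo)
    (phi_scaled t (x - y) * `|davg h (level_part (E j) f) y|)%R%:E))%E).
  apply: ge0_le_integral => //.
  - by move=> y _; rewrite lee_fin mulr_ge0.
  - apply/measurable_EFinP; apply: measurable_funM => //.
    by apply: measurableT_comp => //; exact: measurable_davg.
  - exact (measurable_nneseries_EFin mlp lp0).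
  move=> y _; under eq_eseriesr do rewrite EFinM.
  rewrite EFinM nneseriesZl//.
  by apply: lee_wpmul2l; [rewrite lee_fin|exact: davg_le_levels].
rewrite integral_nneseries_EFin//.
have -> : (\int[mu]_z (phi_scaled t (x - z) * family_transplant f z)%R%:E =
   \sum_(0 <= j <oo) \int[mu]_z (phi_scaled t (x - z) * transplant (E j) h f z)%R%:E)%E.
  rewrite -(integral_nneseries_EFin mtp tp0); apply: eq_integral => z _.
  rewrite EFinM EFin_family_transplant -nneseriesZl//.
  by move=> j _; rewrite lee_fin.
rewrite -nneseriesZl//; last by move=> j _; apply: integral_ge0 => y _; rewrite lee_fin.
apply: lee_nneseries => j _ *; first by apply: integral_ge0 => y _; rewrite lee_fin.
exact: (transplant_dominates (mE j) (@Epq j) h0 mf (lam0 j) (@fE j)).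
Qed.

End function.
End level_family.

(** * The square function on the levels *)

Section double_series.
Context {R : realType}.
Local Open Scope ereal_scope.

Lemma dyadic_threshold (x : R) : (0 < x)%R ->
  exists k0 : int, forall k : int, (x <= (2 : R) ^ k)%R = (k0 <= k)%R.
Proof.
move=> x0; exists (Num.ceil (ln x / ln 2)) => k.
have ln20 : (0 < ln 2 :> R)%R by rewrite ln_gt0// ltr1n.
have lnk : ln ((2 : R) ^ k) = (k%:~R * ln 2)%R.
  case: k => n.
    by rewrite -exprnP lnXn// mulr_natl.
  by rewrite NegzE -exprnN lnV ?posrE ?exprn_gt0// lnXn// mulrNz mulNr mulr_natl.
rewrite ceil_le_int ler_pdivrMr// -lnk ler_ln// posrE exprz_gt0//.
Qed.

Lemma int_ge_bij (k0 : int) :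
  set_bij setT [set k : int | (k0 <= k)%R] (fun i : nat => k0 + i%:Z)%R.
Proof.
split.
- by move=> i _ /=; rewrite lerDl.
- by move=> i j _ _ /addrI [->].
- by move=> k /= k0k; exists `|k - k0|%N => //; rewrite gez0_abs ?subr_ge0// subrKC.
Qed.

Lemma int_lt_bij (k0 : int) :
  set_bij setT [set k : int | (k < k0)%R] (fun i : nat => k0 - i.+1%:Z)%R.
Proof.
split.
- by move=> i _ /=; rewrite gtrDl oppr_lt0.
- by move=> i j _ _ /addrI /oppr_inj [->].
- move=> k /= kk0; exists (`|k0 - k|.-1)%N => //.
  rewrite prednK ?absz_gt0 ?subr_eq0 ?gt_eqF// gez0_abs ?subr_ge0 ?ltW//.
  by rewrite opprB subrKC.
Qed.

Lemma esum_pairs (D : set int) (e : nat -> int) (a : nat -> int -> \bar R) :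
  set_bij setT D e -> (forall t k, 0 <= a t k) ->
  \esum_(p in [set p : nat * int | D p.2]) a p.1 p.2 =
  \sum_(0 <= t <oo) \sum_(0 <= i <oo) a t (e i).
Proof.
move=> [eD ei es] a0.
rewrite (reindex_esum setT _ (fun p : nat * nat => (p.1, e p.2))); last first.
  split.
  - by move=> [t i] _ /=; exact: eD.
  - by move=> [t i] [t' i'] _ _ /= [-> /ei ->]; rewrite ?inE.
  - by move=> [t k] /= /es[i _ <-]; exists (t, i).
transitivity (\esum_(t in [set: nat]) \esum_(i in [set: nat]) a t (e i)).
  rewrite esum_esum//; congr esum.
  by apply/seteqP; split => // -[t i].
rewrite -nneseries_esumT; last by move=> t; exact: esum_ge0.
by apply: eq_eseriesr => t _; rewrite -nneseries_esumT.
Qed.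

Lemma nneseries2_le (c : nat -> nat -> \bar R) (B : \bar R) :
  (forall t i, 0 <= c t i) ->
  (forall n m, \sum_(i < m) \sum_(t < n) c t i <= B) ->
  \sum_(0 <= t <oo) \sum_(0 <= i <oo) c t i <= B.
Proof.
move=> c0 cB; apply: lime_le.
  by apply: is_cvg_nneseries => t _ _; apply: nneseries_ge0.
near=> n; rewrite -nneseries_sum//.
apply: lime_le; first by apply: is_cvg_nneseries => i _ _; apply: sume_ge0.
near=> m; rewrite big_mkord; under eq_bigr do rewrite big_mkord.
exact: cB.
Unshelve. all: by end_near. Qed.

Lemma double_sum_lin2 n m (a b : nat -> nat -> \bar R) :
  (forall t i, 0 <= a t i) -> (forall t i, 0 <= b t i) ->
  \sum_(i < m) \sum_(t < n) (2%:E * a t i + 2%:E * b t i) =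
  2%:E * (\sum_(i < m) \sum_(t < n) a t i) + 2%:E * (\sum_(i < m) \sum_(t < n) b t i).
Proof.
move=> a0 b0.
have Z (d : nat -> nat -> \bar R) : (forall t i, 0 <= d t i) ->
    2%:E * (\sum_(i < m) \sum_(t < n) d t i) = \sum_(i < m) \sum_(t < n) (2%:E * d t i).
  move=> d0; rewrite ge0_sume_distrr; last by move=> i _; exact: sume_ge0.
  by apply: eq_bigr => i _; rewrite ge0_sume_distrr.
rewrite (Z a a0) (Z b b0) -big_split; apply: eq_bigr => i _.
by rewrite -big_split.
Qed.

End double_series.

Section level_square.
Context {R : realType}.
Notation mu := (@lebesgue_measure R).

Variables (E : nat -> set (measurableTypeR R)) (p q : R).
Hypotheses (mE : forall j, measurable (E j)) (tE : trivIset setT E)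
  (pq : p <= q) (Epq : forall j, E j `<=` `[p, q]).
Variables (lam : nat -> R) (f1 f2 : nat -> R -> R).
Hypotheses (lam0 : forall j, 0 <= lam j)
  (mf1 : forall t, measurable_fun [set: R] (f1 t))
  (mf2 : forall t, measurable_fun [set: R] (f2 t))
  (f12 : forall j n x, E j x ->
     \sum_(t < n) (f1 t x ^+ 2 + f2 t x ^+ 2) <= lam j ^+ 2).

Let f1sq j n x : E j x -> \sum_(t < n) f1 t x ^+ 2 <= lam j ^+ 2.
Proof.
move=> jx; apply: le_trans (f12 n jx); apply: ler_sum => t _.
by rewrite lerDl sqr_ge0.
Qed.

Let f2sq j n x : E j x -> \sum_(t < n) f2 t x ^+ 2 <= lam j ^+ 2.
Proof.
move=> jx; apply: le_trans (f12 n jx); apply: ler_sum => t _.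
by rewrite lerDr sqr_ge0.
Qed.

Lemma level_component_le (f : nat -> R -> R) j t x :
  (forall n, \sum_(t < n) f t x ^+ 2 <= lam j ^+ 2) -> `|f t x| <= lam j.
Proof.
move=> /(_ t.+1) H; rewrite -(@ler_sqr _ `|f t x|) ?nnegrE// real_normK ?num_real//.
apply: le_trans H; rewrite big_ord_recr/= lerDr sumr_ge0// => i _; exact: sqr_ge0.
Qed.

Variables (h : R).
Hypotheses (h0 : 0 < h) (hpq : 2 * h <= q - p).

Let hi i : 0 < h / 2 ^+ i. Proof. by rewrite divr_gt0 ?exprn_gt0. Qed.

(* [integral_entropy_le] is used with [c = 16^-j]: the second term then remains
   summable after multiplication by [lam j ^ 2 ~ 4^j]. *)
Lemma level_family_le (f : nat -> R -> R) j n m :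
  (forall t, measurable_fun [set: R] (f t)) ->
  (forall n x, E j x -> \sum_(t < n) f t x ^+ 2 <= lam j ^+ 2) ->
  (\sum_(i < m) \sum_(t < n)
     \int[mu]_z (transplant (E j) (h / 2 ^+ i) (f t) z ^+ 2)%R%:E <=
   (180 * lam j ^+ 2)%:E * ((j.+1%:R * fine (mu (E j)) + (16 ^+ j)^-1 * (q - p))%R%:E))%E.
Proof.
move=> mf fsq.
have Efin := bounded_level_fin (mE j) (@Epq j).
have fl t x : E j x -> `|f t x| <= lam j.
  by move=> jx; apply: level_component_le => k; exact: fsq.
apply: (@le_trans _ _ (\sum_(i < m) \sum_(t < n)
    \int[mu]_y (davg (h / 2 ^+ i) (level_part (E j) (f t)) y ^+ 2 /
                avg (h / 2 ^+ i) \1_(E j) y)%R%:E)%E).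
  apply: lee_sum => i _; apply: lee_sum => t _.
  exact: (transplant_sqr_le (mE j) (@Epq j) (hi i) (mf t) (lam0 j) (fl t)).
have fw x : \sum_(t < n) level_part (E j) (f t) x ^+ 2 <= lam j ^+ 2 * \1_(E j) x.
  rewrite /level_part indicE; have [jx|jx] := boolP (x \in E j).
    rewrite mulr1; under eq_bigr do rewrite mulr1.
    by apply: fsq; exact: set_mem.
  by rewrite mulr0 big1// => t _; rewrite mulr0 expr0n.
have mlp t : measurable_fun [set: R] (level_part (E j) (f t)).
  exact: (measurable_level_part (mE j) (mf t)).
apply: (le_trans (square_function_level (mE j) Efin (lam0 j) mlp fw m h0)).
set M := fine (mu (E j)).
have ME : mu (E j) = M%:E by rewrite fineK// ge0_fin_numE.
have M0 : 0 <= M by rewrite fine_ge0.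
have mEj : measurable (E j) by exact: mE.
have mI : measurable_fun [set: R] (\1_(E j) : R -> R) by apply: measurable_indic; exact: mE.
have sum_le : (\sum_(t < n) \int[mu]_x (level_part (E j) (f t) x ^+ 2)%R%:E <=
    (lam j ^+ 2 * M)%:E)%E.
  rewrite -nnint_sum; [|by move=> t; exact: measurable_funX|by move=> t x; exact: sqr_ge0].
  apply: (@le_trans _ _ (\int[mu]_x (lam j ^+ 2 * (\1_(E j) x))%R%:E)%E).
    apply: nnint_le => //.
    - by apply: measurable_sum => t; exact: measurable_funX.
    - exact (measurable_funM (measurable_cst _) mI).
    - by move=> x; apply: sumr_ge0 => t _; exact: sqr_ge0.
  rewrite nnintZ ?sqr_ge0//.
  have -> : (\int[mu]_x (\1_(E j) x)%:E = M%:E)%E.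
    by rewrite integral_indic// setIT; exact: ME.
  by rewrite EFinM.
set c := (16 ^+ j)^-1 : R.
have c0 : 0 < c by rewrite invr_gt0 exprn_gt0.
have c1 : c <= 1 by rewrite invf_le1 ?exprn_gt0// exprn_ege1// ler1n.
have ent : (\int[mu]_y (entropy (avg h \1_(E j) y))%:E <=
    (15 * j%:R * M + c * (2 * (q - p)))%:E)%E.
  have c01 : 0 < c <= 1 by rewrite c0.
  apply: (le_trans (integral_entropy_le (mE j) Efin h0 c01 pq (@Epq j))).
  rewrite ME -EFinM -EFinD lee_fin; apply: lerD.
    rewrite ler_wpM2r// invrK lnXn// -[leLHS]mulr_natr ler_wpM2r//.
    have := @le_ln1Dx R 15 ltac:(lra).
    by rewrite (_ : 1 + 15 = 16 :> R)//; ring.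
  by rewrite ler_wpM2l ?(ltW c0)//; move: hpq; lra.
apply: (@le_trans _ _ (2%:E * (lam j ^+ 2 * M)%:E +
    (12 * lam j ^+ 2)%:E * (15 * j%:R * M + c * (2 * (q - p)))%:E)%E).
  have c12 : (0 <= (12 * lam j ^+ 2)%:E)%E by rewrite lee_fin mulr_ge0// sqr_ge0.
  by apply: leeD; apply: lee_wpmul2l.
rewrite -!EFinM -EFinD lee_fin -[j.+1%:R]natr1.
have l2 : 0 <= lam j ^+ 2 by rewrite sqr_ge0.
have H1 : 0 <= lam j ^+ 2 * M by rewrite mulr_ge0.
have H2 : 0 <= lam j ^+ 2 * (c * (q - p)) by rewrite !mulr_ge0 ?(ltW c0) ?subr_ge0.
have -> : 180 * lam j ^+ 2 * ((j%:R + 1) * M + c * (q - p)) =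
  2 * (lam j ^+ 2 * M) + 12 * lam j ^+ 2 * (15 * j%:R * M + c * (2 * (q - p))) +
  (178 * (lam j ^+ 2 * M) + 156 * (lam j ^+ 2 * (c * (q - p)))) by ring.
by rewrite lerDl; lra.
Qed.

Definition layer (k : R) (t : nat) (z : R) : R :=
  family_transplant E k (f1 t) z + family_transplant E k (f2 t) z.

Lemma level_square_le j :
  (\int[mu]_(x in E j) (\sum_(0 <= t <oo) \sum_(0 <= i <oo)
     (layer (h / 2 ^+ i) t x ^+ 2)%R%:E) <=
   (720 * lam j ^+ 2 * (j.+1%:R * fine (mu (E j)) + (16 ^+ j)^-1 * (q - p)))%:E)%E.
Proof.
pose T1 t i z := transplant (E j) (h / 2 ^+ i) (f1 t) z.
pose T2 t i z := transplant (E j) (h / 2 ^+ i) (f2 t) z.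
pose u t i z := 2 * T1 t i z ^+ 2 + 2 * T2 t i z ^+ 2.
have fl1 t x : E j x -> `|f1 t x| <= lam j.
  by move=> jx; apply: level_component_le => k; exact: f1sq.
have fl2 t x : E j x -> `|f2 t x| <= lam j.
  by move=> jx; apply: level_component_le => k; exact: f2sq.
have mT1 t i : measurable_fun [set: R] (T1 t i).
  exact: (measurable_transplant (mE j) (@Epq j) (hi i) (mf1 t) (lam0 j) (fl1 t)).
have mT2 t i : measurable_fun [set: R] (T2 t i).
  exact: (measurable_transplant (mE j) (@Epq j) (hi i) (mf2 t) (lam0 j) (fl2 t)).
have mT1' t i : measurable_fun [set: R] (fun z => 2 * T1 t i z ^+ 2).
  exact (measurable_funM (measurable_cst _) (measurable_funX _ (mT1 t i))).
have mT2' t i : measurable_fun [set: R] (fun z => 2 * T2 t i z ^+ 2).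
  exact (measurable_funM (measurable_cst _) (measurable_funX _ (mT2 t i))).
have mu_ t i : measurable_fun [set: R] (u t i).
  exact (measurable_funD (mT1' t i) (mT2' t i)).
have u0 t i z : 0 <= u t i z by rewrite addr_ge0// mulr_ge0// sqr_ge0.
have msum (v : nat -> nat -> R -> R) (D : set (measurableTypeR R)) : measurable D ->
    (forall t i, measurable_fun [set: R] (v t i)) -> (forall t i z, 0 <= v t i z) ->
    measurable_fun D (fun z => (\sum_(0 <= t <oo) \sum_(0 <= i <oo) (v t i z)%:E)%E).
  move=> mD mv v0; apply: measurable_funTS.
  apply: (@ge0_emeasurable_sum _ _ _ _ (fun t z => (\sum_(0 <= i <oo) (v t i z)%:E)%E) xpredT).
    by move=> t z _ _; apply: nneseries_ge0 => i _ _; rewrite lee_fin.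
  by move=> t _; exact (measurable_nneseries_EFin (mv t) (v0 t)).
have sum0 (v : nat -> nat -> R -> R) z : (forall t i z, 0 <= v t i z) ->
    (0 <= \sum_(0 <= t <oo) \sum_(0 <= i <oo) (v t i z)%:E)%E.
  by move=> v0; apply: nneseries_ge0 => t _ _; apply: nneseries_ge0 => i _ _; rewrite lee_fin.
pose w t i z := (T1 t i z + T2 t i z) ^+ 2.
have w0 t i z : 0 <= w t i z by exact: sqr_ge0.
have mw t i : measurable_fun [set: R] (w t i).
  exact (measurable_funX _ (measurable_funD (mT1 t i) (mT2 t i))).
apply: (@le_trans _ _ (\int[mu]_z (\sum_(0 <= t <oo) \sum_(0 <= i <oo) (u t i z)%:E))%E).
  apply: (@le_trans _ _ (\int[mu]_(z in E j) (\sum_(0 <= t <oo) \sum_(0 <= i <oo) (u t i z)%:E))%E); last first.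
    apply: ge0_subset_integral => //.
    - exact (msum u setT measurableT mu_ u0).
    - by move=> z _; exact: sum0.
  rewrite (_ : (\int[mu]_(x in E j) _ = \int[mu]_(z in E j)
      (\sum_(0 <= t <oo) \sum_(0 <= i <oo) (w t i z)%:E))%E); last first.
    apply: eq_integral => z /set_mem jz.
    apply: eq_eseriesr => t _; apply: eq_eseriesr => i _.
    by rewrite /layer !(family_transplant_level _ tE _ jz).
  apply: ge0_le_integral => //.
  - by move=> z _; exact: sum0.
  - exact (msum w _ (mE j) mw w0).
  - exact (msum u _ (mE j) mu_ u0).
  move=> z _; apply: lee_nneseries => t *; first by apply: nneseries_ge0 => i _ _; rewrite lee_fin.
  apply: lee_nneseries => i *; first by rewrite lee_fin.
  rewrite lee_fin /w /u -subr_ge0.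
  have -> : 2 * T1 t i z ^+ 2 + 2 * T2 t i z ^+ 2 - (T1 t i z + T2 t i z) ^+ 2 =
    (T1 t i z - T2 t i z) ^+ 2 by ring.
  exact: sqr_ge0.
have mS t : measurable_fun [set: measurableTypeR R] (fun z => (\sum_(0 <= i <oo) (u t i z)%:E)%E).
  exact (measurable_nneseries_EFin (mu_ t) (u0 t)).
have S0 t (z : measurableTypeR R) : [set: measurableTypeR R] z -> (0 <= \sum_(0 <= i <oo) (u t i z)%:E)%E.
  by move=> _; apply: nneseries_ge0 => i _ _; rewrite lee_fin.
rewrite (@integral_nneseries _ _ _ mu setT measurableT _ mS S0).
under eq_eseriesr => t _ do rewrite (integral_nneseries_EFin (mu_ t) (u0 t)).
apply: nneseries2_le => [t i|n m].
  by apply: integral_ge0 => z _; rewrite lee_fin.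
have I0 (T : nat -> nat -> R -> R) t i : (0 <= \int[mu]_z (T t i z ^+ 2)%R%:E)%E.
  by apply: integral_ge0 => z _; rewrite lee_fin sqr_ge0.
have uE t i : (\int[mu]_z (u t i z)%:E = 2%:E * \int[mu]_z (T1 t i z ^+ 2)%R%:E +
    2%:E * \int[mu]_z (T2 t i z ^+ 2)%R%:E)%E.
  rewrite (nnintD (mT1' t i) (mT2' t i)); try by move=> z; rewrite mulr_ge0 ?sqr_ge0.
  congr (_ + _)%E.
    exact (nnintZ (ler0n R 2) (measurable_funX 2 (mT1 t i)) (fun z => sqr_ge0 _)).
  exact (nnintZ (ler0n R 2) (measurable_funX 2 (mT2 t i)) (fun z => sqr_ge0 _)).
rewrite (eq_bigr (fun i : 'I_m => (\sum_(t < n) (2%:E * \int[mu]_z (T1 t i z ^+ 2)%R%:E +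
    2%:E * \int[mu]_z (T2 t i z ^+ 2)%R%:E))%E)); last first.
  by move=> i _; apply: eq_bigr => t _; exact: uE.
rewrite (double_sum_lin2 n m (I0 T1) (I0 T2)).
have B1 := level_family_le n m mf1 (@f1sq j).
have B2 := level_family_le n m mf2 (@f2sq j).
set B := (X in (_ <= X)%E) in B1.
apply: (@le_trans _ _ (2%:E * B + 2%:E * B)%E).
  have two0 : (0 <= 2%:E :> \bar R)%E by rewrite lee_fin.
  exact (leeD (lee_wpmul2l two0 B1) (lee_wpmul2l two0 B2)).
rewrite /B -!EFinM -EFinD lee_fin le_eqVlt; apply/orP; left; apply/eqP.
ring.
Qed.

End level_square.

Section extended_orlicz.
Context {R : realType}.
Implicit Types (s : R) (u v : \bar R).
Local Open Scope ereal_scope.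

Lemma ePhi_ge0 s u : 0 <= u -> 0 <= ePhi s u.
Proof. by case: u => // t; rewrite !lee_fin; exact: Phi_ge0. Qed.

Lemma ePhi_le s u v : (0 <= s)%R -> 0 <= u -> u <= v -> ePhi s u <= ePhi s v.
Proof.
move=> s0; case: u => [t||]; case: v => [t'||]//; rewrite ?lee_fin ?leey//.
by move=> t0 tt'; exact: Phi_le.
Qed.

Lemma measurable_Phi s : measurable_fun [set: R] (Phi s).
Proof.
apply: measurable_funM => //.
apply: (@measurableT_comp _ _ _ _ _ _ (fun x : R => x `^ s)%R).
  exact: measurable_powR.
apply: (@measurableT_comp _ _ _ _ _ _ (@ln R)); first exact: measurable_ln.
exact: measurable_funD.
Qed.

Lemma measurable_ePhi d (T : measurableType d) s (D : set T) (f : T -> \bar R) :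
  measurable_fun D f -> measurable_fun D (fun x => ePhi s (f x)).
Proof.
by move=> mf; exact (measurableT_comp (measurable_er_map T (measurable_Phi s)) mf).
Qed.

Lemma measurable_sqrte d (T : measurableType d) (D : set T) (f : T -> \bar R) :
  (forall x, 0 <= f x) -> measurable_fun D f -> measurable_fun D (fun x => sqrte (f x)).
Proof.
move=> f0 mf; apply: (@eq_measurable_fun _ _ _ _ _ (er_map Num.sqrt \o f)).
  by move=> x _ /=; have := f0 x; case: (f x).
have ms : measurable_fun [set: R] (@Num.sqrt R).
  by apply: continuous_measurable_fun => x; exact: sqrt_continuous.
exact (measurableT_comp (measurable_er_map T ms) mf).
Qed.

Lemma ePhi_le_quadratic s (n : nat) (A t : R) u : (0 <= s)%R -> (0 < n)%N ->
  (s <= n%:R)%R -> (0 < A)%R -> (0 < t)%R -> 0 <= u ->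
  ePhi s (sqrte u * (t^-1)%:E) <=
  ((n%:R ^+ n * expR 1) * Phi s A)%:E * (1 + ((t * A) ^- 2)%:E * u).
Proof.
move=> s0 n0 sn A0 t0.
have K0 : (0 < (n%:R ^+ n * expR 1) * Phi s A)%R.
  rewrite mulr_gt0//; first by rewrite mulr_gt0 ?expR_gt0// exprn_gt0// ltr0n.
  by rewrite mulr_gt0// powR_gt0//; apply: (@lt_le_trans _ _ 1%R) => //; apply: ln_e_ge1; exact: ltW.
have tA0 : (0 < (t * A) ^- 2)%R by rewrite invr_gt0 exprn_gt0// mulr_gt0.
case: u => [r| |]//; last first.
  by move=> _; rewrite gt0_muley ?lte_fin// addey// gt0_muley ?leey// lte_fin.
rewrite !lee_fin => r0.
have := @Phi_le_quadratic R s n A (Num.sqrt r / t) s0 n0 sn A0 (divr_ge0 (sqrtr_ge0 _) (ltW t0)).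
rewrite expr_div_n sqr_sqrtr// => H; apply: (le_trans H).
suff -> : (r / t ^+ 2 / A ^+ 2 = (t * A) ^- 2 * r)%R by [].
by field; apply/andP; split; exact: lt0r_neq0.
Qed.

End extended_orlicz.

Section level_orlicz.
Context {R : realType}.
Notation mu := (@lebesgue_measure R).

Variables (E : nat -> set (measurableTypeR R)) (J : set (measurableTypeR R))
  (L t0 s : R) (n : nat) (F S : R -> \bar R).
Hypotheses (mE : forall j, measurable (E j)) (tE : trivIset setT E)
  (EJ : forall j, E j `<=` J) (mJ : measurable J) (JL : mu J = L%:E)
  (t00 : 0 < t0) (s0 : 0 <= s) (n0 : (0 < n)%N) (sn : s + 1 / 2 <= n%:R).
Hypotheses (F0 : forall x, (0 <= F x)%E) (mF : measurable_fun [set: R] F)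
  (FE : forall j x, E j.+1 x -> ((t0 * 2 ^+ j)%:E < F x)%E)
  (FL : (\int[mu]_(x in J) ePhi (s + 1 / 2) (F x * (t0^-1)%:E) <= L%:E)%E).
Hypotheses (S0 : forall x, (0 <= S x)%E) (mS : measurable_fun [set: R] S)
  (Sout : forall x, (forall j, ~ E j x) -> S x = 0%E)
  (SE : forall j, (\int[mu]_(x in E j) S x <=
    (720 * (t0 * 2 ^+ j) ^+ 2 * (j.+1%:R * fine (mu (E j)) + (16 ^+ j)^-1 * L))%:E)%E).

Let s' := s + 1 / 2.
Let K := n%:R ^+ n * expR 1 : R.
Let w j := 2 ^+ j * j.+1%:R `^ s' : R.
Let c6 := 2 * 6 `^ s' : R.
Let H x := (1 + c6%:E * ePhi s' (F x * (t0^-1)%:E))%E.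

Let L0 : 0 <= L. Proof. by rewrite -lee_fin -JL. Qed.
Let s'0 : 0 <= s'. Proof. by rewrite addr_ge0. Qed.
Let c60 : 0 <= c6. Proof. by rewrite mulr_ge0 ?powR_ge0. Qed.
Let K0 : 0 <= K. Proof. by rewrite mulr_ge0 ?expR_ge0// exprn_ge0. Qed.

Let C0 : 0 <= 721 * K * 3 `^ s.
Proof. exact (mulr_ge0 (mulr_ge0 (ler0n R 721) K0) (powR_ge0 _ _)). Qed.

Let EM j : mu (E j) = (fine (mu (E j)))%:E.
Proof.
rewrite fineK// ge0_fin_numE//; apply: (@le_lt_trans _ _ (mu J)); last by rewrite JL ltry.
by apply: le_measure; rewrite ?inE.
Qed.

Let ePhiF0 x : (0 <= ePhi s' (F x * (t0^-1)%:E))%E.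
Proof. by apply/ePhi_ge0/mule_ge0 => //; rewrite lee_fin invr_ge0 ltW. Qed.

Let mePhiF : measurable_fun [set: R] (fun x => ePhi s' (F x * (t0^-1)%:E)%E).
Proof. by apply: measurable_ePhi; exact (emeasurable_funM mF (measurable_cst _)). Qed.

Let H0 x : (0 <= H x)%E.
Proof. by rewrite adde_ge0// mule_ge0// lee_fin. Qed.

Let mH : measurable_fun [set: R] H.
Proof.
exact (emeasurable_funD (measurable_cst _) (emeasurable_funM (measurable_cst _) mePhiF)).
Qed.

Lemma level_weight_le j : ((w j * fine (mu (E j)))%:E <= \int[mu]_(x in E j) H x)%E.
Proof.
rewrite EFinM -EM -(integral_cst mu (mE j)).
apply: ge0_le_integral.
- exact: mE.
- by move=> x _; rewrite lee_fin mulr_ge0 ?powR_ge0 ?exprn_ge0.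
- exact: measurable_cst.
- exact: (measurable_funTS mH).
move=> x; case: j => [_|j jx].
  rewrite /w expr0 mul1r powR1 /H leeDl//.
  by rewrite mule_ge0// lee_fin.
apply: (@le_trans _ _ (c6%:E * ePhi s' (F x * (t0^-1)%:E))%E); last by rewrite /H leeDr.
have := FE jx; have := F0 x; case: (F x) => [r| |]//.
  rewrite !lee_fin lte_fin /w => r0 tr.
  apply: Phi_level_ge => //.
  by rewrite ltr_pdivlMr// mulrC.
move=> _ _; rewrite gt0_mulye ?lte_fin ?invr_gt0//= gt0_muley ?leey//.
by rewrite lte_fin mulr_gt0// powR_gt0.
Qed.

Lemma level_tail_le j : w j * ((16 ^+ j)^-1 * L) <= n%:R ^+ n * 4 * L * (2 ^+ j)^-1.
Proof.
have j1 : 1 <= j.+1%:R :> R by rewrite ler1n.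
have H1 := powR_le_expR j1 n0 sn.
have H2 : expR j.+1%:R <= 4 * 4 ^+ j :> R.
  rewrite -exprS -[X in expR X]mul1r expRM_natr.
  by apply: lerXn2r; rewrite ?nnegrE ?expR_ge0//; exact: expR1_le4.
have H3 : j.+1%:R `^ s' <= n%:R ^+ n * (4 * 4 ^+ j).
  by apply: (le_trans H1); rewrite ler_wpM2l ?exprn_ge0.
have p2 : 2 ^+ j != 0 :> R by rewrite expf_neq0// pnatr_eq0.
have E4 : 4 ^+ j = 2 ^+ j * 2 ^+ j :> R by rewrite -exprMn; congr (_ ^+ _); ring.
have E16 : 16 ^+ j = 2 ^+ j * 2 ^+ j * (2 ^+ j * 2 ^+ j) :> R.
  by rewrite -!exprMn; congr (_ ^+ _); ring.
have -> : n%:R ^+ n * 4 * L * (2 ^+ j)^-1 =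
  2 ^+ j * (n%:R ^+ n * (4 * 4 ^+ j)) * ((16 ^+ j)^-1 * L) :> R.
  by rewrite E4 E16; field.
apply: ler_wpM2r; first by rewrite mulr_ge0// invr_ge0 exprn_ge0.
by rewrite ler_wpM2l ?exprn_ge0.
Qed.

Let U x := ePhi s (sqrte (S x) * (t0^-1)%:E)%E.

Let U0 x : (0 <= U x)%E.
Proof. by apply/ePhi_ge0/mule_ge0; [exact: sqrte_ge0|rewrite lee_fin invr_ge0 ltW]. Qed.

Let mU : measurable_fun [set: R] U.
Proof.
apply: measurable_ePhi.
exact (emeasurable_funM (measurable_sqrte S0 mS) (measurable_cst _)).
Qed.

(* [Phi_le_quadratic] at [A = 2^j sqrt (j + 1)], the typical size of [sqrt S / t0]
   on [E j]. *)
Lemma level_orlicz_le j : (\int[mu]_(x in E j) U x <=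
  (721 * K * 3 `^ s)%:E * (\int[mu]_(x in E j) H x +
     (n%:R ^+ n * 4 * L * (2 ^+ j)^-1)%:E))%E.
Proof.
set M := fine (mu (E j)).
have M0 : 0 <= M by rewrite fine_ge0.
pose A : R := 2 ^+ j * Num.sqrt j.+1%:R.
have j1 : 0 < j.+1%:R :> R by rewrite ltr0n.
have A0 : 0 < A by rewrite mulr_gt0 ?exprn_gt0// sqrtr_gt0.
have PA0 : 0 <= Phi s A by apply: Phi_ge0; exact: ltW.
have KP0 : (0 <= (K * Phi s A)%:E)%E by rewrite lee_fin mulr_ge0.
have q0 : (0 <= ((t0 * A) ^- 2)%:E)%E by rewrite lee_fin invr_ge0 sqr_ge0.
have sn' : s <= n%:R by apply: le_trans sn; rewrite lerDl.
have mSj : measurable_fun (E j) S by exact: (measurable_funTS mS).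
have mqS : measurable_fun (E j) (fun x => ((t0 * A) ^- 2)%:E * S x)%E.
  exact (emeasurable_funM (measurable_cst _) mSj).
apply: (@le_trans _ _ (\int[mu]_(x in E j) ((K * Phi s A)%:E * (1 + ((t0 * A) ^- 2)%:E * S x)))%E).
  apply: ge0_le_integral => //.
  - exact: (measurable_funTS mU).
  - exact (emeasurable_funM (measurable_cst _) (emeasurable_funD (measurable_cst _) mqS)).
  by move=> x _; exact: ePhi_le_quadratic.
rewrite ge0_integralZl//; [|exact (emeasurable_funD (measurable_cst _) mqS)|
  by move=> x _; rewrite adde_ge0// mule_ge0].
rewrite ge0_integralD//; last by move=> x _; rewrite mule_ge0.
rewrite ge0_integralZl//.
rewrite integral_cst; last exact: mE.
rewrite mul1e [X in (_ * (X + _))%E]EM -/M.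
apply: (@le_trans _ _ ((721 * K * 3 `^ s)%:E * (w j * M + w j * ((16 ^+ j)^-1 * L))%R%:E)%E); last first.
  apply: lee_wpmul2l; first by rewrite lee_fin.
  by rewrite EFinD; apply: leeD; [exact: level_weight_le|rewrite lee_fin level_tail_le].
apply: (@le_trans _ _ ((K * Phi s A)%:E * (M%:E + ((t0 * A) ^- 2)%:E *
    (720 * (t0 * 2 ^+ j) ^+ 2 * (j.+1%:R * M + (16 ^+ j)^-1 * L))%:E))%E).
  apply: lee_wpmul2l => //; apply: leeD => //; apply: lee_wpmul2l => //; exact: SE.
rewrite -!EFinM lee_fin.
have -> : (t0 * A) ^- 2 * (720 * (t0 * 2 ^+ j) ^+ 2 * (j.+1%:R * M + (16 ^+ j)^-1 * L)) =
   720 * (M + (16 ^+ j)^-1 * L / j.+1%:R).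
  have p2 : 2 ^+ j != 0 :> R by rewrite expf_neq0// pnatr_eq0.
  have tA2 : (t0 * A) ^+ 2 = t0 ^+ 2 * (2 ^+ j) ^+ 2 * j.+1%:R.
    by rewrite /A !exprMn sqr_sqrtr ?ler0n// mulrA.
  rewrite tA2; move: p2; set p := 2 ^+ j; set c := (16 ^+ j)^-1; set jj := j.+1%:R => p2.
  by field; rewrite p2 !lt0r_neq0.
set c := (16 ^+ j)^-1 * L.
have c0 : 0 <= c by rewrite mulr_ge0// invr_ge0 exprn_ge0.
have cj : c / j.+1%:R <= c by rewrite ler_pdivrMr// ler_peMr// ler1n.
have cj0 : 0 <= c / j.+1%:R by rewrite divr_ge0// ltW.
have Pw : Phi s A <= 3 `^ s * w j by exact: Phi_level_le.
rewrite -mulrDr.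
have -> : 721 * K * 3 `^ s * (w j * (M + c)) = K * (3 `^ s * w j) * (721 * (M + c)) by ring.
apply: ler_pM.
- by rewrite mulr_ge0.
- have pos (x z : R) : 0 <= x -> 0 <= z -> 0 <= x + 720 * (x + z) by lra.
  exact: pos.
- by rewrite ler_wpM2l.
- have lin (x y z : R) : z <= y -> 0 <= y -> x + 720 * (x + z) <= 721 * (x + y) by lra.
  exact: lin.
Qed.

Lemma half_sum_le m : \sum_(j < m) (2 ^+ j)^-1 <= 2 :> R.
Proof.
suff -> : \sum_(j < m) (2 ^+ j)^-1 = 2 - 2 * (2 ^+ m)^-1 :> R.
  by rewrite lerBlDr lerDl mulr_ge0// invr_ge0 exprn_ge0.
elim: m => [|m IH]; first by rewrite big_ord0 expr0 invr1; ring.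
have p2 : 2 ^+ m != 0 :> R by rewrite expf_neq0// pnatr_eq0.
by rewrite big_ord_recr/= IH exprS; field.
Qed.

Lemma orlicz_levels_le : (\int[mu]_x U x <=
  (721 * K * 3 `^ s * (1 + c6 + 8 * n%:R ^+ n) * L)%:E)%E.
Proof.
have mUE : measurable (\bigcup_j E j) by exact: bigcup_measurable.
have UE : (\int[mu]_x U x = \int[mu]_(x in \bigcup_j E j) U x)%E.
  rewrite [RHS]integral_mkcond; apply: eq_integral => x _.
  rewrite patchE; case: ifPn => // /negP xE.
  have nx j : ~ E j x by move=> jx; apply: xE; rewrite inE; exists j.
  rewrite /U (Sout nx).
  have -> : sqrte 0 = 0%E :> \bar R by rewrite /= sqrtr0.
  by rewrite mul0e /ePhi/= Phi0.
pose d j : R := n%:R ^+ n * 4 * L * (2 ^+ j)^-1.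
have d0 j : 0 <= d j by rewrite !mulr_ge0 ?exprn_ge0 ?invr_ge0.
have IH0 j : (0 <= \int[mu]_(x in E j) H x)%E by exact: integral_ge0.
rewrite UE ge0_integral_bigcup//; [|exact: (measurable_funTS mU)].
apply: (@le_trans _ _ (\sum_(0 <= j <oo) ((721 * K * 3 `^ s)%:E * (\int[mu]_(x in E j) H x + (d j)%:E)))%E).
  by apply: lee_nneseries => j *; [exact: integral_ge0|exact: level_orlicz_le].
rewrite nneseriesZl; last by move=> j _; rewrite adde_ge0// lee_fin.
rewrite nneseriesD//; last by move=> j _ *; rewrite lee_fin.
rewrite -ge0_integral_bigcup//; last exact: (measurable_funTS mH).
rewrite -[X in (_ <= X%:E)%E]mulrA [X in (_ <= X)%E]EFinM; apply: lee_wpmul2l; first by rewrite lee_fin.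
have -> : (1 + c6 + 8 * n%:R ^+ n) * L = (L + c6 * L) + 8 * n%:R ^+ n * L by ring.
rewrite EFinD; apply: leeD.
  apply: (@le_trans _ _ (\int[mu]_(x in J) H x)%E).
    apply: ge0_subset_integral => //; first exact: (measurable_funTS mH).
    by apply: bigcup_sub => j _; exact: EJ.
  rewrite ge0_integralD//; [|by move=> x _; rewrite mule_ge0// lee_fin|
    exact (measurable_funTS (emeasurable_funM (measurable_cst _) mePhiF))].
  rewrite ge0_integralZl//; last exact (measurable_funTS mePhiF).
  have JL' : (mu J <= L%:E)%E by rewrite JL.
  rewrite integral_cst// mul1e EFinD [(c6 * L)%:E]EFinM; apply: leeD; first exact: JL'.
  by apply: lee_wpmul2l; [rewrite lee_fin|exact: FL].
apply: lime_le; first by apply: is_cvg_nneseries => j _ _; rewrite lee_fin.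
near=> m; rewrite big_mkord sumEFin lee_fin -mulr_sumr.
have -> : 8 * n%:R ^+ n * L = n%:R ^+ n * 4 * L * 2 by ring.
by rewrite ler_wpM2l ?half_sum_le// !mulr_ge0// exprn_ge0.
Unshelve. all: by end_near. Qed.

End level_orlicz.

(** * Low frequencies *)

Section mean_zero.
Context {R : realType}.
Notation mu := (@lebesgue_measure R).
Notation integrable f := (mu.-integrable [set: R] (EFin \o f)).
Variables (f : R -> R) (a b : R).
Hypotheses (ab : a <= b) (fi : integrable f) (f0 : forall x, ~ (a <= x <= b) -> f x = 0).

Lemma window_mean_zero (u v y : R) : \int[mu]_x f x = 0 ->
  ~ (a <= y + u <= b) -> ~ (a <= y + v <= b) -> window u v f y = 0.
Proof.
move=> If /negP yu /negP yv; rewrite /window.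
have [|nuv] := boolP ((y + u < a) && (b < y + v)).
  move=> /andP[ua bv]; rewrite -[RHS]If [LHS]Rintegral_mkcond; apply: eq_Rintegral => x _.
  rewrite patchE; case: ifPn => // /negP xD; apply/esym/f0 => /andP[ax xb]; apply: xD.
  by rewrite inE/= in_itv/=; apply/andP; split; lra.
rewrite /Rintegral integral0_eq// => x; rewrite /= in_itv/= => /andP[ux xv].
congr (_%:E); apply: f0 => /andP[ax xb].
by move: yu yv nuv; rewrite !negb_and -!ltNge -!leNgt => /orP[?|?] /orP[?|?] /orP[?|?]; lra.
Qed.

Let N := \int[mu]_x `|f x|.

Let fin : integrable (fun x => `|f x|).
Proof. exact: (@integrable_norm _ _ _ mu setT). Qed.

Lemma window_norm_le (u v y : R) : `|window u v f y| <= N.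
Proof.
have mD : measurable (`[y + u, y + v[%classic : set (measurableTypeR R)) by exact: measurable_itv.
apply: (le_trans (le_normr_Rintegral mD (integrable_subset mD fi))).
have iD := integrable_subset mD fin.
rewrite -lee_fin EFin_Rintegral//.
rewrite [in leLHS]/Rintegral fineK; last by apply: integrable_fin_num.
apply: ge0_subset_integral => //.
by case/integrableP: fin.
Qed.

Let I := (\1_(`[a, b]%classic) : R -> R).

Let IE z : I z = (a <= z <= b)%R%:R.
Proof. by rewrite /I indicE (_ : (z \in _) = (a <= z <= b)%R)//; apply/idP/idP; rewrite inE/= in_itv. Qed.

Lemma davg_mean_zero_le (h y : R) : 0 < h -> \int[mu]_x f x = 0 ->
  `|davg h f y| <= h^-1 * N * (I (y - h) + I y + I (y + h)).
Proof.
move=> h0 If; rewrite davgE//.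
have N0 : 0 <= N by apply: Rintegral_ge0.
have hN : 0 <= h^-1 * N by rewrite mulr_ge0// invr_ge0 ltW.
have I01 z : 0 <= I z by rewrite IE.
have H : `|(window 0 h f y - window (- h) 0 f y) / (2 * h)| <= h^-1 * N.
  rewrite normrM normfV (@gtr0_norm _ (2 * h)) ?mulr_gt0// ler_pdivrMr ?mulr_gt0//.
  apply: (le_trans (ler_normB _ _)).
  have w1 := window_norm_le 0 h y; have w2 := window_norm_le (- h) 0 y.
  have -> : h^-1 * N * (2 * h) = N + N by field; exact: lt0r_neq0.
  by rewrite lerD.
have [H1|H1] := leP 1 (I (y - h) + I y + I (y + h)).
  by apply: (le_trans H); rewrite ler_peMr.
have Iz z : ~ (a <= z <= b) \/ I z = 1.
  by rewrite IE; case: (boolP (a <= z <= b)) => [|/negP]; [right|left].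
have i1 := I01 (y - h); have i2 := I01 y; have i3 := I01 (y + h).
have [A|A] := Iz (y - h); last by lra.
have [B|B] := Iz y; last by lra.
have [D|D] := Iz (y + h); last by lra.
rewrite !window_mean_zero ?addr0// subrr mul0r normr0.
by rewrite mulr_ge0// !addr_ge0.
Qed.

Lemma mean_zero_dominates (h t x : R) : 0 < h -> h <= t -> b - a <= t ->
  \int[mu]_x f x = 0 ->
  (\int[mu]_y (phi_scaled t (x - y) * `|davg h f y|)%R%:E <=
   27%:E * \int[mu]_z (phi_scaled t (x - z) * ((b - a) / h * `|f z|))%R%:E)%E.
Proof.
move=> h0 ht Lt If; have t0 : 0 < t by exact: lt_le_trans ht.
have mphi := measurable_phi_scaled x t0.
have ph0 y : 0 <= phi_scaled t (x - y) by rewrite ltW ?phi_scaled_gt0.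
have N0 : 0 <= N by apply: Rintegral_ge0.
have I0 z : 0 <= I z by rewrite IE.
have mI : measurable_fun [set: R] I by exact: measurable_indic.
have mIs c : measurable_fun [set: R] (fun y => I (y + c)).
  by apply: measurableT_comp => //; exact: measurable_funD.
have pfi := integrable_phi_scaled t0 x fin.
pose P := \int[mu]_z (phi_scaled t (x - z) * `|f z|).
have P0 : 0 <= P by apply: Rintegral_ge0 => z _; rewrite mulr_ge0.
have key y c : `|c| <= h -> I (y + c) * (phi_scaled t (x - y) * N) <= 9 * P * I (y + c).
  move=> ch; rewrite IE; case: (boolP (a <= _ <= b)); last by rewrite mul0r mulr0.
  rewrite mul1r mulr1 => /andP[yca ycb].
  rewrite /N -RintegralZl//= /P -RintegralZl//=.
  apply: le_Rintegral => //.
  - exact (integrableZl measurableT _ fin).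
  - exact (integrableZl measurableT _ pfi).
  move=> z _; have [|/negP nz] := boolP (a <= z <= b); last first.
    by rewrite f0// normr0 !mulr0.
  move=> /andP[az zb]; rewrite mulrA ler_wpM2r//.
  apply: (@le_trans _ _ (3 * phi_scaled t (x - (y + c)))).
    apply: phi_scaled_slow => //; rewrite opprD addrA subrr add0r normrN.
    exact: le_trans ht.
  have -> : 9 * phi_scaled t (x - z) = 3 * (3 * phi_scaled t (x - z)) by ring.
  rewrite ler_wpM2l//; apply: phi_scaled_slow => //.
  by rewrite ler_norml; apply/andP; split; lra.
have hP : 0 <= h^-1 * (9 * P) by rewrite !mulr_ge0// invr_ge0 ltW.
apply: (@le_trans _ _ (\int[mu]_y (h^-1 * (9 * P) * ((I (y + - h) + I (y + 0)) + I (y + h)))%R%:E)%E).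
  apply: nnint_le.
  - apply: measurable_funM => //; apply: measurableT_comp => //; exact: measurable_davg.
  - exact (measurable_funM (measurable_cst _) (measurable_funD (measurable_funD (mIs _) (mIs _)) (mIs _))).
  - by move=> y; rewrite mulr_ge0.
  move=> y; apply: (@le_trans _ _ (phi_scaled t (x - y) * (h^-1 * N * (I (y - h) + I y + I (y + h))))).
    by rewrite ler_wpM2l// davg_mean_zero_le.
  have h00 := ltW h0.
  have k1 : I (y - h) * _ <= _ := key y (- h) ltac:(by rewrite normrN ger0_norm).
  have k2 := key y 0 ltac:(by rewrite normr0).
  have k3 := key y h ltac:(by rewrite ger0_norm).
  have -> : phi_scaled t (x - y) * (h^-1 * N * (I (y - h) + I y + I (y + h))) =
    h^-1 * (I (y - h) * (phi_scaled t (x - y) * N) + I (y + 0) * (phi_scaled t (x - y) * N) +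
      I (y + h) * (phi_scaled t (x - y) * N)) by rewrite addr0; ring.
  rewrite -[leRHS]mulrA; apply: ler_wpM2l; first by rewrite invr_ge0 ltW.
  by rewrite [leRHS]mulrDr [X in _ <= X + _]mulrDr; apply: lerD => //; exact: lerD.
have IL : (\int[mu]_x (I x)%:E = (b - a)%:E)%E.
  have mab : measurable (`[a, b]%classic : set (measurableTypeR R)) by exact: measurable_itv.
  rewrite integral_indic// setIT; transitivity (lebesgue_measure `[a, b]%classic) => //.
  rewrite lebesgue_measure_itv/= lte_fin.
  by case: ltP => // ba; rewrite (_ : b = a) ?subrr//; apply/eqP; rewrite eq_le ba.
rewrite (nnintZ hP (measurable_funD (measurable_funD (mIs _) (mIs _)) (mIs _))); last first.
  by move=> y; rewrite !addr_ge0.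
rewrite (nnintD (measurable_funD (mIs _) (mIs _)) (mIs _))//; last by move=> y; rewrite addr_ge0.
rewrite (nnintD (mIs _) (mIs _))// !nnint_shift// IL.
rewrite (_ : (\int[mu]_z _ = ((b - a) / h * P)%:E)%E); last first.
  have k0 : 0 <= (b - a) / h by rewrite divr_ge0 ?subr_ge0// ltW.
  have pp z : 0 <= phi_scaled t (x - z) * `|f z| by rewrite mulr_ge0.
  rewrite EFinM /P EFin_Rintegral// -(nnintZ k0 (measurable_integrable pfi) pp).
  by apply: eq_integral => z _; rewrite mulrCA.
rewrite -!EFinD -!EFinM lee_fin le_eqVlt; apply/orP; left; apply/eqP.
ring.
Qed.

End mean_zero.

Section domination.
Context {R : realType}.
Notation mu := (@lebesgue_measure R).
Notation integrable f := (mu.-integrable [set: R] (EFin \o f)).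
Variables (eta : R -> R) (C : R).
Hypotheses (C0 : 0 < C) (HC : forall (k : int) (f : R -> R[i]),
  integrable (fun x => complex.Re (f x)) -> integrable (fun x => complex.Im (f x)) ->
  forall x, cmod (LP_proj eta k f x) <=
    C * (\int[mu]_y (phi_scaled (2 ^ (- k)) (x - y) *
      (`|davg (2 ^ (- k) / 4) (fun z => complex.Re (f z)) y| +
       `|davg (2 ^ (- k) / 4) (fun z => complex.Im (f z)) y|)))%R).

Lemma LP_dominatedW (k : int) (f : R -> R[i]) (g1 g2 : R -> R) (B : R) :
  integrable (fun x => complex.Re (f x)) -> integrable (fun x => complex.Im (f x)) ->
  integrable g1 -> integrable g2 -> (forall x, 0 <= g1 x) -> (forall x, 0 <= g2 x) ->
  (forall x, (\int[mu]_y (phi_scaled (2 ^ (- k)) (x - y) *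
      `|davg (2 ^ (- k) / 4) (fun z => complex.Re (f z)) y|)%R%:E <=
    B%:E * \int[mu]_y (phi_scaled (2 ^ (- k)) (x - y) * g1 y)%R%:E)%E) ->
  (forall x, (\int[mu]_y (phi_scaled (2 ^ (- k)) (x - y) *
      `|davg (2 ^ (- k) / 4) (fun z => complex.Im (f z)) y|)%R%:E <=
    B%:E * \int[mu]_y (phi_scaled (2 ^ (- k)) (x - y) * g2 y)%R%:E)%E) ->
  LP_dominated eta (C * B) k f (fun y => g1 y + g2 y).
Proof.
move=> f1i f2i g1i g2i g10 g20 H1 H2 x.
set t := 2 ^ (- k) : R; have t0 : 0 < t by exact: exprz_gt0.
have t4 : 0 < t / 4 by rewrite divr_gt0.
have gi : integrable (fun y => g1 y + g2 y) by exact (integrableD measurableT g1i g2i).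
have dn (F : R -> R) : integrable F -> integrable (fun y => `|davg (t / 4) F y|).
  by move=> Fi; apply: (@integrable_norm _ _ _ mu setT); exact: integrable_davg.
have d1 := dn _ f1i; have d2 := dn _ f2i.
have p1 := integrable_phi_scaled t0 x d1; have p2 := integrable_phi_scaled t0 x d2.
have q1 := integrable_phi_scaled t0 x g1i; have q2 := integrable_phi_scaled t0 x g2i.
split; first exact: (integrable_phi_scaled t0 x gi).
apply: (le_trans (HC k f1i f2i x)); rewrite -mulrA ler_wpM2l ?(ltW C0)//.
rewrite -/t.
under eq_Rintegral do rewrite mulrDr.
under [in leRHS]eq_Rintegral do rewrite mulrDr.
rewrite !RintegralD// mulrDr; apply: lerD.
  by rewrite -lee_fin EFinM !EFin_Rintegral//; exact: H1.
by rewrite -lee_fin EFinM !EFin_Rintegral//; exact: H2.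
Qed.

End domination.

Section square_function_data.
Context {R : realType}.
Notation mu := (@lebesgue_measure R).
Notation integrable f := (mu.-integrable [set: R] (EFin \o f)).

Lemma cmod_sqr (z : R[i]) : cmod z ^+ 2 = complex.Re z ^+ 2 + complex.Im z ^+ 2.
Proof. by case: z => u v; rewrite /cmod/= sqr_sqrtr// addr_ge0 ?sqr_ge0. Qed.

Lemma sqrte_le (u : \bar R) (c : R) : (0 <= u)%E -> 0 <= c ->
  (sqrte u <= c%:E)%E -> (u <= (c ^+ 2)%:E)%E.
Proof.
case: u => [u||]//; rewrite !lee_fin => u0 c0 uc.
by rewrite -(sqr_sqrtr u0) ler_sqr ?nnegrE ?sqrtr_ge0.
Qed.

Variables (l r : bool) (a b : R).
Hypothesis (ab : a < b).
Let J : set (measurableTypeR R) := itvJ l r a b.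

Lemma measurable_itvJ : measurable J.
Proof. exact: measurable_itv. Qed.

Lemma itvJ_measure : mu J = (b - a)%:E.
Proof. by rewrite /J /itvJ lebesgue_measure_itv/= lte_fin ab. Qed.

Lemma itvJ_bounds x : J x -> a <= x <= b.
Proof.
rewrite /J /itvJ/= in_itv/= => /andP[]; case: l; case: r => /= h1 h2; apply/andP; split => //;
  exact: ltW.
Qed.

Variables (f : nat -> R -> R[i]).
Hypotheses (mf : forall t, cmeasurable (f t)) (sf : forall t, supported_in (f t) J).

Let F := square_function [set: nat] (fun t x => cmod (f t x)).

Lemma square_functionE x : F x = sqrte (\sum_(0 <= t <oo) (cmod (f t x) ^+ 2)%:E)%E.
Proof.
by rewrite /F /square_function nneseries_esumT// => t; rewrite lee_fin sqr_ge0.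
Qed.

Let mcmod t : measurable_fun [set: R] (fun x => cmod (f t x) ^+ 2).
Proof.
have [m1 m2] := mf t.
under eq_fun do rewrite cmod_sqr.
exact (measurable_funD (measurable_funX 2 m1) (measurable_funX 2 m2)).
Qed.

Let S0 x : (0 <= \sum_(0 <= t <oo) (cmod (f t x) ^+ 2)%:E)%E.
Proof. by apply: nneseries_ge0 => t _ _; rewrite lee_fin sqr_ge0. Qed.

Lemma square_function_ge0 x : (0 <= F x)%E.
Proof. by rewrite square_functionE sqrte_ge0. Qed.

Lemma measurable_square_function : measurable_fun [set: R] F.
Proof.
apply: (@eq_measurable_fun _ _ _ _ _
  (fun x => sqrte (\sum_(0 <= t <oo) (cmod (f t x) ^+ 2)%:E)%E)).
  by move=> x _; rewrite square_functionE.
apply: (measurable_sqrte S0).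
exact (measurable_nneseries_EFin mcmod (fun t x => sqr_ge0 _)).
Qed.

Lemma square_function_out x : ~ J x -> F x = 0%E.
Proof.
move=> xJ; rewrite square_functionE eseries0 /=; first by rewrite sqrtr0.
move=> t _ _; rewrite sf// /cmod/=.
by rewrite !expr0n/= addr0 sqrtr0 expr0n.
Qed.

Lemma cmod_le_square_function t x : ((cmod (f t x))%:E <= F x)%E.
Proof.
have c0 : 0 <= cmod (f t x) by rewrite /cmod; case: (f t x) => u v; exact: sqrtr_ge0.
have : (((cmod (f t x)) ^+ 2)%:E <= \sum_(0 <= t <oo) (cmod (f t x) ^+ 2)%:E)%E.
  apply: (@le_trans _ _ (\sum_(0 <= i < t.+1) (cmod (f i x) ^+ 2)%:E)%E); last first.
    by apply: nneseries_lim_ge => i _ _; rewrite lee_fin sqr_ge0.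
  rewrite big_nat_recr//= leeDr// sume_ge0// => i _; rewrite lee_fin sqr_ge0//.
rewrite square_functionE; have := S0 x; case: (\sum_(0 <= t <oo) _)%E => [u||]//=; rewrite ?leey//.
rewrite !lee_fin => u0 cu; rewrite -[leLHS]ger0_norm// -sqrtr_sqr.
by rewrite ler_sqrt.
Qed.

Lemma square_function_partial t0 n x : 0 <= t0 -> (F x <= t0%:E)%E ->
  \sum_(t < n) (complex.Re (f t x) ^+ 2 + complex.Im (f t x) ^+ 2) <= t0 ^+ 2.
Proof.
move=> t00; rewrite square_functionE => /(sqrte_le (S0 x) t00) H.
rewrite -lee_fin; apply: le_trans H.
under eq_bigr do rewrite -cmod_sqr.
rewrite -sumEFin -(big_mkord xpredT (fun t => (cmod (f t x) ^+ 2)%:E)).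
by apply: nneseries_lim_ge => i _ _; rewrite lee_fin sqr_ge0.
Qed.

Lemma luxemburg_lt s y : (luxemburg s J F < y)%E -> exists t0 : R,
  [/\ 0 < t0, (t0%:E < y)%E &
      (\int[mu]_(x in J) ePhi s (F x * (t0^-1)%:E) <= (b - a)%:E)%E].
Proof.
move=> /ereal_inf_lt[_ [t0 [t00 H] <-] ty]; exists t0; split => //.
move: H; rewrite [mu (itvJ l r a b)]itvJ_measure/=.
under eq_integral do rewrite gee0_abs ?square_function_ge0//.
by rewrite lee_pdivrMl ?subr_gt0// mule1.
Qed.

Section admissible.
Variables (s t0 : R).
Hypotheses (s0 : 0 <= s) (t00 : 0 < t0)
  (adm : (\int[mu]_(x in J) ePhi s (F x * (t0^-1)%:E) <= (b - a)%:E)%E).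

Lemma integral_square_function_le : (\int[mu]_(x in J) F x <= (t0 * (b - a))%:E)%E.
Proof.
have mJ := measurable_itvJ.
have mF := measurable_square_function.
have tt0 : (0 <= (t0^-1)%:E)%E by rewrite lee_fin invr_ge0 ltW.
have mFt : measurable_fun [set: R] (fun x => F x * (t0^-1)%:E)%E.
  exact (emeasurable_funM mF (measurable_cst _)).
have H : (\int[mu]_(x in J) (F x * (t0^-1)%:E) <= (b - a)%:E)%E.
  apply: le_trans adm; apply: ge0_le_integral => //.
  - by move=> x _; rewrite mule_ge0// square_function_ge0.
  - exact: (measurable_funTS mFt).
  - exact: (measurable_funTS (measurable_ePhi s mFt)).
  move=> x _; have : (0 <= F x * (t0^-1)%:E)%E by rewrite mule_ge0// square_function_ge0.
  case: (F x * _)%E => [u||]//=; rewrite !lee_fin => u0.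
  rewrite /Phi ler_peMr//.
  have l1 := ln_e_ge1 u0; apply: (@le_trans _ _ (1 `^ s)); first by rewrite powR1.
  by apply: ge0_ler_powR; rewrite ?nnegrE//; lra.
have Z : (\int[mu]_(x in J) (F x * (t0^-1)%:E) = (\int[mu]_(x in J) F x) * (t0^-1)%:E)%E.
  apply: ge0_integralZr => //; first exact: (measurable_funTS mF).
  by move=> x _; exact: square_function_ge0.
by move: H; rewrite Z -lee_pdivlMr ?invr_gt0// invrK EFinM muleC.
Qed.

Lemma integrable_component t :
  integrable (fun x => complex.Re (f t x)) /\ integrable (fun x => complex.Im (f t x)).
Proof.
have mF := measurable_square_function; have mJ := measurable_itvJ.
have FT : (\int[mu]_x F x < +oo)%E.
  apply: (@le_lt_trans _ _ (\int[mu]_(x in J) F x)%E).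
    rewrite [leRHS]integral_mkcond; apply: ge0_le_integral => //.
    - by move=> x _; exact: square_function_ge0.
    - by apply/(measurable_restrictT _ mJ); exact: measurable_funTS.
    move=> x _; rewrite patchE; case: ifPn => // /negP xJ.
    by rewrite square_function_out// => xJ'; apply: xJ; rewrite inE.
  exact: (le_lt_trans integral_square_function_le (ltry _)).
have [m1 m2] := mf t.
have H (g : R -> R) : measurable_fun [set: R] g -> (forall x, `|g x| <= cmod (f t x)) -> integrable g.
  move=> mg gc; apply/integrableP; split; first exact/measurable_EFinP.
  apply: le_lt_trans FT; apply: ge0_le_integral => //.
  - by apply/measurable_EFinP; exact: measurableT_comp.
  by move=> x _; apply: le_trans (cmod_le_square_function t x); rewrite lee_fin.
have c0 x : 0 <= cmod (f t x) by rewrite /cmod; case: (f t x) => u v; exact: sqrtr_ge0.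
split; apply: H => // x; rewrite -(@ler_sqr _ `|_|) ?nnegrE// real_normK ?num_real// cmod_sqr.
  by rewrite lerDl sqr_ge0.
by rewrite lerDr sqr_ge0.
Qed.

Lemma square_function_fin : {ae mu, forall x, J x -> (F x < +oo)%E}.
Proof.
have mF := measurable_square_function; have mJ := measurable_itvJ.
have Fi : mu.-integrable J F.
  apply/integrableP; split; first exact: (measurable_funTS mF).
  under eq_integral do rewrite gee0_abs ?square_function_ge0//.
  exact: (le_lt_trans integral_square_function_le (ltry _)).
have H := integrable_ae mJ Fi.
apply: (@filterS _ _ (ae_filter_ringOfSetsType mu) _ _ _ H) => x Fx /Fx.
by rewrite ge0_fin_numE// square_function_ge0.
Qed.

End admissible.
End square_function_data.

Section low_frequencies.
Context {R : realType}.
Notation mu := (@lebesgue_measure R).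
Notation integrable f := (mu.-integrable [set: R] (EFin \o f)).
Variables (eta : R -> R) (C : R).
Hypotheses (C0 : 0 < C) (HC : forall (k : int) (f : R -> R[i]),
  integrable (fun x => complex.Re (f x)) -> integrable (fun x => complex.Im (f x)) ->
  forall x, cmod (LP_proj eta k f x) <=
    C * (\int[mu]_y (phi_scaled (2 ^ (- k)) (x - y) *
      (`|davg (2 ^ (- k) / 4) (fun z => complex.Re (f z)) y| +
       `|davg (2 ^ (- k) / 4) (fun z => complex.Im (f z)) y|)))%R).

Variables (l r : bool) (a b : R) (f : nat -> R -> R[i]).
Hypotheses (ab : a < b) (mf : forall t, cmeasurable (f t))
  (sf : forall t, supported_in (f t) (itvJ l r a b))
  (fi : forall t, integrable (fun x => complex.Re (f t x)) /\
                  integrable (fun x => complex.Im (f t x)))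
  (f0 : forall t, cintegral (f t) = 0).

Definition low_majorant (t : nat) (k : int) (x : R) : R :=
  2 ^ k * (b - a) / 2 * `|complex.Re (f t x)| + 2 ^ k * (b - a) / 2 * `|complex.Im (f t x)|.

Let mlow t k : measurable_fun [set: R] (low_majorant t k).
Proof.
have [m1 m2] := mf t.
apply: measurable_funD; apply: measurable_funM => //; exact: measurableT_comp.
Qed.

Let outside t x : ~ (a <= x <= b) -> complex.Re (f t x) = 0 /\ complex.Im (f t x) = 0.
Proof. by move=> xab; rewrite sf// => /itvJ_bounds. Qed.

Lemma component_dominates (k : int) (g : R -> R) (x : R) : integrable g ->
  (forall x, ~ (a <= x <= b) -> g x = 0) -> (\int[mu]_x g x)%R = 0 ->
  2 ^ k < (b - a)^-1 ->
  (\int[mu]_y (phi_scaled (2 ^ (- k)) (x - y) * `|davg (2 ^ (- k) / 4) g y|)%R%:E <=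
   216%:E * \int[mu]_y (phi_scaled (2 ^ (- k)) (x - y) * (2 ^ k * (b - a) / 2 * `|g y|))%R%:E)%E.
Proof.
move=> gi g0 Ig kL.
have k0 : 0 < 2 ^ k :> R by exact: exprz_gt0.
have tk : 2 ^ (- k) = (2 ^ k)^-1 :> R by rewrite invr_expz.
have t0 : 0 < 2 ^ (- k) :> R by exact: exprz_gt0.
have L0 : 0 < b - a by rewrite subr_gt0.
have Lt : b - a <= 2 ^ (- k).
  by rewrite tk -[leLHS]invrK lef_pV2 ?posrE ?invr_gt0// ltW.
have h0 : 0 < 2 ^ (- k) / 4 :> R by rewrite divr_gt0.
have ht : 2 ^ (- k) / 4 <= 2 ^ (- k) :> R by move: t0; move: (2 ^ (- k)) => t; lra.
apply: (le_trans (mean_zero_dominates (ltW ab) gi g0 x h0 ht Lt Ig)).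
have gn : integrable (fun x => `|g x|) by exact: (@integrable_norm _ _ _ mu setT).
have gc : integrable (fun y => 2 ^ k * (b - a) / 2 * `|g y|) by exact (integrableZl measurableT _ gn).
have m8 := measurable_integrable (integrable_phi_scaled t0 x gc).
have pos y : 0 <= phi_scaled (2 ^ (- k)) (x - y) * (2 ^ k * (b - a) / 2 * `|g y|).
  apply: mulr_ge0; first exact: ltW (phi_scaled_gt0 _ t0).
  by apply: mulr_ge0 => //; apply: divr_ge0 => //; apply: mulr_ge0; exact: ltW.
have -> : (\int[mu]_z (phi_scaled (2 ^ (- k)) (x - z) * ((b - a) / (2 ^ (- k) / 4) * `|g z|))%R%:E =
    \int[mu]_y (8 * (phi_scaled (2 ^ (- k)) (x - y) * (2 ^ k * (b - a) / 2 * `|g y|)))%R%:E)%E.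
  apply: eq_integral => y _; congr (_%:E).
  have -> : (b - a) / (2 ^ (- k) / 4) = 8 * (2 ^ k * (b - a) / 2).
    by rewrite tk; field; exact: lt0r_neq0.
  by move: (phi_scaled _ _) (2 ^ k * (b - a) / 2) => u v; ring.
rewrite (nnintZ (ler0n R 8) m8 pos) muleA -EFinM.
by rewrite (_ : 27 * 8 = 216 :> R)//; ring.
Qed.

Lemma low_majorant_dominates t k : 2 ^ k < (b - a)^-1 ->
  LP_dominated eta (C * 216) k (f t) (low_majorant t k).
Proof.
move=> kL; have [f1i f2i] := fi t.
have c0 : 0 <= 2 ^ k * (b - a) / 2.
  apply: divr_ge0 => //; apply: mulr_ge0; first exact: ltW (exprz_gt0 _ _).
  by rewrite subr_ge0 ltW.
have ni (g : R -> R) : integrable g -> integrable (fun y => 2 ^ k * (b - a) / 2 * `|g y|).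
  by move=> gi; exact (integrableZl measurableT _ (@integrable_norm _ _ _ mu setT _ gi)).
have [I1 I2] : (\int[mu]_x complex.Re (f t x))%R = 0 /\ (\int[mu]_x complex.Im (f t x))%R = 0.
  by have := f0 t; rewrite /cintegral => -[-> ->].
apply: (LP_dominatedW C0 HC f1i f2i (ni _ f1i) (ni _ f2i)).
- by move=> x; rewrite mulr_ge0.
- by move=> x; rewrite mulr_ge0.
- by move=> x; apply: component_dominates => // y /(outside t)[].
- by move=> x; apply: component_dominates => // y /(outside t)[].
Qed.

Let G := square_function [set p : nat * int | 2 ^ p.2 < (b - a)^-1]
  (fun p => low_majorant p.1 p.2).
Let F := square_function [set: nat] (fun t x => cmod (f t x)).

Let k0_ : exists k0 : int, forall k : int, (2 ^ k < (b - a)^-1) = (k < k0).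
Proof.
have [k0 H] := @dyadic_threshold R (b - a)^-1 ltac:(by rewrite invr_gt0 subr_gt0).
by exists k0 => k; rewrite !ltNge H.
Qed.

Lemma low_square_functionE : exists k0 : int, (forall k : int, (2 ^ k < (b - a)^-1) = (k < k0)) /\
  forall x, G x = sqrte (\sum_(0 <= t <oo) \sum_(0 <= i <oo)
    (low_majorant t (k0 - i.+1%:Z) x ^+ 2)%:E)%E.
Proof.
have [k0 H] := k0_; exists k0; split=> // x.
rewrite /G /square_function.
rewrite (_ : [set p | _] = [set p : nat * int | [set k : int | k < k0] p.2]); last first.
  by apply/seteqP; split => p /=; rewrite H.
rewrite (esum_pairs (a := fun t k => (low_majorant t k x ^+ 2)%:E) (int_lt_bij k0))//.
by move=> t k; rewrite lee_fin sqr_ge0.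
Qed.

Lemma low_square_function_le x : (G x <= F x)%E.
Proof.
have [k0 [H ->]] := low_square_functionE.
rewrite [F x](square_functionE f) lee_sqrt; last first.
  by apply: nneseries_ge0 => t _ _; rewrite lee_fin sqr_ge0.
apply: lee_nneseries => t *.
  by apply: nneseries_ge0 => i _ _; rewrite lee_fin sqr_ge0.
apply: lime_le; first by apply: is_cvg_nneseries => i _ _; rewrite lee_fin sqr_ge0.
near=> n; rewrite big_mkord sumEFin lee_fin.
set u := `|complex.Re (f t x)|; set v := `|complex.Im (f t x)|.
have uv : cmod (f t x) ^+ 2 = u ^+ 2 + v ^+ 2.
  by rewrite cmod_sqr /u /v !real_normK ?num_real.
have L0 : 0 < b - a by rewrite subr_gt0.
have kL : 2 ^ (k0 - 1) * (b - a) <= 1.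
  by rewrite -ler_pdivlMr// mul1r ltW// H gtrDl oppr_lt0.
have k00 : 0 <= 2 ^ (k0 - 1) * (b - a) by rewrite mulr_ge0 ?ltW// exprz_gt0.
apply: (@le_trans _ _ (\sum_(i < n) (cmod (f t x) ^+ 2 / 2 * (2 ^+ i)^-1))).
  apply: ler_sum => i _; rewrite /low_majorant -/u -/v.
  have -> : 2 ^ (k0 - i.+1%:Z) = 2 ^ (k0 - 1) * (2 ^+ i)^-1 :> R.
    rewrite exprnN -expfzDr ?pnatr_eq0//; congr (_ ^ _).
    by rewrite -addn1 PoszD opprD addrA addrAC.
  set p := 2 ^ (k0 - 1) in kL k00 *; set q := (2 ^+ i)^-1.
  have q0 : 0 <= q by rewrite invr_ge0 exprn_ge0.
  have q1 : q <= 1 by rewrite invf_le1 ?exprn_gt0// exprn_ege1// ler1n.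
  have -> : (p * q * (b - a) / 2 * u + p * q * (b - a) / 2 * v) ^+ 2 =
    (p * (b - a)) ^+ 2 * ((u + v) ^+ 2 / 4 * (q * q)) by field.
  apply: (@le_trans _ _ ((u + v) ^+ 2 / 4 * (q * q))).
    apply: ler_piMl; first by apply: mulr_ge0; [apply: divr_ge0; rewrite ?sqr_ge0|exact: mulr_ge0].
    by rewrite expr_le1.
  rewrite uv; apply: ler_pM.
  - by rewrite divr_ge0 ?sqr_ge0.
  - exact: mulr_ge0.
  - have H2 : 0 <= (u - v) ^+ 2 by exact: sqr_ge0.
    have -> : (u ^+ 2 + v ^+ 2) / 2 = (u + v) ^+ 2 / 4 + (u - v) ^+ 2 / 4 by field.
    by rewrite lerDl divr_ge0.
  - by rewrite ler_piMl.
rewrite -mulr_sumr.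
have -> : cmod (f t x) ^+ 2 = cmod (f t x) ^+ 2 / 2 * 2 by field.
rewrite mulrK ?unitfE//; apply: ler_wpM2l; last exact: half_sum_le.
by rewrite divr_ge0 ?sqr_ge0.
Unshelve. all: by end_near. Qed.

Lemma measurable_low_square_function : measurable_fun [set: R] G.
Proof.
have [k0 [H GE]] := low_square_functionE.
apply: (@eq_measurable_fun _ _ _ _ _ (fun x => sqrte (\sum_(0 <= t <oo) \sum_(0 <= i <oo)
    (low_majorant t (k0 - i.+1%:Z) x ^+ 2)%:E)%E)).
  by move=> x _; rewrite GE.
have S0 t x : (0 <= \sum_(0 <= i <oo) (low_majorant t (k0 - i.+1%:Z) x ^+ 2)%:E)%E.
  by apply: nneseries_ge0 => i _ _; rewrite lee_fin sqr_ge0.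
apply: measurable_sqrte => [x|]; first exact: nneseries_ge0.
apply: (@ge0_emeasurable_sum _ _ _ _ (fun t x => (\sum_(0 <= i <oo)
  (low_majorant t (k0 - i.+1%:Z) x ^+ 2)%:E)%E) xpredT) => [t x _ _|t _]; first exact: S0.
exact (measurable_nneseries_EFin (fun i => measurable_funX 2 (mlow t _)) (fun i x => sqr_ge0 _)).
Qed.

Lemma low_orlicz_le (s alpha : R) : 0 <= s -> 0 < alpha ->
  (\int[mu]_x ePhi s ((alpha^-1)%:E * G x) <=
   \int[mu]_(x in itvJ l r a b) ePhi s (`|F x| * (alpha^-1)%:E))%E.
Proof.
move=> s0 al0; have F0 := square_function_ge0 f.
under [leRHS]eq_integral do rewrite gee0_abs ?F0//.
rewrite [leRHS]integral_mkcond.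
have a0 : (0 <= (alpha^-1)%:E)%E by rewrite lee_fin invr_ge0 ltW.
have mF := measurable_square_function mf.
have mJ := measurable_itvJ l r a b.
have G0 x : (0 <= G x)%E by rewrite /G /square_function sqrte_ge0.
apply: ge0_le_integral => //.
- by move=> x _; apply: ePhi_ge0; rewrite mule_ge0.
- apply: measurable_ePhi.
  exact (emeasurable_funM (measurable_cst _) measurable_low_square_function).
- apply/(measurable_restrictT _ mJ); apply: measurable_funTS; apply: measurable_ePhi.
  exact (emeasurable_funM mF (measurable_cst _)).
move=> x _; rewrite patchE; case: ifPn => [_|/negP xJ].
  rewrite muleC; apply: ePhi_le => //; first by rewrite mule_ge0.
  by apply: lee_wpmul2r => //; exact: low_square_function_le.
have -> : G x = 0%E.
  apply/eqP; rewrite eq_le G0 andbT; apply: (le_trans (low_square_function_le x)).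
  by rewrite [F x](square_function_out sf)// => xJ'; apply: xJ; rewrite inE.
by rewrite mule0 /ePhi/= Phi0.
Qed.

End low_frequencies.

(** * High frequencies *)

Section luxemburg_bound.
Context {R : realType}.
Notation mu := (@lebesgue_measure R).

Lemma ePhi_div (s c t : R) (u : \bar R) : 0 <= s -> 1 <= c -> 0 < t -> (0 <= u)%E ->
  (ePhi s (u * ((c * t)^-1)%:E) <= (c^-1)%:E * ePhi s (u * (t^-1)%:E))%E.
Proof.
move=> s0 c1 t0; have c0 : 0 < c by lra.
case: u => [u u0| _|//]; last first.
  by rewrite !gt0_mulye ?lte_fin ?invr_gt0 ?mulr_gt0//= gt0_muley// lte_fin invr_gt0.
rewrite -!EFinM !lee_fin/= [leRHS]mulrC.
rewrite (_ : u / (c * t) = u / t / c); last by field; rewrite !gt_eqF.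
by apply: Phi_div => //; rewrite divr_ge0// ltW.
Qed.

Lemma luxemburg_le (s c t L M : R) (K : set (measurableTypeR R)) (G : R -> \bar R) :
  0 <= s -> 1 <= c -> 0 < t -> measurable K -> mu K = M%:E -> 0 < L -> L <= M ->
  (forall x, 0 <= G x)%E -> measurable_fun [set: R] G ->
  (\int[mu]_x ePhi s (G x * (t^-1)%:E) <= (c * L)%:E)%E ->
  (luxemburg s K G <= (c * t)%:E)%E.
Proof.
move=> s0 c1 t0 mK KM L0 LM G0 mG GL; have c0 : 0 < c by lra.
apply: ereal_inf_lbound; exists (c * t) => //; split; first exact: mulr_gt0.
rewrite KM/=.
under eq_integral do rewrite gee0_abs//.
rewrite lee_pdivrMl; last exact: lt_le_trans LM.
rewrite mule1.
have tt0 : (0 <= (t^-1)%:E)%E by rewrite lee_fin invr_ge0 ltW.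
have ct0 : (0 <= ((c * t)^-1)%:E)%E by rewrite lee_fin invr_ge0 mulr_ge0// ltW.
have mGt (d : R) : measurable_fun [set: R] (fun x => ePhi s (G x * d%:E)%E).
  by apply: measurable_ePhi; exact (emeasurable_funM mG (measurable_cst _)).
have U0 x : (0 <= ePhi s (G x * (t^-1)%:E))%E by rewrite ePhi_ge0// mule_ge0.
apply: (@le_trans _ _ (\int[mu]_x ((c^-1)%:E * ePhi s (G x * (t^-1)%:E)))%E).
  apply: (@le_trans _ _ (\int[mu]_x ePhi s (G x * ((c * t)^-1)%:E))%E).
    apply: ge0_subset_integral => //.
    - exact: mGt.
    - by move=> x _; rewrite ePhi_ge0// mule_ge0.
  apply: ge0_le_integral => //.
  - by move=> x _; rewrite ePhi_ge0// mule_ge0.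
  - exact: mGt.
  - exact (emeasurable_funM (measurable_cst _) (mGt _)).
  by move=> x _; exact: ePhi_div.
rewrite ge0_integralZl//; [|exact: mGt|by rewrite lee_fin invr_ge0 ltW].
apply: (@le_trans _ _ ((c^-1)%:E * (c * L)%:E)%E).
  by apply: lee_wpmul2l => //; rewrite lee_fin invr_ge0 ltW.
by rewrite -EFinM lee_fin mulKf// gt_eqF.
Qed.

Lemma LP_dominatedS (eta : R -> R) (C C' : R) (k : int) (f : R -> R[i]) (g : R -> R) :
  C <= C' -> (forall y, 0 <= g y) -> LP_dominated eta C k f g -> LP_dominated eta C' k f g.
Proof.
move=> CC' g0 H x; have [H1 H2] := H x; split => //.
apply: (le_trans H2); rewrite ler_wpM2r//; apply: Rintegral_ge0 => y _.
by rewrite mulr_ge0// ltW// phi_scaled_gt0// exprz_gt0.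
Qed.

Lemma itv4J_measure (l r : bool) (a b : R) : a < b -> mu (itv4J l r a b) = (4 * (b - a))%:E.
Proof.
move=> ab; rewrite /itv4J [mu _]itvJ_measure; last by lra.
by congr (_%:E); ring.
Qed.

Lemma itvJ_sub4 (l r : bool) (a b : R) : a < b -> itvJ l r a b `<=` itv4J l r a b.
Proof.
move=> ab x /itvJ_bounds /andP[ax xb].
by rewrite /itv4J /itvJ/= in_itv/=; apply/andP; split;
  [case: l|case: r] => /=; lra.
Qed.

Lemma high_square_functionE (L : R) : 0 < L ->
  exists2 h : R, 0 < h & 2 * h <= L /\ forall (u : R -> nat -> R -> R) x,
    square_function [set p : nat * int | L^-1 <= 2 ^ p.2]
      (fun p => u (2 ^ (- p.2) / 4) p.1) x =
    sqrte (\sum_(0 <= t <oo) \sum_(0 <= i <oo) (u (h / 2 ^+ i) t x ^+ 2)%:E)%E.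
Proof.
move=> L0; have [k0 H] := @dyadic_threshold R L^-1 ltac:(by rewrite invr_gt0).
have p0 : 0 < 2 ^ (- k0) :> R by exact: exprz_gt0.
exists (2 ^ (- k0) / 4); first by rewrite divr_gt0.
split.
  have : 2 ^ (- k0) <= L.
    by rewrite -invr_expz -[leRHS]invrK lef_pV2 ?posrE ?invr_gt0 ?exprz_gt0// H.
  by move: p0; move: (2 ^ (- k0)) => p; lra.
move=> u x; rewrite /square_function.
rewrite (_ : [set p | _] = [set p : nat * int | [set k : int | k0 <= k] p.2]); last first.
  by apply/seteqP; split => p /=; rewrite H.
rewrite (esum_pairs (a := fun t k => (u (2 ^ (- k) / 4) t x ^+ 2)%:E) (int_ge_bij k0)); last first.
  by move=> t k; rewrite lee_fin sqr_ge0.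
congr sqrte; apply: eq_eseriesr => t _; apply: eq_eseriesr => i _.
congr ((u _ t x ^+ 2)%:E).
by rewrite opprD expfzDr ?pnatr_eq0// -exprnN mulrAC.
Qed.

End luxemburg_bound.

Section high_frequencies.
Context {R : realType}.
Notation mu := (@lebesgue_measure R).
Notation integrable f := (mu.-integrable [set: R] (EFin \o f)).
Variables (eta : R -> R) (C : R).
Hypotheses (C0 : 0 < C) (HC : forall (k : int) (f : R -> R[i]),
  integrable (fun x => complex.Re (f x)) -> integrable (fun x => complex.Im (f x)) ->
  forall x, cmod (LP_proj eta k f x) <=
    C * (\int[mu]_y (phi_scaled (2 ^ (- k)) (x - y) *
      (`|davg (2 ^ (- k) / 4) (fun z => complex.Re (f z)) y| +
       `|davg (2 ^ (- k) / 4) (fun z => complex.Im (f z)) y|)))%R).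

Variables (f : nat -> R -> R[i]).
Let f1 t x := complex.Re (f t x).
Let f2 t x := complex.Im (f t x).
Hypotheses (fi1 : forall t, integrable (f1 t)) (fi2 : forall t, integrable (f2 t)).

Section abstract_levels.
Variables (E : nat -> set (measurableTypeR R)) (p q : R) (lam : nat -> R).
Hypotheses (mE : forall j, measurable (E j)) (tE : trivIset setT E)
  (Epq : forall j, E j `<=` `[p, q]) (lam0 : forall j, 0 <= lam j)
  (f12 : forall j n x, E j x -> \sum_(t < n) (f1 t x ^+ 2 + f2 t x ^+ 2) <= lam j ^+ 2)
  (fE : {ae mu, forall x t, f t x != 0 -> exists j, E j x}).

Let level_bound (g : nat -> R -> R) : (forall t x, g t x ^+ 2 <= f1 t x ^+ 2 + f2 t x ^+ 2) ->
  forall t j x, E j x -> `|g t x| <= lam j.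
Proof.
move=> gf t j x jx; apply: (level_component_le lam0) => n.
by apply: le_trans (f12 n jx); apply: ler_sum => i _.
Qed.

Let f1_le t x : f1 t x ^+ 2 <= f1 t x ^+ 2 + f2 t x ^+ 2.
Proof. by rewrite lerDl sqr_ge0. Qed.

Let f2_le t x : f2 t x ^+ 2 <= f1 t x ^+ 2 + f2 t x ^+ 2.
Proof. by rewrite lerDr sqr_ge0. Qed.

Let f1E t : {ae mu, forall x, f1 t x != 0 -> exists j, E j x}.
Proof.
apply: (@filterS _ _ (ae_filter_ringOfSetsType mu) _ _ _ fE) => x H n0; apply: (H t).
by apply: contra n0 => /eqP ft0; rewrite /f1 ft0.
Qed.

Let f2E t : {ae mu, forall x, f2 t x != 0 -> exists j, E j x}.
Proof.
apply: (@filterS _ _ (ae_filter_ringOfSetsType mu) _ _ _ fE) => x H n0; apply: (H t).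
by apply: contra n0 => /eqP ft0; rewrite /f2 ft0.
Qed.

Lemma layer_ge0 h t x : 0 < h -> 0 <= layer E f1 f2 h t x.
Proof.
move=> h0; apply: addr_ge0.
- exact: (family_transplant_ge0 mE tE Epq h0).
- exact: (family_transplant_ge0 mE tE Epq h0).
Qed.

Lemma measurable_layer h t : 0 < h -> measurable_fun [set: R] (layer E f1 f2 h t).
Proof.
move=> h0; apply: measurable_funD.
- exact: (measurable_family_transplant mE tE Epq h0 (fi1 t) lam0 (level_bound f1_le t)).
- exact: (measurable_family_transplant mE tE Epq h0 (fi2 t) lam0 (level_bound f2_le t)).
Qed.

Lemma layer_out h t x : (forall j, ~ E j x) -> layer E f1 f2 h t x = 0.
Proof. by move=> nx; rewrite /layer !family_transplant_out// addr0. Qed.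

Lemma layer_dominated k t :
  LP_dominated eta (C * 3) k (f t) (layer E f1 f2 (2 ^ (- k) / 4) t).
Proof.
have t0 : 0 < 2 ^ (- k) :> R by exact: exprz_gt0.
have h0 : 0 < 2 ^ (- k) / 4 :> R by rewrite divr_gt0.
have ht : 2 ^ (- k) / 4 <= 2 ^ (- k) :> R.
  by move: t0; move: (2 ^ (- k)) => c; lra.
apply: (LP_dominatedW C0 HC (fi1 t) (fi2 t)).
- exact: (integrable_family_transplant mE tE Epq h0 (fi1 t) lam0 (level_bound f1_le t)).
- exact: (integrable_family_transplant mE tE Epq h0 (fi2 t) lam0 (level_bound f2_le t)).
- by move=> x; exact: (family_transplant_ge0 mE tE Epq h0).
- by move=> x; exact: (family_transplant_ge0 mE tE Epq h0).
- move=> x; exact: (family_transplant_dominates mE tE Epq h0 (fi1 t) lam0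
    (level_bound f1_le t) (f1E t) x t0 ht).
- move=> x; exact: (family_transplant_dominates mE tE Epq h0 (fi2 t) lam0
    (level_bound f2_le t) (f2E t) x t0 ht).
Qed.

Lemma measurable_layers h : 0 < h -> measurable_fun [set: R]
  (fun x => \sum_(0 <= t <oo) \sum_(0 <= i <oo) (layer E f1 f2 (h / 2 ^+ i) t x ^+ 2)%:E)%E.
Proof.
move=> h0; have hi i : 0 < h / 2 ^+ i by rewrite divr_gt0 ?exprn_gt0.
apply: (@ge0_emeasurable_sum _ _ _ _ (fun t x => (\sum_(0 <= i <oo)
  (layer E f1 f2 (h / 2 ^+ i) t x ^+ 2)%:E)%E) xpredT) => [t x _ _|t _].
  by apply: nneseries_ge0 => i _ _; rewrite lee_fin sqr_ge0.
exact (measurable_nneseries_EFin (fun i => measurable_funX 2 (measurable_layer t (hi i)))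
  (fun i x => sqr_ge0 _)).
Qed.

End abstract_levels.
End high_frequencies.

Section dyadic_levels.
Context {R : realType}.
Notation mu := (@lebesgue_measure R).
Variables (J : set (measurableTypeR R)) (F : R -> \bar R) (t0 : R).
Hypotheses (mJ : measurable J) (mF : measurable_fun [set: R] F)
  (F0 : forall x, (0 <= F x)%E) (t00 : 0 < t0).

Definition level_range (j : nat) : set (\bar R) :=
  if j is i.+1 then [set` `](t0 * 2 ^+ i)%:E, (t0 * 2 ^+ j)%:E] ]
  else [set` `]-oo, t0%:E] ].

Definition level (j : nat) : set (measurableTypeR R) := J `&` F @^-1` level_range j.

Lemma measurable_level j : measurable (level j).
Proof.
have mP (A : set (\bar R)) : measurable A -> measurable (J `&` F @^-1` A).
  move=> mA; have := mF measurableT mA; rewrite setTI => mFA.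
  exact: measurableI.
by apply: mP; case: j => [|j]; exact: emeasurable_itv.
Qed.

Lemma level_le j x : level j x -> (F x <= (t0 * 2 ^+ j)%:E)%E.
Proof.
move=> [_]; case: j => [|j]; rewrite /level_range/= in_itv/=; first by rewrite mulr1.
by move=> /andP[].
Qed.

Lemma level_gt j x : level j.+1 x -> ((t0 * 2 ^+ j)%:E < F x)%E.
Proof. by move=> [_]; rewrite /level_range/= in_itv/= => /andP[]. Qed.

Lemma trivIset_level : trivIset setT level.
Proof.
have lt_absurd i j x : (i < j)%N -> level i x -> level j x -> False.
  case: j => // j; rewrite ltnS => ij /level_le Fi /level_gt Fj.
  have := lt_le_trans Fj Fi; rewrite lte_fin ltNge ler_wpM2l ?(ltW t00)//.
  by rewrite ler_weXn2l// ler1n.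
move=> i j _ _ [x [ix jx]]; apply/eqP; case: ltngtP => // ij; exfalso.
- exact: lt_absurd ij ix jx.
- exact: lt_absurd ij jx ix.
Qed.

Lemma level_cover x : J x -> (F x < +oo)%E -> exists j, level j x.
Proof.
move=> Jx Fx.
have FE : F x = (fine (F x))%:E by rewrite fineK// ge0_fin_numE.
have ex : exists j, fine (F x) <= t0 * 2 ^+ j.
  have r0 : 0 <= fine (F x) / t0 by rewrite divr_ge0 ?fine_ge0// ltW.
  exists (Num.bound (fine (F x) / t0)).
  rewrite -ler_pdivrMl// mulrC; apply: (le_trans (ltW (archi_boundP r0))).
  by rewrite -natrX ler_nat ltnW// ltn_expl.
case: (ex_minnP ex) => j Fj jmin; exists j; split => //.
case: j Fj jmin => [|j] Fj jmin; rewrite /level_range/= in_itv/= FE.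
  by move: Fj; rewrite expr0 mulr1 lee_fin.
rewrite lee_fin Fj andbT lte_fin ltNge; apply/negP => Fj'.
by have := jmin _ Fj'; rewrite ltnn.
Qed.

End dyadic_levels.

Section high_frequency_bound.
Context {R : realType}.
Notation mu := (@lebesgue_measure R).
Notation integrable f := (mu.-integrable [set: R] (EFin \o f)).
Variables (eta : R -> R) (C : R).
Hypotheses (C0 : 0 < C) (HC : forall (k : int) (f : R -> R[i]),
  integrable (fun x => complex.Re (f x)) -> integrable (fun x => complex.Im (f x)) ->
  forall x, cmod (LP_proj eta k f x) <=
    C * (\int[mu]_y (phi_scaled (2 ^ (- k)) (x - y) *
      (`|davg (2 ^ (- k) / 4) (fun z => complex.Re (f z)) y| +
       `|davg (2 ^ (- k) / 4) (fun z => complex.Im (f z)) y|)))%R).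

Variables (l r : bool) (a b : R) (f : nat -> R -> R[i]) (s : R) (n : nat).
Hypotheses (ab : a < b) (mf : forall t, cmeasurable (f t))
  (sf : forall t, supported_in (f t) (itvJ l r a b))
  (s0 : 0 <= s) (n0 : (0 < n)%N) (sn : s + 1 / 2 <= n%:R).

Let J := itvJ l r a b.
Let F := square_function [set: nat] (fun t x => cmod (f t x)).
Let f1 t x := complex.Re (f t x).
Let f2 t x := complex.Im (f t x).
Let L := b - a.

Hypothesis finF : (luxemburg (s + 1 / 2) J F < +oo)%E.

Let L0 : 0 < L. Proof. by rewrite subr_gt0. Qed.

Let mJ : measurable (J : set (measurableTypeR R)) := measurable_itvJ l r a b.

Let fi : forall t, integrable (f1 t) /\ integrable (f2 t).
Proof.
have [t0 [t00 _ adm]] := luxemburg_lt ab finF.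
have s'0 : 0 <= s + 1 / 2 by rewrite addr_ge0.
exact: (integrable_component mf sf s'0 t00 adm).
Qed.

Definition orlicz_constant : R :=
  721 * (n%:R ^+ n * expR 1) * 3 `^ s * (1 + 2 * 6 `^ (s + 1 / 2) + 8 * n%:R ^+ n).

Let G (g : nat -> int -> R -> R) :=
  square_function [set p : nat * int | L^-1 <= 2 ^ p.2] (fun p => g p.1 p.2).

Definition dominating (B : R) (g : nat -> int -> R -> R) : Prop :=
  forall t k, [/\ measurable_fun [set: R] (g t k), supported_in (g t k) J,
    forall x, 0 <= g t k x & LP_dominated eta B k (f t) (g t k)].

Lemma admissible_dominating (t0 : R) : 0 < t0 ->
  (\int[mu]_(x in J) ePhi (s + 1 / 2) (F x * (t0^-1)%:E) <= L%:E)%E ->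
  exists2 g, dominating (C * 3) g & measurable_fun [set: R] (G g) /\
    (\int[mu]_x ePhi s (G g x * (t0^-1)%:E) <= (orlicz_constant * L)%:E)%E.
Proof.
move=> t00 adm.
have s'0 : 0 <= s + 1 / 2 by rewrite addr_ge0.
have mF := measurable_square_function mf.
have F0 := square_function_ge0 f.
pose E := level J F t0.
have mE j : measurable (E j) by exact: measurable_level.
have tE : trivIset setT E by exact: trivIset_level.
have EJ j : E j `<=` J by move=> x [].
have Eab j : E j `<=` `[a, b] by move=> x /EJ /itvJ_bounds; rewrite /= in_itv.
pose lam j := t0 * 2 ^+ j.
have lam0 j : 0 <= lam j by rewrite mulr_ge0 ?exprn_ge0// ltW.
have f12 j m x : E j x -> \sum_(t < m) (f1 t x ^+ 2 + f2 t x ^+ 2) <= lam j ^+ 2.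
  by move=> jx; exact: (square_function_partial m (lam0 j) (level_le jx)).
have fE : {ae mu, forall x t, f t x != 0 -> exists j, E j x}.
  have H := square_function_fin mf s'0 t00 adm.
  apply: (@filterS _ _ (ae_filter_ringOfSetsType mu) _ _ _ H) => x Fx t ft.
  have Jx : J x by apply: contrapT => nJx; move: ft; rewrite (@sf t x nJx) eqxx.
  by apply: level_cover => //; exact: Fx.
have fi1 t := (fi t).1; have fi2 t := (fi t).2.
have pk k : 0 < 2 ^ (- k) / 4 :> R by rewrite divr_gt0// exprz_gt0.
have [h h0 [hL GE]] := high_square_functionE L0.
pose S x := (\sum_(0 <= t <oo) \sum_(0 <= i <oo) (layer E f1 f2 (h / 2 ^+ i) t x ^+ 2)%:E)%E.
have S0 x : (0 <= S x)%E.
  by apply: nneseries_ge0 => t _ _; apply: nneseries_ge0 => i _ _; rewrite lee_fin sqr_ge0.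
have mS : measurable_fun [set: R] S.
  exact: (measurable_layers fi1 fi2 mE tE Eab lam0 f12 h0).
have Sout x : (forall j, ~ E j x) -> S x = 0%E.
  move=> nx; rewrite /S eseries0// => t _ _; rewrite eseries0// => i _ _.
  by rewrite layer_out// expr0n.
exists (fun t k => layer E f1 f2 (2 ^ (- k) / 4) t).
  move=> t k; split.
  - exact: (measurable_layer fi1 fi2 mE tE Eab lam0 f12 t (pk k)).
  - by move=> x nJ; apply: layer_out => j /EJ.
  - by move=> x; exact: (layer_ge0 f mE tE Eab t x (pk k)).
  - exact: (layer_dominated C0 HC fi1 fi2 mE tE Eab lam0 f12 fE).
have GS x : G (fun t k => layer E f1 f2 (2 ^ (- k) / 4) t) x = sqrte (S x).
  exact: (GE (layer E f1 f2)).
split.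
  apply: (@eq_measurable_fun _ _ _ _ _ (fun x => sqrte (S x))); first by move=> x _; rewrite GS.
  exact: measurable_sqrte.
under eq_integral do rewrite GS.
have JL : mu J = L%:E by exact: itvJ_measure.
apply: (orlicz_levels_le mE tE EJ mJ JL t00 s0 n0 sn F0 mF _ adm S0 mS Sout).
- by move=> j x; exact: level_gt.
- move=> j; apply: (level_square_le mE tE (ltW ab) Eab lam0 _ _ f12 h0 hL).
  + by move=> t; exact: (mf t).1.
  + by move=> t; exact: (mf t).2.
Qed.

(* When the norm of [F] vanishes no [t0] is comparable to it; empty levels serve
   instead. *)
Lemma null_dominating : luxemburg (s + 1 / 2) J F = 0%E ->
  dominating (C * 3) (fun _ _ _ => 0).
Proof.
move=> N0.
have s'0 : 0 <= s + 1 / 2 by rewrite addr_ge0.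
have mF := measurable_square_function mf.
have F0 := square_function_ge0 f.
have IF : (\int[mu]_(x in J) F x = 0)%E.
  apply/eqP; rewrite eq_le integral_ge0// andbT.
  apply/lee_addgt0Pr => e e0; rewrite add0e.
  have /(luxemburg_lt ab)[t0 [t00 te adm]] : (luxemburg (s + 1 / 2) J F < (e / L)%:E)%E.
    by rewrite N0 lte_fin divr_gt0.
  apply: (le_trans (integral_square_function_le mf s'0 t00 adm)).
  by rewrite lee_fin -ler_pdivlMr// ltW.
have FJ : {ae mu, forall x, J x -> F x = 0%E}.
  have mFJ : measurable_fun J F by exact: (measurable_funTS mF).
  have absF : (\int[mu]_(x in J) `|F x| = 0)%E.
    by under eq_integral do rewrite gee0_abs//.
  exact ((ae_eq_integral_abs mu mJ mFJ).1 absF).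
pose E := (fun=> set0) : nat -> set (measurableTypeR R).
have fE : {ae mu, forall x t, f t x != 0 -> exists j, E j x}.
  apply: (@filterS _ _ (ae_filter_ringOfSetsType mu) _ _ _ FJ) => x Fx t /eqP ft; exfalso.
  have Jx : J x by apply: contrapT => nJx; apply: ft; exact: sf.
  apply: ft.
  have := cmod_le_square_function f t x; rewrite [X in (_ <= X)%E](Fx Jx) lee_fin.
  rewrite -[leLHS]ger0_norm; last by rewrite /cmod; case: (f t x) => u v; exact: sqrtr_ge0.
  by rewrite normr_le0 => /eqP; exact: ComplexField.Normc.eq0_normc.
have mE j : measurable (E j) by exact: measurable0.
have tE : trivIset setT E by move=> i j _ _ [x []].
have Eab j : E j `<=` `[a, b] by [].
have f12 j m x : E j x -> \sum_(t < m) (f1 t x ^+ 2 + f2 t x ^+ 2) <= (fun=> 0 : R) j ^+ 2 by [].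
have fi1 t := (fi t).1; have fi2 t := (fi t).2.
move=> t k; split => //.
have := layer_dominated C0 HC fi1 fi2 mE tE Eab (fun=> lexx 0) f12 fE k t.
rewrite (_ : layer _ _ _ _ _ = (fun=> 0))//.
by apply/funext => x; apply: layer_out => j [].
Qed.

Lemma high_frequency_bound (c : R) : 1 <= c -> orlicz_constant <= c ->
  exists2 g, dominating (C * 3) g &
    forall K (M : R), measurable (K : set (measurableTypeR R)) -> mu K = M%:E -> L <= M ->
      (luxemburg s K (G g) <= (2 * c)%:E * luxemburg (s + 1 / 2) J F)%E.
Proof.
move=> c1 oc; have c0 : 0 < c by exact: lt_le_trans c1.
have N0 : (0 <= luxemburg (s + 1 / 2) J F)%E.
  by apply: le_ereal_inf_tmp => _ [t [t0 _] <-]; rewrite lee_fin ltW.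
have G0 g x : (0 <= G g x)%E by rewrite /G /square_function sqrte_ge0.
have [Z|NZ] := eqVneq (luxemburg (s + 1 / 2) J F) 0%E.
  exists (fun _ _ _ => 0); first exact: null_dominating.
  move=> K M mK KM LM; rewrite Z mule0.
  have GZ : G (fun _ _ _ => 0) = (fun=> 0%E).
    apply/funext => x; rewrite /G /square_function esum1 ?/= ?sqrtr0//.
    by move=> p _; rewrite expr0n.
  apply/lee_addgt0Pr => e e0; rewrite add0e -[e]mul1r.
  apply: (luxemburg_le (L := L) s0 _ e0 mK KM L0 LM (G0 _)) => //.
    by rewrite GZ; exact: measurable_cst.
  rewrite GZ; under eq_integral do rewrite mul0e /ePhi/= Phi0.
  by rewrite integral0 lee_fin mul1r ltW.
have [N NE] : exists N : R, luxemburg (s + 1 / 2) J F = N%:E.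
  by exists (fine (luxemburg (s + 1 / 2) J F)); rewrite fineK// ge0_fin_numE.
have Np : 0 < N by rewrite -lte_fin -NE lt0e NZ.
have /(luxemburg_lt ab)[t0 [t00 tN adm]] : (luxemburg (s + 1 / 2) J F < (2 * N)%:E)%E.
  by rewrite NE lte_fin; lra.
have [g dg [mG GL]] := admissible_dominating t00 adm.
exists g => // K M mK KM LM; rewrite NE.
apply: (@le_trans _ _ (c * t0)%:E).
  apply: (luxemburg_le (L := L) s0 c1 t00 mK KM L0 LM (G0 _) mG).
  by apply: (le_trans GL); rewrite lee_fin ler_wpM2r// ltW.
by rewrite -EFinM lee_fin (mulrC 2) -mulrA ler_wpM2l// ltW.
Qed.

End high_frequency_bound.

Theorem proposition3p6 (R : realType) (sigma : nat) (eta : R -> R)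
    (heta : LP_symbol eta) :
  exists2 C : R, 0 < C &
  forall (l r : bool) (a b : R), a < b ->
  let mu := @lebesgue_measure R in
  let J := itvJ l r a b in
  let J4 := itv4J l r a b in
  let lenJ := b - a in
  forall f : nat -> R -> R[i],
  (forall tau, cmeasurable (f tau)) ->
  (forall tau, supported_in (f tau) J) ->
  let F := square_function [set: nat] (fun tau x => cmod (f tau x)) in
  (luxemburg (sigma.+1%:R / 2) J F < +oo)%E ->
  (exists g : nat -> int -> R -> R,
     let G := square_function
                [set p : nat * int | lenJ^-1 <= (2 : R) ^ p.2]
                (fun p => g p.1 p.2) in
     [/\ forall tau k, lenJ^-1 <= (2 : R) ^ k ->
           [/\ measurable_fun [set: R] (g tau k),
               supported_in (g tau k) J4 &
               LP_dominated eta C k (f tau) (g tau k)],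
         (luxemburg (sigma%:R / 2) J G
            <= C%:E * luxemburg (sigma.+1%:R / 2) J F)%E &
         (luxemburg (sigma%:R / 2) J4 G
            <= C%:E * luxemburg (sigma.+1%:R / 2) J F)%E])
  /\
  ((forall tau, cintegral (f tau) = 0) ->
   exists g : nat -> int -> R -> R,
     let G := square_function
                [set p : nat * int | (2 : R) ^ p.2 < lenJ^-1]
                (fun p => g p.1 p.2) in
     (forall tau k, (2 : R) ^ k < lenJ^-1 ->
        measurable_fun [set: R] (g tau k) /\
        LP_dominated eta C k (f tau) (g tau k)) /\
     (forall alpha : R, 0 < alpha ->
        ((lenJ^-1)%:E *
           \int[mu]_x ePhi (sigma%:R / 2) ((alpha^-1)%:E * G x)
         <= C%:E * ((lenJ^-1)%:E *
              \int[mu]_(x in J)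
                 ePhi (sigma%:R / 2) (`|F x| * (alpha^-1)%:E)))%E)).
Proof.
have [C C0 HC] := LP_proj_le heta.
set s : R := sigma%:R / 2.
have sE : sigma.+1%:R / 2 = s + 1 / 2 :> R by rewrite /s -mulrDl natr1.
have s0 : 0 <= s by rewrite divr_ge0.
have sn : s + 1 / 2 <= sigma.+1%:R.
  by rewrite -sE ler_pdivrMr// ler_peMr// ler1n.
pose c := 1 + `|orlicz_constant s sigma.+1|.
have c1 : 1 <= c by rewrite lerDl.
have oc : orlicz_constant s sigma.+1 <= c.
  by apply: (le_trans (ler_norm _)); rewrite lerDr.
exists (C * 216 + 2 * c); first by move: c1 C0; lra.
move=> l r a b ab mu J J4 lenJ f mf sf F; rewrite sE => finF.
have L0 : 0 < lenJ by rewrite subr_gt0.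
split.
  have [g dg lux] := high_frequency_bound C0 HC ab mf sf s0 (ltn0Sn sigma) sn finF c1 oc.
  have N0 : (0 <= luxemburg (s + 1 / 2) J F)%E.
    by apply: le_ereal_inf_tmp => _ [t [t0 _] <-]; rewrite lee_fin ltW.
  have Cc : ((2 * c)%:E * luxemburg (s + 1 / 2) J F <=
      (C * 216 + 2 * c)%:E * luxemburg (s + 1 / 2) J F)%E.
    by apply: lee_wpmul2r => //; rewrite lee_fin lerDr mulr_ge0// ltW.
  exists g; split.
  - move=> tau k _; have [mg sg g0 Dg] := dg tau k; split=> //.
      by move=> x nJ4; apply: sg => /(itvJ_sub4 ab).
    by apply: (LP_dominatedS _ g0 Dg); move: c1 C0; lra.
  - apply: le_trans Cc; apply: (lux J lenJ) => //.
      exact: measurable_itvJ.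
    exact: itvJ_measure.
  - apply: le_trans Cc; apply: (lux J4 (4 * lenJ)).
    + exact: measurable_itvJ.
    + exact: itv4J_measure.
    + by rewrite ler_peMl ?(ltW L0)// ler1n.
move=> f0.
have [t0 [t00 _ adm]] := luxemburg_lt ab finF.
have fi := integrable_component mf sf (addr_ge0 s0 (divr_ge0 ler01 (ler0n R 2))) t00 adm.
exists (low_majorant a b f); split.
  move=> tau k kL; split.
    have [m1 m2] := mf tau.
    by apply: measurable_funD; apply: measurable_funM => //; exact: measurableT_comp.
  apply: (LP_dominatedS _ _ (low_majorant_dominates C0 HC ab sf fi f0 tau kL)).
    by move: c1 C0; lra.
  move=> y; rewrite /low_majorant -mulrDr mulr_ge0//.
  by rewrite divr_ge0// mulr_ge0 ?(ltW (exprz_gt0 _ _)) ?subr_ge0 ?(ltW ab).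
move=> alpha al0.
have Z0 : (0 <= (lenJ^-1)%:E * \int[mu]_(x in J) ePhi s (`|F x| * (alpha^-1)%:E))%E.
  apply: mule_ge0; first by rewrite lee_fin invr_ge0 ltW.
  by apply: integral_ge0 => x _; apply: ePhi_ge0; rewrite mule_ge0// lee_fin invr_ge0 ltW.
apply: (@le_trans _ _ ((lenJ^-1)%:E * \int[mu]_(x in J) ePhi s (`|F x| * (alpha^-1)%:E))%E).
  apply: lee_wpmul2l; first by rewrite lee_fin invr_ge0 ltW.
  exact: low_orlicz_le.
by apply: lee_pemull => //; rewrite lee_fin; move: c1 C0; lra.
Qed.
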